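(* Let $d\ge1$ be an integer. For quasi-all functions $f\in L^1(\mathcal S_d)$ (i.e. for all $f$ in some residual subset of the Banach space $L^1(\mathcal S_d)$), the following holds: for every $\beta\in[0,d]$, $$\dim_{\mathcal H}\big(E(\beta,f)\big)=d-\beta.$$
   Context: $\mathcal S_d$ is the Euclidean unit sphere of $\mathbb R^{d+1}$ with the metric inherited from the Euclidean norm $\|\cdot\|$ of $\mathbb R^{d+1}$; $\sigma$ is the normalized Lebesgue (surface) measure on $\mathcal S_d$, and $L^1(\mathcal S_d)=L^1(\mathcal S_d,\sigma)$ with its usual norm. For $x$ in the open unit ball and $\xi\in\mathcal S_d$, the Poisson kernel is $P(x,\xi)=\frac{1-\|x\|^2}{\|x-\xi\|^{d+1}}$, and $P[f](x)=\int_{\mathcal S_d}P(x,\xi)f(\xi)\,d\sigma(\xi)$. For $f\in L^1(\mathcal S_d)$ and $\beta\in[0,d]$, $$E(\beta,f)=\Big\{y\in\mathcal S_d:\ \limsup_{r\to1^-}\frac{\log|P[f](ry)|}{-\log(1-r)}=\beta\Big\}$$ (with $\log 0=-\infty$). A subset of a Baire space is residual if it contains a countable intersection of dense open sets. The residual set does not depend on $\beta$. $\dim_{\mathcal H}$ denotes Hausdorff dimension (with $\dim_{\mathcal H}(\varnothing)=0$). *)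

(* Defs.v *)
From HB Require Import structures.
From mathcomp Require Import all_boot all_order all_algebra.
From mathcomp Require Import all_classical all_reals all_analysis.
From mathcomp Require Import measurable_realfun ring lra.
Set Implicit Arguments.
Unset Strict Implicit.
Unset Printing Implicit Defensive.
Import Order.TTheory GRing.Theory Num.Theory.
Import numFieldNormedType.Exports.
Local Open Scope classical_set_scope.
Local Open Scope ring_scope.

Section euclidean_norm.
Context {R : realType} {n : nat}.
Implicit Types x y : 'rV[R]_n.

(* The norm MathComp-Analysis puts on 'rV[R]_n is the sup norm. *)
Definition enorm x : R := Num.sqrt (\sum_(i < n) x ord0 i ^+ 2).

Lemma enorm_ge0 x : 0 <= enorm x.
Proof. exact: sqrtr_ge0. Qed.

Lemma sqr_enorm x : enorm x ^+ 2 = \sum_(i < n) x ord0 i ^+ 2.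
Proof. by rewrite sqr_sqrtr// sumr_ge0// => i _; exact: sqr_ge0. Qed.

Lemma enorm_eq0 x : enorm x = 0 -> x = 0.
Proof.
move=> x0; have : \sum_(i < n) x ord0 i ^+ 2 = 0 by rewrite -sqr_enorm x0 expr0n.
move/psumr_eq0P => x0i; apply/rowP => i; rewrite mxE; apply/eqP.
by rewrite -sqrf_eq0; apply/eqP/x0i => // j _; exact: sqr_ge0.
Qed.

Lemma enorm0 : enorm 0 = 0.
Proof. by rewrite /enorm big1 ?sqrtr0// => i _; rewrite mxE expr0n. Qed.

Lemma enormN x : enorm (- x) = enorm x.
Proof. by congr Num.sqrt; apply: eq_bigr => i _; rewrite mxE sqrrN. Qed.

Lemma cauchy_schwarz x y :
  \sum_(i < n) x ord0 i * y ord0 i <= enorm x * enorm y.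
Proof.
have [x0|x0] := eqVneq (enorm x) 0.
  rewrite x0 mul0r big1// => i _; by rewrite (enorm_eq0 x0) mxE mul0r.
have [y0|y0] := eqVneq (enorm y) 0.
  rewrite y0 mulr0 big1// => i _; by rewrite (enorm_eq0 y0) mxE mulr0.
set a := enorm x; set b := enorm y; set s := \sum_(i < n) _.
have ab0 : 0 < a * b by rewrite mulr_gt0// lt_neqAle eq_sym ?x0 ?y0 enorm_ge0.
have : 0 <= \sum_(i < n) (b * x ord0 i - a * y ord0 i) ^+ 2.
  by apply: sumr_ge0 => i _; exact: sqr_ge0.
rewrite (_ : \sum_(i < n) _ = 2 * (a * b) * (a * b - s)); last first.
  transitivity (b ^+ 2 * \sum_(i < n) x ord0 i ^+ 2 - 2 * (a * b) * s
      + a ^+ 2 * \sum_(i < n) y ord0 i ^+ 2).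
    rewrite !mulr_sumr -sumrB -big_split/=; apply: eq_bigr => i _; ring.
  rewrite -!sqr_enorm -/a -/b; ring.
have ab2 : 0 < 2 * (a * b) by rewrite mulr_gt0.
by rewrite (pmulr_rge0 _ ab2) subr_ge0.
Qed.

Lemma ler_enormD x y : enorm (x + y) <= enorm x + enorm y.
Proof.
rewrite -ler_sqr ?nnegrE ?addr_ge0 ?enorm_ge0//.
have -> : enorm (x + y) ^+ 2 =
    enorm x ^+ 2 + 2 * (\sum_(i < n) x ord0 i * y ord0 i) + enorm y ^+ 2.
  rewrite !sqr_enorm mulr_sumr -!big_split/=; apply: eq_bigr => i _.
  rewrite mxE; ring.
have := cauchy_schwarz x y; nra.
Qed.

End euclidean_norm.

Record sphere (R : realType) (d : nat) := Sphere {
  sphere_val :> 'rV[R]_d.+1 ;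
  _ : enorm sphere_val == 1 }.

HB.instance Definition _ (R : realType) (d : nat) :=
  [isSub for @sphere_val R d].
HB.instance Definition _ (R : realType) (d : nat) :=
  [Choice of sphere R d by <:].

Section sphere_metric.
Context {R : realType} {d : nat}.
Implicit Types x y z : sphere R d.

Let dist x y : R := enorm (sphere_val x - sphere_val y).

Let distxx x : dist x x = 0.
Proof. by rewrite /dist subrr enorm0. Qed.

Let dist_positivity x y : dist x y = 0 -> x = y.
Proof. by move/enorm_eq0/eqP; rewrite subr_eq0 => /eqP /val_inj. Qed.

Let dist_sym x y : dist x y = dist y x.
Proof. by rewrite /dist -enormN opprB. Qed.

Let dist_triangle y x z : dist x z <= dist x y + dist y z.
Proof.
rewrite /dist (_ : sphere_val x - sphere_val z =
  (sphere_val x - sphere_val y) + (sphere_val y - sphere_val z)).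
  exact: ler_enormD.
by rewrite addrA subrK.
Qed.

HB.instance Definition _ := @isMetric.Build R (sphere R d)
  dist distxx dist_positivity dist_sym dist_triangle.

Let delta_mx_sphere : enorm (delta_mx ord0 ord0 : 'rV[R]_d.+1) == 1.
Proof.
rewrite /enorm (bigD1 ord0)//= big1 ?addr0 => [|i /negbTE i0].
  by rewrite mxE !eqxx expr1n sqrtr1.
by rewrite mxE i0 andbF expr0n.
Qed.

HB.instance Definition _ := isPointed.Build (sphere R d) (Sphere delta_mx_sphere).

End sphere_metric.

Definition sphere_display : measure_display.
Proof. exact. Qed.

Section sphere_borel.
Context {R : realType} {d : nat}.

Let borel : set (set (sphere R d)) := <<s @open (sphere R d) >>.

Let borel0 : borel set0. Proof. exact: sigma_algebra0. Qed.

Let borelC A : borel A -> borel (~` A). Proof. exact: sigma_algebraC. Qed.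

Let borel_bigcup (F : (set (sphere R d))^nat) :
  (forall i, borel (F i)) -> borel (\bigcup_i F i).
Proof. exact: sigma_algebra_bigcup. Qed.

HB.instance Definition _ := @isMeasurable.Build sphere_display (sphere R d)
  borel borel0 borelC borel_bigcup.

End sphere_borel.

Section hausdorff.
Context {R : realType} {T : metricType R}.
Local Open Scope ereal_scope.
Implicit Types (s delta : R) (A B U : set T).

Definition diam A : \bar R :=
  ereal_sup (0 |` [set (mdist z.1 z.2)%:E | z in A `*` A]).

(* Since 0 `^ 0 = 1, the separate case of the empty set makes the
   0-dimensional Hausdorff measure the counting measure. *)
Definition hausdorff_gauge s U : \bar R :=
  if U == set0 then 0 else diam U `^ s.

Definition hausdorff_cover delta A : set ((set T)^nat) :=
  [set U | A `<=` \bigcup_i U i /\ forall i, diam (U i) <= delta%:E].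

Definition hausdorff_premeasure s delta A : \bar R :=
  ereal_inf [set \sum_(i <oo) hausdorff_gauge s (U i)
            | U in hausdorff_cover delta A].

Definition hausdorff_measure s A : \bar R :=
  ereal_sup [set hausdorff_premeasure s delta A
            | delta in [set delta : R | (0 < delta)%R]].

Definition hausdorff_dim A : \bar R :=
  ereal_inf [set s%:E | s in [set s : R | (0 <= s)%R /\ hausdorff_measure s A = 0]].

Lemma diam0 : diam set0 = 0.
Proof.
by rewrite /diam set0X image_set0 setU0 ereal_sup1.
Qed.

Lemma mdist_diam A x y : A x -> A y -> (mdist x y)%:E <= diam A.
Proof. by move=> Ax Ay; apply: ereal_sup_ubound; right; exists (x, y). Qed.

Lemma hausdorff_gauge_ge0 s U : 0 <= hausdorff_gauge s U.
Proof. by rewrite /hausdorff_gauge; case: ifPn => // _; exact: poweR_ge0. Qed.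
Hint Resolve hausdorff_gauge_ge0 : core.

Lemma hausdorff_gauge0 s : hausdorff_gauge s set0 = 0.
Proof. by rewrite /hausdorff_gauge eqxx. Qed.

Lemma hausdorff_premeasure_ge0 s delta A : 0 <= hausdorff_premeasure s delta A.
Proof. by apply: le_ereal_inf_tmp => x [U _ <-]; exact: nneseries_ge0. Qed.

Lemma hausdorff_premeasure0 s delta : (0 < delta)%R ->
  hausdorff_premeasure s delta set0 = 0.
Proof.
move=> delta0; apply/eqP; rewrite eq_le hausdorff_premeasure_ge0 andbT.
apply: ereal_inf_lbound; exists (fun=> set0).
  by split=> // i; rewrite diam0 lee_fin ltW.
by rewrite eseries0// => i _ _; rewrite hausdorff_gauge0.
Qed.

Lemma le_hausdorff_premeasure s delta :
  {homo hausdorff_premeasure s delta : A B / A `<=` B >-> A <= B}.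
Proof.
move=> A B AB; apply: ereal_inf_le_tmp => _ [U [BU dU] <-].
by exists U => //; split => //; exact: subset_trans BU.
Qed.

Lemma hausdorff_premeasure_sigma_subadditive s delta :
  sigma_subadditive (hausdorff_premeasure s delta).
Proof.
set mu := hausdorff_premeasure s delta.
move=> A; have [[i ioo]|] := pselect (exists i, mu (A i) = +oo).
  rewrite (eseries_pinfty _ _ ioo) ?leey// => n _.
  by rewrite -ltNye (lt_le_trans _ (hausdorff_premeasure_ge0 _ _ _)).
rewrite -forallNE => Aoo.
suff add2e (e : {posnum R}) :
    mu (\bigcup_n A n) <= \sum_(i <oo) mu (A i) + e%:num%:E.
  by apply/lee_addgt0Pr => _/posnumP[].
rewrite (le_trans _ (epsilon_trick _ _ _))//; last first.
  by move=> n; exact: hausdorff_premeasure_ge0.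
pose P n (B : (set T)^nat) := hausdorff_cover delta (A n) B /\
  \sum_(k <oo) hausdorff_gauge s (B k) <= mu (A n) + (e%:num / (2 ^ n.+1)%:R)%:E.
have [G PG] : {G : ((set T)^nat)^nat & forall n, P n (G n)}.
  apply: (@choice _ _ P) => n; rewrite /P.
  have munfin : mu (A n) \is a fin_num.
    by rewrite ge0_fin_numE ?hausdorff_premeasure_ge0// ltey; exact/eqP.
  have en1 : (0 < e%:num / (2 ^ n.+1)%:R)%R by [].
  have [_ [B AnB <-] /ltW muB] := lb_ereal_inf_adherent en1 munfin.
  by exists B.
have gG_ge0 x : 0 <= (hausdorff_gauge s \o uncurry G) x by exact: hausdorff_gauge_ge0.
apply: (@le_trans _ _ (\esum_(i in setT) (hausdorff_gauge s \o uncurry G) i)).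
  apply: ereal_inf_lbound => /=.
  have /card_esym/ppcard_eqP[f] := card_nat2.
  exists (uncurry G \o f).
    split => [t [i _ Ait]|i]; last first.
      by rewrite /= (surjective_pairing (f i)); exact: (PG (f i).1).1.2.
    have [j _ Gijt] := (PG i).1.1 _ Ait.
    by exists (f^-1%FUN (i, j)) => //=; rewrite invK ?inE.
  rewrite -(esum_pred_image (hausdorff_gauge s \o uncurry G) _ xpredT)
    ?[fun=> _]set_true//.
  by rewrite image_eq.
have <- : \sum_(i <oo) \sum_(j <oo) hausdorff_gauge s (G i j) =
    \esum_(i in setT) (hausdorff_gauge s \o uncurry G) i.
  rewrite nneseries_esumT; last by move=> i; exact: nneseries_ge0.
  under eq_esum do rewrite nneseries_esumT//.
  by rewrite esum_esum//; congr esum; [apply/seteqP; split|apply/funext => -[]].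
apply: lee_nneseries => [i _ _|i _]; first exact: nneseries_ge0.
exact: (PG i).2.
Qed.

Lemma hausdorff_measure_ge0 s A : 0 <= hausdorff_measure s A.
Proof.
apply: le_trans (hausdorff_premeasure_ge0 s 1 A) _.
by apply: ereal_sup_ubound; exists 1%R => //=.
Qed.

Lemma hausdorff_measure0 s : hausdorff_measure s set0 = 0.
Proof.
apply/eqP; rewrite eq_le hausdorff_measure_ge0 andbT.
by apply: ge_ereal_sup => _ [e /= e0 <-]; rewrite hausdorff_premeasure0.
Qed.

Lemma le_hausdorff_premeasure_measure s delta A : (0 < delta)%R ->
  hausdorff_premeasure s delta A <= hausdorff_measure s A.
Proof. by move=> d0; apply: ereal_sup_ubound; exists delta. Qed.

Lemma le_hausdorff_measure s :
  {homo hausdorff_measure s : A B / A `<=` B >-> A <= B}.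
Proof.
move=> A B AB; apply: ge_ereal_sup => _ [e /= e0 <-].
exact: le_trans (le_hausdorff_premeasure s e AB)
  (le_hausdorff_premeasure_measure s B e0).
Qed.

Lemma hausdorff_measure_sigma_subadditive s :
  sigma_subadditive (hausdorff_measure s).
Proof.
move=> A; apply: ge_ereal_sup => _ [e /= e0 <-].
apply: le_trans (hausdorff_premeasure_sigma_subadditive s e A) _.
apply: lee_nneseries => [i _ _|i _]; first exact: hausdorff_premeasure_ge0.
exact: le_hausdorff_premeasure_measure.
Qed.

HB.instance Definition _ s := isOuterMeasure.Build R T (hausdorff_measure s)
  (hausdorff_measure0 s) (hausdorff_measure_ge0 s)
  (@le_hausdorff_measure s) (@hausdorff_measure_sigma_subadditive s).

End hausdorff.

(* Caratheodory's criterion: Hausdorff measures are Borel. *)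
Section hausdorff_borel.
Context {R : realType} {T : metricType R}.
Local Open Scope ereal_scope.
Variable s : R.
Local Notation mu := (@hausdorff_measure R T s).

Definition separated (e : R) (A B : set T) :=
  forall x y, A x -> B y -> (e <= mdist x y)%R.

Lemma hausdorff_premeasure_separated (e delta : R) (A B : set T) :
    (delta < e)%R -> separated e A B ->
  hausdorff_premeasure s delta A + hausdorff_premeasure s delta B <=
  hausdorff_premeasure s delta (A `|` B).
Proof.
move=> de AB; apply: le_ereal_inf_tmp => _ [U [ABU dU] <-].
pose V (C : set T) i := if pselect (C `&` U i !=set0) then U i else set0.
have Vcover (C : set T) : C `<=` A `|` B -> hausdorff_cover delta C (V C).
  move=> CAB; split => [x Cx|i].
    have [i _ Uix] := ABU _ (CAB _ Cx).
    by exists i => //; rewrite /V; case: pselect => // -[]; exists x.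
  rewrite /V; case: pselect => [CU|CU]; first exact: dU.
  by rewrite diam0; apply: le_trans (dU i); apply: ereal_sup_ubound; left.
apply: (@le_trans _ _ (\sum_(i <oo) hausdorff_gauge s (V A i) +
                       \sum_(i <oo) hausdorff_gauge s (V B i))).
  apply: leeD; apply: ereal_inf_lbound.
  - by exists (V A) => //; apply: Vcover; exact: subsetUl.
  - by exists (V B) => //; apply: Vcover; exact: subsetUr.
rewrite -nneseriesD; [|by move=> *; exact: hausdorff_gauge_ge0..].
apply: lee_nneseries => [i _ _|i _].
  by rewrite adde_ge0 ?hausdorff_gauge_ge0.
rewrite /V; case: pselect => [AU|AU]; last first.
  rewrite hausdorff_gauge0 add0e.
  by case: pselect => // BU; rewrite hausdorff_gauge0 hausdorff_gauge_ge0.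
case: pselect => [BU|BU]; last by rewrite hausdorff_gauge0 adde0.
have [[a [Aa Ua]] [b [Bb Ub]]] := (AU, BU).
have := le_trans (mdist_diam Ua Ub) (dU i); rewrite lee_fin => abd.
by have := le_lt_trans (le_trans (AB _ _ Aa Bb) abd) de; rewrite ltxx.
Qed.

Lemma hausdorff_premeasure_nonincreasing (delta1 delta2 : R) (A : set T) :
  (delta1 <= delta2)%R ->
  hausdorff_premeasure s delta2 A <= hausdorff_premeasure s delta1 A.
Proof.
move=> d12; apply: ereal_inf_le_tmp => _ [U [AU dU] <-].
by exists U => //; split => // i; rewrite (le_trans (dU i))// lee_fin.
Qed.

Lemma hausdorff_measure_separated (e : R) (A B : set T) : (0 < e)%R ->
  separated e A B -> mu A + mu B <= mu (A `|` B).
Proof.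
move=> e0 AB; have [->|ABoo] := eqVneq (mu (A `|` B)) +oo; first by rewrite leey.
have fA : mu A \is a fin_num.
  rewrite ge0_fin_numE ?hausdorff_measure_ge0//.
  apply: (@le_lt_trans _ _ (mu (A `|` B))); last by rewrite ltey.
  exact/le_hausdorff_measure/subsetUl.
rewrite addeC -leeBrDr//; apply: ge_ereal_sup => _ [dB /= dB0 <-].
have fB : hausdorff_premeasure s dB B \is a fin_num.
  rewrite ge0_fin_numE ?hausdorff_premeasure_ge0//.
  apply: (@le_lt_trans _ _ (mu (A `|` B))); last by rewrite ltey.
  apply: le_trans (le_hausdorff_premeasure_measure _ _ dB0) _.
  exact/le_hausdorff_measure/subsetUr.
rewrite leeBrDr// addeC -leeBrDr//; apply: ge_ereal_sup => _ [dA /= dA0 <-].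
rewrite leeBrDr//.
pose delta := Num.min (e / 2)%R (Num.min dA dB).
have delta0 : (0 < delta)%R by rewrite !lt_min divr_gt0//= dA0.
apply: le_trans (le_hausdorff_premeasure_measure _ _ delta0).
have de : (delta < e)%R.
  by rewrite (@le_lt_trans _ _ (e / 2)%R) ?ge_min ?lexx// ltr_pdivrMr// ltr_pMr// ltr1n.
apply: le_trans (hausdorff_premeasure_separated de AB).
apply: leeD; apply: hausdorff_premeasure_nonincreasing.
  by rewrite !ge_min lexx orbT.
by rewrite !ge_min lexx !orbT.
Qed.

Lemma open_hausdorff_caratheodory (O : set T) : open O -> mu.-caratheodory O.
Proof.
move=> oO; apply: le_caratheodory_measurable => X.
change (mu (X `&` O) + mu (X `&` ~` O) <= mu X).
have [->|Xoo] := eqVneq (mu X) +oo; first by rewrite leey.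
pose r n : R := (n.+1%:R^-1)%R.
have r_gt0 n : (0 < r n)%R by rewrite invr_gt0.
have r_lt n : (r n.+1 < r n)%R by rewrite ltf_pV2 ?posrE// ltr_nat.
have r_le m n : (m <= n)%N -> (r n <= r m)%R.
  by move=> mn; rewrite lef_pV2 ?posrE// ler_nat.
pose S n := [set x | X x /\ forall y, ~ O y -> (r n <= mdist x y)%R].
have S_O n : S n `<=` O.
  move=> x [_ Sx]; apply: contrapT => /Sx.
  by rewrite mdistxx leNgt r_gt0.
have S_X n : S n `<=` X by move=> x [].
have S_mono m n : (m <= n)%N -> S m `<=` S n.
  move=> mn x [Xx Sx]; split => // y Oy.
  exact: le_trans (r_le _ _ mn) (Sx _ Oy).
have S_cover x : X x -> O x -> exists n, S n x.
  move=> Xx Ox; have : nbhs x O by apply: open_nbhs_nbhs.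
  move=> /nbhs_ballP[e /= e0 xeO].
  have [n _ /(_ n (leqnn n)) /= ne] := near_infty_natSinv_lt (PosNum e0).
  exists n; split => // y Oy; rewrite leNgt; apply/negP => xy.
  by apply: Oy; apply: xeO; rewrite ballEmdist /=; exact: lt_trans xy ne.
have S_sep n (A : set T) : A `<=` X -> A `&` S n.+1 = set0 ->
    separated (r n - r n.+1) (S n) A.
  move=> AX AS x y [Xx Sx] Ay.
  have : ~ S n.+1 y by move=> Sy; have : (A `&` S n.+1) y by []; rewrite AS.
  move=> /not_andP[|/existsNP[z /not_implyP[Oz /negP]]].
    by move=> /(_ (AX _ Ay)).
  rewrite -ltNge => yz; have := Sx _ Oz; have := metric_triangle x y z; lra.
pose D n := S n.+1 `\` S n.
have D_X n : D n `<=` X by move=> x [/S_X].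
have sumD c N : \sum_(0 <= k < N) mu (D (k.*2 + c).+1) <= mu X.
  suff : \sum_(0 <= k < N) mu (D (k.*2 + c).+1) <= mu (S (N.*2 + c)%N).
    move/le_trans; apply; exact/le_hausdorff_measure/S_X.
  elim: N => [|N IH]; first by rewrite big_geq// hausdorff_measure_ge0.
  rewrite big_nat_recr//=; apply: le_trans (leeD IH (lexx _)) _.
  have SD : separated (r (N.*2 + c)%N - r (N.*2 + c).+1) (S (N.*2 + c)%N)
      (D (N.*2 + c).+1).
    by apply: S_sep; [exact: D_X|rewrite /D setDKI].
  apply: le_trans (hausdorff_measure_separated _ SD) _; first by rewrite subr_gt0.
  apply: le_hausdorff_measure => x [|[]].
    by apply: S_mono; rewrite doubleS !addSn leqW// leqW.
  by rewrite doubleS !addSn.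
have sumDoo : \sum_(0 <= k <oo) mu (D k.+1) < +oo.
  apply: (@le_lt_trans _ _ (mu X + mu X)); last first.
    by rewrite lte_add_pinfty// ltey.
  apply: lime_le; first by apply: is_cvg_nneseries => *; exact: hausdorff_measure_ge0.
  apply: nearW => n.
  apply: (@le_trans _ _ (\sum_(0 <= k < n.*2) mu (D k.+1))).
    apply: lee_sum_nneg_natr; last by rewrite -addnn leq_addr.
    by move=> *; exact: hausdorff_measure_ge0.
  have -> : \sum_(0 <= k < n.*2) mu (D k.+1) =
    \sum_(0 <= k < n) mu (D (k.*2 + 0).+1) + \sum_(0 <= k < n) mu (D (k.*2 + 1).+1).
    elim: n => [|n IH]; first by rewrite !big_geq// adde0.
    by rewrite doubleS !big_nat_recr//= IH addn0 addn1 -addeA addeACA.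
  exact: leeD.
have := nneseries_tail_cvg sumDoo (fun k _ => hausdorff_measure_ge0 s (D k.+1)).
move=> tail0; apply/lee_addgt0Pr => e e0.
have [N _ /(_ N (leqnn N)) /= tailN] :
    \forall n \near \oo, \sum_(n <= k <oo) mu (D k.+1) < e%:E.
  by apply: (tail0 [set x | x < e%:E]); apply: open_ereal_lt'; rewrite lte_fin.
have XO : X `&` O `<=` S N.+1 `|` \bigcup_(n in ~` `I_N) D n.+1.
  move=> x [Xx Ox]; have [n] := S_cover x Xx Ox.
  elim: n => [S0|n IH Sn]; first by left; exact: S_mono S0.
  have [Sn'|Sn'] := pselect (S n x); first exact: IH.
  have [nN|Nn] := leqP n N; first by left; apply: S_mono Sn.
  right; exists n.-1; first by rewrite /= => /=; apply/negP; rewrite -leqNgt -ltnS prednK//; exact: leq_ltn_trans Nn.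
  by rewrite /D prednK//; exact: leq_ltn_trans Nn.
have mXO : mu (X `&` O) <= mu (S N.+1) + e%:E.
  apply: le_trans (le_hausdorff_measure s XO) _.
  apply: le_trans (outer_measureU2 mu _ _) _.
  apply: leeD => //; apply/ltW/(le_lt_trans _ tailN).
  exact: (outer_measure_sigma_subadditive_tail mu N (fun n => D n.+1)).
apply: le_trans (leeD mXO (lexx _)) _.
rewrite -addeA [_ + mu _]addeC addeA; apply: leeD => //.
have SX : separated (r N.+1 - r N.+2) (S N.+1) (X `&` ~` O).
  apply: S_sep; first exact: subIsetl.
  by apply/seteqP; split => // x [[_ Ox] /S_O].
apply: le_trans (hausdorff_measure_separated _ SX) _; first by rewrite subr_gt0.
apply: le_hausdorff_measure => x [/S_X//|[]//].
Qed.

Lemma borel_hausdorff_caratheodory (A : set T) :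
  <<s @open T >> A -> mu.-caratheodory A.
Proof.
apply; split => [|O oO]; last exact: open_hausdorff_caratheodory.
split=> [|B mB|F mF].
- exact: caratheodory_measurable_set0.
- by rewrite setTD; exact: caratheodory_measurable_setC.
- exact: caratheodory_measurable_bigcup.
Qed.

End hausdorff_borel.

Section surface_measure.
Context {R : realType} {d : nat}.
Local Open Scope ereal_scope.

(* The surface measure of the d-dimensional sphere, up to the usual
   dimensional constant. *)
Definition sphere_hausdorff : set (sphere R d) -> \bar R :=
  hausdorff_measure d%:R.

Let sphere_hausdorff_semi_sigma_additive : semi_sigma_additive sphere_hausdorff.
Proof.
move=> F mF tF mUF.
apply: (@caratheodory_measure_sigma_additive R (sphere R d)
  (hausdorff_measure d%:R) F) => //.
- by move=> i; exact: borel_hausdorff_caratheodory (mF i).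
- exact: borel_hausdorff_caratheodory mUF.
Qed.

HB.instance Definition _ := isMeasure.Build sphere_display (sphere R d) R
  sphere_hausdorff (hausdorff_measure0 _) (hausdorff_measure_ge0 _)
  sphere_hausdorff_semi_sigma_additive.

(* The normalized surface measure. Since 0 < sphere_hausdorff setT < +oo, the
   second argument of mnormalize, a fallback value, is irrelevant. *)
Definition sigma : probability (sphere R d) R :=
  mnormalize sphere_hausdorff (dirac point).

End surface_measure.
Arguments sigma : clear implicits.

(* The metric of the norm of L^p, on classes of a.e. equal functions. *)
Section Lspace_metric.
Context d (T : measurableType d) (R : realType).
Variables (mu : {measure set T -> \bar R}) (p : \bar R) (p1 : (1 <= p)%E).
Implicit Types f g h : LspaceType mu p1.

HB.instance Definition _ := gen_eqMixin (LspaceType mu p1).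
HB.instance Definition _ := gen_choiceMixin (LspaceType mu p1).

Let dist f g : R := fine 'N[mu]_p[EFin \o (f \- g)%R]%E.

Let measurable_Lspace f : measurable_fun [set: T] (f : T -> R).
Proof.
have mf := measurable_funPT (repr (f : {mfun_ mu, T >-> measurableTypeR R})).
by move=> mT Y mY; exact: mf.
Qed.

Let dist_fin f g : (dist f g)%:E = 'N[mu]_p[EFin \o (f \- g)%R]%E.
Proof.
rewrite /dist fineK// ge0_fin_numE ?Lnorm_ge0//.
rewrite (_ : f \- g = f \+ (\- (g : T -> R)))//.
apply: le_lt_trans (eminkowski mu _ _ p1) _ => //.
  exact: measurableT_comp.
rewrite lte_add_pinfty//; first exact: Lebesgue_finite.
have -> : EFin \o \- (g : T -> R) = (\- (EFin \o (g : T -> R)))%E by [].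
rewrite oppe_Lnorm; exact: Lebesgue_finite.
Qed.

Let distxx f : dist f f = 0.
Proof.
apply: EFin_inj; rewrite dist_fin (_ : EFin \o _ = cst 0%E).
  by rewrite Lnorm0// gt_eqF// (lt_le_trans _ p1).
by apply/funext => x /=; rewrite subrr.
Qed.

Let dist_positivity f g : dist f g = 0 -> f = g.
Proof.
move=> fg0; have /Lnorm_eq0_eq0 : 'N[mu]_p[EFin \o (f \- g)%R]%E = 0%E.
  by rewrite -dist_fin fg0.
have p0 : (0 < p)%E by rewrite (lt_le_trans _ p1).
have /measurable_EFinP mfg : measurable_fun [set: T] ((f : T -> R) \- g).
  exact: measurable_funB.
move=> /(_ mfg p0) fg.
have {}fg : LebesgueSpace.sort f = LebesgueSpace.sort g.
  rewrite -[LHS]reprK -[RHS]reprK; apply/eqP/ae_eqP.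
  move: fg; apply: filterS => x fgx xT; apply/eqP.
  by rewrite -subr_eq0; apply/eqP/EFin_inj; exact: fgx xT.
case: f g fg {fg0 mfg} => [f [[nf]]] [g [[ng]]] /= fg.
by case: _ / fg in ng *; rewrite (Prop_irrelevance nf ng).
Qed.

Let dist_sym f g : dist f g = dist g f.
Proof.
rewrite /dist -oppe_Lnorm; congr (fine (Lnorm _ _ _)).
by apply/funext => x /=; rewrite opprB.
Qed.

Let dist_triangle g f h : dist f h <= dist f g + dist g h.
Proof.
rewrite -lee_fin EFinD !dist_fin.
rewrite (_ : f \- h = (f \- g) \+ (g \- h)).
  by apply: eminkowski => //; exact: measurable_funB.
by apply/funext => x /=; rewrite addrA subrK.
Qed.

HB.instance Definition _ := @isMetric.Build R (LspaceType mu p1)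
  dist distxx dist_positivity dist_sym dist_triangle.

End Lspace_metric.

Definition residual (X : topologicalType) (A : set X) :=
  exists F : (set X)^nat,
    (forall n, open (F n) /\ dense (F n)) /\ \bigcap_n F n `<=` A.

Section poisson.
Context {R : realType} {d : nat}.

Definition poisson_kernel (x : 'rV[R]_d.+1) (xi : sphere R d) : R :=
  (1 - enorm x ^+ 2) / enorm (x - sphere_val xi) ^+ d.+1.

(* An element f of L^1 coerces to one of its representatives. *)
Definition poisson_integral (f : LspaceType1 (sigma R d)) (x : 'rV[R]_d.+1) : R :=
  \int[sigma R d]_xi (poisson_kernel x xi * f xi).

(* lne maps 0 to -oo, and - ln (1 - r) > 0 for r close to 1 on the left. *)
Definition divergence_set (beta : R) (f : LspaceType1 (sigma R d)) :
    set (sphere R d) :=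
  [set y | limf_esup (fun r : R =>
      (lne `|poisson_integral f (r *: sphere_val y)|%:E
         / (- ln (1 - r))%:E)%E) 1^'- = beta%:E].

End poisson.

(* Main.v *)
(* Write mu_f for the measure |f| d sigma. The Poisson integral of f at r y is
   at most a constant times a weighted average of mu_f(B(y, e)) / e^d over the
   dyadic scales e >= 1 - r. So if the order of growth at y exceeds g > 0, then
   mu_f(B(y, e)) >= c e^(d - g) at arbitrarily small scales e; packing disjoint
   such balls shows that the set of these y is negligible in every dimension
   greater than d - g. This holds for every f and gives the upper bound.

   For the lower bound, let h_n have mass 2^(-n d) very close to each point of
   a net of mesh 2^(-n). At distance 2^(-q) from the net, q >= n, the Poisson
   integral of h_n at radius 1 - 2^(-q) is at least c 2^((q - n) d). A residual
   set of functions is, for infinitely many n, extremely close to g + c_n h_n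
   with g bounded and c_n ~ 1/n. For 0 < beta < d choose such n_k sparse and
   q_k ~ d n_k / (d - beta): the points whose binary digits vanish at all
   positions in (n_k, q_k] form a Cantor set of positive Hausdorff measure in
   dimension d - beta on which the order of growth is at least beta, and by the
   upper bound the points of order greater than beta are negligible in it. For
   beta = 0 the order of growth is nonnegative on a set of positive measure,
   because c_n can be chosen among two values so that the Poisson integral of
   g + c_n h_n at radius 1 - 2^(-n) is rarely small. *)
Require Import Defs.
From HB Require Import structures.
From mathcomp Require Import all_boot all_order all_algebra.
From mathcomp Require Import finmap.
From mathcomp Require Import all_classical all_reals all_analysis.
From mathcomp Require Import measurable_realfun ring lra zify.
Set Implicit Arguments.
Unset Strict Implicit.
Unset Printing Implicit Defensive.
Import Order.TTheory GRing.Theory Num.Theory.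
Import numFieldNormedType.Exports.
Local Open Scope classical_set_scope.
Local Open Scope ring_scope.

(** * Hausdorff measures: covers and the mass distribution principle *)

(** Neither the open sets nor the net functions may depend on beta. Hence the perturbation allowed
    around g + c_n h_n has size about 2^(-n^2 d) / n: it keeps the Poisson integrals under control
    at all radii 1 - 2^(-q) with n <= q <= n^2, and q ~ d n / (d - beta) falls in this window for
    every fixed beta < d once n is large. The bounded part g contributes at most n, which a gain of
    2^((q - n) d) / n swallows when q is well beyond n. At q = n the gain is only 1/n and g may
    cancel it, which is why beta = 0 needs an argument of its own. An order of at least beta is
    easier to force than an order equal to beta. Positive measure in dimension exactly d - beta,
    rather than that dimension alone, is what allows the points of larger order to be discarded. At
    beta = d the lower bound is trivial, every dimension being nonnegative. *)

Section hausdorff_lemmas.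
Context {R : realType} {T : metricType R}.
Local Open Scope ereal_scope.
Implicit Types (s delta : R) (A B U : set T).

Lemma diam_ge0 A : 0 <= diam A.
Proof. by apply: ereal_sup_ubound; left. Qed.

Lemma diam_le (r : R) A : (0 <= r)%R ->
  (forall x y, A x -> A y -> (mdist x y <= r)%R) -> diam A <= r%:E.
Proof.
move=> r0 Ar; apply: ge_ereal_sup => _ [->|[[x y] [/= Ax Ay] <-]].
  by rewrite lee_fin.
by rewrite lee_fin; exact: Ar.
Qed.

Lemma hausdorff_gauge_le s (r : R) A : (0 <= s)%R -> (0 <= r)%R ->
  diam A <= r%:E -> hausdorff_gauge s A <= (r `^ s)%:E.
Proof.
move=> s0 r0 Ar; rewrite /hausdorff_gauge; case: ifPn => _.
  by rewrite lee_fin powR_ge0.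
rewrite -poweR_EFin; apply: gt0_ler_poweR => //; rewrite in_itv/= leey andbT//.
exact: diam_ge0.
Qed.

(** The finite cover is continued by empty sets, which have gauge 0 even for [s = 0] by the separate
    clause of [hausdorff_gauge]. *)
Lemma hausdorff_premeasure_fin_cover s delta (I : finType) (U : I -> set T) A :
    (0 <= delta)%R -> A `<=` \bigcup_i U i ->
    (forall i, diam (U i) <= delta%:E) ->
  hausdorff_premeasure s delta A <= \sum_(i : I) hausdorff_gauge s (U i).
Proof.
move=> delta0 AU dU.
pose V n := if insub n is Some k then U (enum_val (k : 'I_#|I|)) else set0.
have -> : \sum_(i : I) hausdorff_gauge s (U i) = \sum_(i <oo) hausdorff_gauge s (V i).
  rewrite (nneseries_split 0 #|I|); last by move=> *; exact: hausdorff_gauge_ge0.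
  rewrite eseries0 ?adde0; last first.
    by move=> i iI _; rewrite /V insubN ?hausdorff_gauge0// -leqNgt.
  rewrite big_mkord add0n (reindex (@enum_val I xpredT)); last first.
    by exists enum_rank => i _; rewrite ?enum_valK ?enum_rankK.
  by apply: eq_bigr => i _; rewrite /V valK.
apply: ereal_inf_lbound; exists V => //; split => [x /AU[i _ Uix]|i].
  by exists (enum_rank i) => //; rewrite /V valK enum_rankK.
by rewrite /V; case: insubP => // _; rewrite diam0 lee_fin.
Qed.

(* [diam U `^ s <= r `^ (s - d) * diam U `^ d] once [diam U <= r]. *)
Lemma hausdorff_measure_gt_dim (d s : R) A : (0 <= d < s)%R ->
  hausdorff_measure d A < +oo -> hausdorff_measure s A = 0.
Proof.
move=> /andP[d0 ds] Aoo; apply/eqP; rewrite eq_le hausdorff_measure_ge0 andbT.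
apply: ge_ereal_sup => _ [delta /= delta0 <-].
have [M M0 AM] : exists2 M : R, (0 < M)%R & hausdorff_measure d A < M%:E.
  have Afin : hausdorff_measure d A \is a fin_num.
    by rewrite ge0_fin_numE// hausdorff_measure_ge0.
  exists (fine (hausdorff_measure d A) + 1)%R.
    by rewrite ltr_wpDl// fine_ge0// hausdorff_measure_ge0.
  by rewrite EFinD fineK// lteDl ?fin_numE// lte_fin.
apply/lee_addgt0Pr => e e0; rewrite add0e.
pose r := ((e / M) `^ (s - d)^-1)%R.
have r0 : (0 < r)%R by rewrite powR_gt0 ?divr_gt0.
have rE : (r `^ (s - d) * M = e)%R.
  rewrite /r -powRrM mulVf ?subr_eq0 ?gt_eqF// powRr1 ?divr_ge0 ?ltW//.
  by rewrite divfK// gt_eqF.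
pose eta := Num.min delta r.
have eta0 : (0 < eta)%R by rewrite lt_min delta0.
have : hausdorff_premeasure d eta A < M%:E.
  exact: le_lt_trans (le_hausdorff_premeasure_measure _ _ eta0) AM.
move=> /ereal_inf_lt[_ [U [AU dU] <-] UM].
apply: (@le_trans _ _ (\sum_(i <oo) hausdorff_gauge s (U i))).
  apply: ereal_inf_lbound; exists U => //; split => // i.
  by apply: le_trans (dU i) _; rewrite lee_fin ge_min lexx.
apply: (@le_trans _ _ (\sum_(i <oo) ((r `^ (s - d))%:E * hausdorff_gauge d (U i)))).
  apply: lee_nneseries => [i _ _|i _]; first exact: hausdorff_gauge_ge0.
  rewrite /hausdorff_gauge; case: ifPn => _; first by rewrite mule0.
  have dUr : diam (U i) <= r%:E.
    by apply: le_trans (dU i) _; rewrite lee_fin ge_min lexx orbT.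
  have dfin : diam (U i) \is a fin_num.
    by rewrite ge0_fin_numE ?diam_ge0// (le_lt_trans dUr) ?ltry.
  rewrite -(fineK dfin) !poweR_EFin -EFinM lee_fin.
  have u0 : (0 <= fine (diam (U i)))%R by rewrite fine_ge0 ?diam_ge0.
  have ur : (fine (diam (U i)) <= r)%R by rewrite -lee_fin fineK.
  have [->|un0] := eqVneq (fine (diam (U i))) 0%R.
    by rewrite powR0 ?mulr_ge0 ?powR_ge0// gt_eqF// (le_lt_trans d0).
  rewrite (_ : s = s - d + d)%R; last by rewrite subrK.
  rewrite (@powRD _ (fine _)) ?un0 ?implybT// addrK ler_wpM2r ?powR_ge0//.
  by apply: ge0_ler_powR => //; rewrite ?nnegrE ?subr_ge0 ?ltW.
rewrite nneseriesZl; last by move=> *; exact: hausdorff_gauge_ge0.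
rewrite -rE EFinM; apply: lee_wpmul2l; last exact: ltW.
by rewrite lee_fin powR_ge0.
Qed.

(* Compactness of [K] reduces any cover to a finite one, which for large [m]
   must catch all the points of the [m]-th sample. *)
Lemma hausdorff_measure_mass (K : set T) (s C : R) (J : nat -> finType)
    (z : forall m, J m -> T) :
    (0 < s)%R -> (0 < C)%R -> cover_compact K -> (forall m j, K (z m j)) ->
    (forall m, 0 < #|J m|)%N ->
    (forall u : R, (0 < u)%R -> exists m0, forall m, (m0 <= m)%N ->
       forall U, (forall x y, U x -> U y -> (mdist x y <= u)%R) ->
       (#|[pred j | `[< U (z m j) >]]|%:R <= C * u `^ s * #|J m|%:R)%R) ->
  (C^-1)%:E <= hausdorff_measure s K.
Proof.
move=> s0 C0 cK Kz J0 HU.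
apply: le_trans (le_hausdorff_premeasure_measure s K (@ltr01 R)).
apply: le_ereal_inf_tmp => _ [U [KU dU] <-].
set S := \sum_(i <oo) _; rewrite leNgt; apply/negP => SC.
have S0 : 0 <= S by apply: nneseries_ge0 => *; exact: hausdorff_gauge_ge0.
have Sfin : S \is a fin_num by rewrite ge0_fin_numE// (lt_trans SC) ?ltry.
pose e := ((C^-1 - fine S) / 2)%R.
have e0 : (0 < e)%R by rewrite divr_gt0// subr_gt0 -lte_fin fineK.
have gfin i : hausdorff_gauge s (U i) \is a fin_num.
  rewrite ge0_fin_numE ?hausdorff_gauge_ge0//.
  by rewrite (le_lt_trans (hausdorff_gauge_le (ltW s0) ler01 (dU i))) ?ltry.
(* Compactness needs open sets: each [U i] is fattened to an open [V i] of diameter at most [u i],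
   where the [s]-th power of [u i] exceeds the gauge of [U i] by [ep i]. The [ep i] add up to
   [e]. *)
pose ep i := (e / (2 ^ i.+1)%:R)%R.
have ep0 i : (0 < ep i)%R by rewrite divr_gt0// ltr0n expn_gt0.
pose g i := fine (hausdorff_gauge s (U i)).
have g0 i : (0 <= g i)%R by rewrite fine_ge0 ?hausdorff_gauge_ge0.
pose u i := ((g i + ep i) `^ s^-1)%R.
have u0 i : (0 < u i)%R by rewrite powR_gt0 // ltr_wpDl.
have us i : (u i `^ s = g i + ep i)%R.
  rewrite /u -powRrM mulVf; last by rewrite gt_eqF.
  by rewrite powRr1// addr_ge0// ltW.
have dfin i : diam (U i) \is a fin_num.
  by rewrite ge0_fin_numE ?diam_ge0// (le_lt_trans (dU i)) ?ltry.
have dui i : (fine (diam (U i)) < u i)%R.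
  have [U0|Un0] := eqVneq (U i) set0; first by rewrite U0 diam0.
  rewrite ltNge; apply/negP => ud.
  have : (u i `^ s <= g i)%R.
    rewrite -lee_fin /g fineK// /hausdorff_gauge (negbTE Un0) -poweR_EFin.
    apply: gt0_ler_poweR; [exact: ltW| | |].
    - by rewrite in_itv/= leey andbT lee_fin ltW.
    - by rewrite in_itv/= leey andbT diam_ge0.
    - by rewrite -(fineK (dfin i)) lee_fin.
  by rewrite us gerDl leNgt ep0.
pose eta i := ((u i - fine (diam (U i))) / 2)%R.
have eta0 i : (0 < eta i)%R by rewrite divr_gt0// subr_gt0.
pose V i := \bigcup_(x in U i) (ball x (eta i))°.
have oV i : setT i -> open (V i) by move=> _; apply: bigcup_open => x _; exact: open_interior.
have KV : K `<=` cover setT V.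
  move=> x /KU[i _ Uix]; exists i => //; exists x => //.
  exact: nbhsx_ballx.
have VV i x y : V i x -> V i y -> (mdist x y <= u i)%R.
  move=> [a Ua /interior_subset ax] [b Ub /interior_subset yb].
  move: ax yb; rewrite !ballEmdist/= => ax yb.
  have ab : (mdist a b <= fine (diam (U i)))%R.
    by rewrite -lee_fin fineK//; exact: mdist_diam.
  have := metric_triangle x a y; have := metric_triangle a b y.
  rewrite (metric_sym x a); move: ax yb; rewrite /eta; lra.
have [D _ KD] := cK _ _ _ oV KV.
pose N := (\max_(i <- finmap.enum_fset D) i).+1.
have DN i : i \in D -> (i < N)%N.
  by move=> iD; rewrite ltnS; apply: (@leq_bigmax_seq _ _ xpredT id).
have [m0 Hm0] := choice (fun i => HU _ (u0 i)).
pose m := \max_(i < N) m0 i.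
have cover_J : (#|J m| <= \sum_(i < N) #|[pred j | `[< V i (z m j) >]]|)%N.
  under eq_bigr do rewrite -sum1_card big_mkcond.
  rewrite exchange_big/= -sum1_card; apply: leq_sum => j _.
  have [i iD Vi] := KD _ (Kz m j).
  rewrite (bigD1 (Ordinal (DN _ iD)))//= ifT ?leq_addr//.
  by rewrite unfold_in; apply/asboolP.
have sJ : ((\sum_(i < N) #|[pred j | `[< V i (z m j) >]]|)%:R <=
    C * (\sum_(i < N) (g i + ep i)) * #|J m|%:R)%R.
  rewrite natr_sum mulr_sumr mulr_suml; apply: ler_sum => i _.
  rewrite -us; apply: Hm0; last exact: VV.
  exact: (leq_bigmax i).
move: cover_J; rewrite -(ler_nat R) => /le_trans/(_ sJ).
have J0' : (0 < #|J m|%:R :> R)%R by rewrite ltr0n.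
rewrite -[leLHS]mul1r ler_pM2r// => C1.
have : (\sum_(i < N) (g i + ep i))%:E <= S + e%:E.
  apply: le_trans (epsilon_trick xpredT (fun i => hausdorff_gauge_ge0 s (U i)) (ltW e0)).
  rewrite -sumEFin -(big_mkord xpredT (fun i => (g i + ep i)%:E)).
  apply: le_trans (nneseries_lim_ge N _); last first.
    by move=> i _ _; rewrite adde_ge0 ?hausdorff_gauge_ge0// lee_fin ltW//; exact: ep0.
  by apply: lee_sum => i _; rewrite EFinD fineK.
rewrite -(fineK Sfin) -EFinD lee_fin => /(ler_wpM2l (ltW C0))/(le_trans C1).
rewrite (_ : fine S + e = C^-1 - e)%R; last by rewrite /e; lra.
by rewrite mulrBr divff ?gt_eqF//; move: (mulr_gt0 C0 e0); lra.
Qed.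

End hausdorff_lemmas.

(** * Geometry of the sphere *)

Section enorm_lemmas.
Context {R : realType} {n : nat}.
Implicit Types x y : 'rV[R]_n.

Lemma ler_coord_enorm x i : `|x ord0 i| <= enorm x.
Proof.
rewrite -ler_sqr ?nnegrE ?normr_ge0 ?enorm_ge0// sqr_enorm real_normK ?num_real//.
by rewrite (bigD1 i)//= lerDl sumr_ge0// => j _; exact: sqr_ge0.
Qed.

Lemma enorm_ler x (a : R) : (forall i, `|x ord0 i| <= a) -> enorm x <= n%:R * a.
Proof.
case: n x => [x _|m x xa]; first by rewrite mul0r /enorm big_ord0 sqrtr0.
have a0 : 0 <= a by apply: le_trans (xa ord0); exact: normr_ge0.
rewrite -ler_sqr ?nnegrE ?mulr_ge0 ?enorm_ge0// sqr_enorm.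
apply: (@le_trans _ _ (\sum_(i < m.+1) a ^+ 2)).
  apply: ler_sum => i _; rewrite -(real_normK (num_real _)).
  by rewrite ler_sqr ?nnegrE.
rewrite sumr_const card_ord -[leLHS]mulr_natl exprMn ler_wpM2r ?sqr_ge0//.
by rewrite -natrX ler_nat expnS leq_pmulr.
Qed.

Lemma enormZ (r : R) x : enorm (r *: x) = `|r| * enorm x.
Proof.
rewrite -sqrtr_sqr /enorm -sqrtrM ?sqr_ge0// mulr_sumr; congr Num.sqrt.
by apply: eq_bigr => i _; rewrite mxE exprMn.
Qed.

End enorm_lemmas.

Section sphere_geometry.
Context {R : realType} {d : nat}.
Implicit Types x y z : sphere R d.
Local Notation co x i := (sphere_val x ord0 i).

Lemma mdist_sphereE x y : mdist x y = enorm (sphere_val x - sphere_val y).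
Proof. by []. Qed.

Lemma sphere_sum x : \sum_(i < d.+1) co x i ^+ 2 = 1.
Proof. by rewrite -sqr_enorm (eqP (valP x)) expr1n. Qed.

Lemma coord_sphere_le x i : `|co x i| <= 1.
Proof. by rewrite -(eqP (valP x)); exact: ler_coord_enorm. Qed.

Lemma coord_mdist x y i : `|co x i - co y i| <= mdist x y.
Proof.
rewrite mdist_sphereE; have := ler_coord_enorm (sphere_val x - sphere_val y) i.
by rewrite !mxE.
Qed.

Lemma mdist_sphere_le2 x y : mdist x y <= 2.
Proof.
rewrite mdist_sphereE; apply: le_trans (ler_enormD _ _) _.
by rewrite enormN (eqP (valP x)) (eqP (valP y)).
Qed.

(** Small enough that every point of the sphere has a coordinate of at least this size, and that the
    squares of [d] numbers between 0 and it add up to at most 1/4, which leaves room for the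
    remaining coordinate in [chart]. *)
Definition patch_width : R := d.+2%:R^-1.

Lemma patch_width_gt0 : 0 < patch_width.
Proof. by rewrite invr_gt0. Qed.

Lemma ex_large_coord x : exists i, patch_width <= `|co x i|.
Proof.
apply: contrapT => /forallNP xi; suff : (1 : R) < 1 by rewrite ltxx.
rewrite -[ltLHS](sphere_sum x).
have w1 : d.+1%:R * patch_width ^+ 2 < 1.
  rewrite /patch_width exprVn ltr_pdivrMr ?exprn_gt0// mul1r -natrX ltr_nat.
  by rewrite expnS expn1; nia.
apply: le_lt_trans w1; rewrite mulr_natl -[X in _ *+ X]card_ord -sumr_const.
apply: ler_sum => i _; rewrite -(real_normK (num_real _)).
rewrite ler_sqr ?nnegrE; [|exact: normr_ge0|exact/ltW/patch_width_gt0].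
by apply: ltW; rewrite ltNge; apply/negP/xi.
Qed.

(* On a patch where the [i]-th coordinate stays away from [0] the other
   coordinates are a bi-Lipschitz chart. *)
Definition patch_lip : R := d.+1%:R * (d.+2%:R * d.+1%:R + 1).

Lemma patch_lip_ge1 : 1 <= patch_lip.
Proof.
rewrite /patch_lip -natrM natr1 -natrM ler1n; nia.
Qed.

Lemma patch_lip_gt0 : 0 < patch_lip.
Proof. exact: lt_le_trans ltr01 patch_lip_ge1. Qed.

(** Subtracting the equations of the sphere at [x] and [y] expresses (x_i - y_i)(x_i + y_i) through
    the other coordinates. The second factor is at least twice [patch_width] in absolute value, as
    both terms have the sign given by [b]. *)
Lemma patch_lipschitz i (b : bool) x y (a : R) :
    patch_width <= (-1) ^+ b * co x i -> patch_width <= (-1) ^+ b * co y i ->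
    0 <= a -> (forall j, `|co x (lift i j) - co y (lift i j)| <= a) ->
  mdist x y <= patch_lip * a.
Proof.
move=> xi yi a0 xya.
have ci : `|co x i - co y i| <= d.+2%:R * d.+1%:R * a.
  have w0 := patch_width_gt0.
  have E : (co x i - co y i) * (co x i + co y i) =
      \sum_(j < d) (co y (lift i j) - co x (lift i j)) * (co y (lift i j) + co x (lift i j)).
    under eq_bigr do rewrite -subr_sqr.
    have := sphere_sum x; have := sphere_sum y.
    rewrite -subr_sqr sumrB !(bigD1_ord i)//=; lra.
  have {}E : `|co x i - co y i| * `|co x i + co y i| <= d%:R * (a * 2).
    rewrite -normrM E; apply: le_trans (ler_norm_sum _ _ _) _.
    apply: (@le_trans _ _ (\sum_(j < d) (a * 2))).
      apply: ler_sum => j _; rewrite normrM distrC ler_pM//.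
      apply: le_trans (ler_normD _ _) _.
      by rewrite (natrD _ 1 1) lerD ?coord_sphere_le.
    by rewrite sumr_const card_ord mulr_natl.
  have S : patch_width * 2 <= `|co x i + co y i|.
    rewrite -(normrMsign b) mulrDr.
    by apply: le_trans (ler_norm _); lra.
  have : `|co x i - co y i| * (patch_width * 2) <= d%:R * (a * 2).
    by apply: le_trans E; rewrite ler_wpM2l.
  rewrite (mulrA d%:R) mulrA ler_pM2r// /patch_width ler_pdivrMr// => /le_trans; apply.
  by rewrite mulrC mulrA ler_wpM2r// -!natrM ler_nat; nia.
rewrite mdist_sphereE /patch_lip -mulrA; apply: enorm_ler => j; rewrite !mxE.
have [<-|ij] := eqVneq i j; first by apply: le_trans ci _; nra.
have [k -> _] := unlift_some ij.
apply: le_trans (xya k) _; rewrite ler_peMl// lerDr.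
by rewrite mulr_ge0.
Qed.

End sphere_geometry.

Arguments patch_width : clear implicits.
Arguments patch_lip : clear implicits.

Section sphere_measure.
Context {R : realType} {d : nat}.
Implicit Types x y z : sphere R d.
Local Notation co x i := (sphere_val x ord0 i).

(** The number of patches (a coordinate and a sign) times the contribution of the cells of one
    patch. *)
Definition ball_upper_const : R := d.+1%:R * 2 * (2 * patch_lip R d) ^+ d.

Lemma ball_upper_const_gt0 : 0 < ball_upper_const.
Proof. by rewrite !mulr_gt0 ?exprn_gt0 ?mulr_gt0 ?patch_lip_gt0. Qed.

(* The part of the ball in a given patch is cut into [k ^ d] cells of
   diameter [O(u / k)]. *)
Lemma hausdorff_ball_le y (u : R) : 0 < u ->
  (hausdorff_measure d%:R (ball y u) <= (ball_upper_const * u ^+ d)%:E)%E.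
Proof.
move=> u0; apply: ge_ereal_sup => _ [delta /= delta0 <-].
have L0 := (@patch_lip_gt0 R d); set L := patch_lip R d in L0 *.
pose k := (Num.truncn (L * (2 * u) / delta)).+1.
have k0 : 0 < k%:R :> R by rewrite ltr0n.
pose h : R := 2 * u / k%:R.
have h0 : 0 < h by rewrite divr_gt0 ?mulr_gt0.
have Lh : L * h <= delta.
  rewrite /h mulrA ler_pdivrMr// [leRHS]mulrC -ler_pdivrMr//.
  by apply/ltW; rewrite truncnS_gt.
have Lh0 : 0 <= L * h by rewrite mulr_ge0// ltW.
pose cell := fun (p : 'I_d.+1 * bool * {ffun 'I_d -> 'I_k}) =>
  [set x : sphere R d | patch_width R d <= (-1) ^+ p.1.2 * co x p.1.1 /\
     forall j, (p.2 j)%:R * h <= co x (lift p.1.1 j) - co y (lift p.1.1 j) + u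
               <= (p.2 j).+1%:R * h].
have dcell p : (diam (cell p) <= (L * h)%:E)%E.
  apply: diam_le => // x z [xp xc] [zp zc].
  apply: (patch_lipschitz xp zp) => [|j]; first exact: ltW.
  have := xc j; have := zc j; rewrite -natr1 mulrDl mul1r ler_norml; lra.
apply: (le_trans (hausdorff_premeasure_fin_cover (U := cell) d%:R (ltW delta0) _ _)).
- move=> x; rewrite ballEmdist/= => xy.
  have [i xi] := ex_large_coord x.
  have xyu j : 0 <= (co x (lift i j) - co y (lift i j) + u) / h < k%:R.
    rewrite divr_ge0 ?(ltW h0)//=; last first.
      by have := coord_mdist x y (lift i j); rewrite metric_sym ler_norml; lra.
    rewrite ltr_pdivrMr// /h mulrC divfK ?gt_eqF//.
    by have := coord_mdist x y (lift i j); rewrite metric_sym ler_norml; lra.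
  have k_lt j : (Num.truncn ((co x (lift i j) - co y (lift i j) + u) / h) < k)%N.
    by have /andP[? ?] := xyu j; rewrite truncn_lt_nat.
  exists (i, co x i < 0, [ffun j => Ordinal (k_lt j)]) => //; split => /=.
    case: ltP xi => xi; rewrite ?expr1 ?mulN1r ?expr0 ?mul1r.
      by rewrite ltr0_norm.
    by rewrite ger0_norm.
  move=> j; rewrite ffunE/= -(ler_pdivlMr _ _ h0) -(ler_pdivrMr _ _ h0).
  by rewrite (ltW (truncnS_gt _)) andbT truncn_le; have /andP[] := xyu j.
- by move=> p; apply: le_trans (dcell p) _; rewrite lee_fin.
apply: (@le_trans _ _ (\sum_(p : 'I_d.+1 * bool * {ffun 'I_d -> 'I_k}) ((L * h) ^+ d)%:E)%E).
  apply: lee_sum => p _; rewrite -powR_mulrn//; apply: hausdorff_gauge_le => //.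
rewrite sumEFin lee_fin sumr_const !card_prod card_ffun !card_ord card_bool.
rewrite -[leLHS]mulr_natl !natrM natrX /ball_upper_const -/L /h.
rewrite -mulrA -exprMn -[leRHS]mulrA -exprMn.
rewrite (_ : k%:R * (L * (2 * u / k%:R)) = 2 * L * u)//.
have kn0 : k%:R != 0 :> R by rewrite gt_eqF.
by move: (k%:R) kn0 => K K0; field.
Qed.

Lemma setT_ball y : [set: sphere R d] = ball y 3.
Proof.
apply/seteqP; split => // x _; rewrite ballEmdist/=.
by apply: le_lt_trans (mdist_sphere_le2 y x) _; rewrite ltr_nat.
Qed.

Lemma hausdorff_sphere_lty : (hausdorff_measure d%:R [set: sphere R d] < +oo)%E.
Proof. by rewrite (setT_ball point) (le_lt_trans (hausdorff_ball_le _ _)) ?ltry. Qed.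

End sphere_measure.

(** * A chart of part of the sphere over a cube *)

Section chart.
Context {R : realType} {d : nat}.
Local Notation co x i := (sphere_val x ord0 i).
Implicit Types x : 'rV[R]_d.

Definition cube_side : R := patch_width R d.

Definition chart_vec (x : 'rV[R]_d) : 'rV[R]_d.+1 :=
  \row_i if unlift ord0 i is Some j then x ord0 j
         else Num.sqrt (1 - \sum_(j < d) x ord0 j ^+ 2).

(** [insubd] makes the map total: where [chart_vec] is not a unit vector, the value is [point]. *)
Definition chart (x : 'rV[R]_d) : sphere R d := insubd (point : sphere R d) (chart_vec x).

Definition chart_cube (a : 'rV[R]_d) (l : R) : set 'rV[R]_d :=
  [set x | forall j, a ord0 j <= x ord0 j <= a ord0 j + l].

Definition base_cube : set 'rV[R]_d := chart_cube 0 cube_side.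

Lemma base_cube_sum x : base_cube x -> \sum_(j < d) x ord0 j ^+ 2 <= 4^-1.
Proof.
move=> xQ; apply: (@le_trans _ _ (\sum_(j < d) patch_width R d ^+ 2)).
  apply: ler_sum => j _; have := xQ j; rewrite mxE add0r => /andP[x0 xl].
  by rewrite ler_sqr ?nnegrE// (le_trans x0).
rewrite sumr_const card_ord -[leLHS]mulr_natl /patch_width exprVn.
rewrite ler_pdivrMr ?exprn_gt0// mulrC ler_pdivlMr// -natrX -natrM ler_nat.
by rewrite !expnS; nia.
Qed.

Lemma chartE x : base_cube x -> sphere_val (chart x) = chart_vec x.
Proof.
move=> /base_cube_sum xQ; rewrite /chart val_insubd ifT//.
rewrite /enorm big_ord_recl /chart_vec mxE unlift_none sqr_sqrtr; last by lra.
rewrite [X in _ + X](eq_bigr (fun j => x ord0 j ^+ 2)); first by rewrite subrK sqrtr1.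
by move=> j _; rewrite mxE liftK.
Qed.

Lemma chart_lift x j : base_cube x -> co (chart x) (lift ord0 j) = x ord0 j.
Proof. by move=> xQ; rewrite chartE// mxE liftK. Qed.

Lemma chart_width x : base_cube x ->
  patch_width R d <= (-1) ^+ false * co (chart x) ord0.
Proof.
move=> xQ; rewrite expr0 mul1r chartE// mxE unlift_none.
have w2 : patch_width R d <= 2^-1 by rewrite lef_pV2 ?posrE// ler_nat.
apply: le_trans w2 _; rewrite -[leLHS]ger0_norm// -sqrtr_sqr ler_sqrt//.
  by have := base_cube_sum xQ; lra.
by have := base_cube_sum xQ; lra.
Qed.

Lemma chart_mdist_le x x' (a : R) : base_cube x -> base_cube x' -> 0 <= a ->
  (forall j, `|x ord0 j - x' ord0 j| <= a) ->
  mdist (chart x) (chart x') <= patch_lip R d * a.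
Proof.
move=> xQ xQ' a0 xx'; apply: (patch_lipschitz (chart_width xQ) (chart_width xQ')) => // j.
by rewrite !chart_lift.
Qed.

Lemma chart_mdist_ge x x' j : base_cube x -> base_cube x' ->
  `|x ord0 j - x' ord0 j| <= mdist (chart x) (chart x').
Proof. by move=> xQ xQ'; rewrite -(chart_lift j xQ) -(chart_lift j xQ') coord_mdist. Qed.

Lemma chart_continuous : {within base_cube, continuous chart}.
Proof.
apply/subspace_continuousP => x xQ.
apply/(@metricType_numDomainType.cvgrPdist_le _ (sphere R d)) => e e0.
have L0 := (@patch_lip_gt0 R d).
have eL : 0 < e / patch_lip R d by rewrite divr_gt0.
rewrite near_withinE; near=> x' => xQ'.
have -> : e = patch_lip R d * (e / patch_lip R d) by rewrite mulrC divfK// gt_eqF.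
apply: chart_mdist_le => //; first exact: ltW.
suff : ball x (e / patch_lip R d) x' by move=> [_ xx'] j; exact/ltW/xx'.
by near: x'; exact: nbhsx_ballx.
Unshelve. all: by end_near. Qed.

Lemma compact_chart_image (K : set 'rV[R]_d) : K `<=` base_cube -> compact K ->
  cover_compact (chart @` K).
Proof.
move=> KQ cK; rewrite -compact_cover; apply: continuous_compact => //.
exact: continuous_subspaceW chart_continuous.
Qed.

End chart.

(** * Cantor sets given by binary digits *)

Section digits.
Variable free : pred nat.

(* Integers whose [m]-bit binary expansion (most significant bit first)
   vanishes at the positions that are not free. *)
Fixpoint digits m : seq nat :=
  if m is m'.+1 then
    if free m' then [seq z.*2 | z <- digits m'] ++ [seq z.*2.+1 | z <- digits m']
    else [seq z.*2 | z <- digits m']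
  else [:: 0%N].

Definition nfree p := count free (iota 0 p).

Lemma nfreeS p : nfree p.+1 = (nfree p + free p)%N.
Proof. by rewrite /nfree -addn1 iotaD count_cat/= add0n addn0. Qed.

Lemma nfree_le p q : (p <= q)%N -> (nfree p <= nfree q)%N.
Proof. by move=> pq; rewrite /nfree -(subnKC pq) iotaD count_cat leq_addr. Qed.

Lemma size_digits m : size (digits m) = (2 ^ nfree m)%N.
Proof.
elim: m => //= m IH; rewrite nfreeS; case: (free m).
  by rewrite size_cat !size_map IH addnn -mul2n addn1 expnS.
by rewrite size_map addn0.
Qed.

Lemma mem_digitsS m z : (z \in digits m.+1) =
  (z./2 \in digits m) && (odd z ==> free m).
Proof.
have E : (z \in [seq x.*2 | x <- digits m]) = (z./2 \in digits m) && ~~ odd z.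
  apply/mapP/andP => [[x xm ->]|[zm oz]]; first by rewrite doubleK odd_double.
  by exists z./2 => //; rewrite -[LHS]odd_double_half (negbTE oz).
have O : (z \in [seq x.*2.+1 | x <- digits m]) = (z./2 \in digits m) && odd z.
  apply/mapP/andP => [[x xm ->]|[zm oz]]; first by rewrite /= uphalf_double odd_double.
  by exists z./2 => //; rewrite -[LHS]odd_double_half oz.
rewrite /=; case: (free m); last by rewrite E //; case: (odd z).
by rewrite mem_cat E// O// -andb_orr orNb implybT.
Qed.

Lemma digits_uniq m : uniq (digits m).
Proof.
elim: m => //= m IH.
have uE : uniq [seq z.*2 | z <- digits m] by rewrite map_inj_uniq//; exact: double_inj.
have uO : uniq [seq z.*2.+1 | z <- digits m].
  by rewrite map_inj_uniq// => x y [] /double_inj.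
case: (free m) => //; rewrite cat_uniq uE uO andbT; apply/hasPn => _ /mapP[x xm ->].
by apply/mapP => -[y _ /(congr1 odd)]; rewrite /= !odd_double.
Qed.

Lemma digits_lt m z : z \in digits m -> (z < 2 ^ m)%N.
Proof.
elim: m z => [|m IH] z; first by rewrite inE => /eqP ->.
by rewrite mem_digitsS => /andP[/IH + _]; rewrite expnS; lia.
Qed.

Lemma digits_div m p z : z \in digits (m + p) -> (z %/ 2 ^ p \in digits m)%N.
Proof.
elim: p z => [|p IH] z; first by rewrite addn0 divn1.
by rewrite addnS mem_digitsS => /andP[/IH + _]; rewrite expnS divnMA divn2.
Qed.

Lemma digits_mul m p z : z \in digits m -> (z * 2 ^ p \in digits (m + p))%N.
Proof.
move=> zm; elim: p => [|p IH]; first by rewrite addn0 muln1.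
rewrite addnS mem_digitsS expnS mulnCA mul2n doubleK odd_double andbT.
by [].
Qed.

Lemma digits_forced m p z : (forall i, (m <= i < m + p)%N -> ~~ free i) ->
  z \in digits (m + p) -> (2 ^ p %| z)%N.
Proof.
elim: p z => [|p IH] z mp; first by rewrite dvd1n.
rewrite addnS mem_digitsS => /andP[/IH zp /implyP oz].
have nodd : ~~ odd z.
  by apply/negP => /oz; apply/negP/mp; rewrite leq_addr addnS ltnSn.
have : (2 ^ p %| z./2)%N.
  by apply: zp => i /andP[mi ip]; apply: mp; rewrite mi addnS ltnW.
rewrite -[X in _ -> (_ %| X)%N]odd_double_half (negbTE nodd) -mul2n expnS.
by rewrite dvdn_pmul2l.
Qed.

(** The quotient by 2^k is the string of the leading [p] digits; fixing it leaves a choice only at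
    the free positions from [p] on. *)
Lemma count_digits p k w :
  (count (fun z => (z %/ 2 ^ k == w)%N) (digits (p + k)) <= 2 ^ (nfree (p + k) - nfree p))%N.
Proof.
elim: k => [|k IH].
  rewrite addn0 subnn (eq_count (a2 := pred1 w)); last by move=> z /=; rewrite divn1.
  by rewrite count_uniq_mem ?digits_uniq// leq_b1.
have E z : (z.*2 %/ 2 ^ k.+1 = z %/ 2 ^ k)%N.
  by rewrite expnS divnMA divn2 doubleK.
have O z : (z.*2.+1 %/ 2 ^ k.+1 = z %/ 2 ^ k)%N.
  by rewrite expnS divnMA divn2 /= uphalf_double.
rewrite addnS /= nfreeS; case: (free _); rewrite ?count_cat !count_map.
  rewrite (eq_count (a2 := fun z => (z %/ 2 ^ k == w)%N)); last by move=> z /=; rewrite E.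
  rewrite [X in (_ + X)%N](eq_count (a2 := fun z => (z %/ 2 ^ k == w)%N)); last first.
    by move=> z /=; rewrite O.
  rewrite addn1 subSn ?nfree_le ?leq_addr// expnS mul2n -addnn.
  exact: leq_add.
rewrite (eq_count (a2 := fun z => (z %/ 2 ^ k == w)%N)); last by move=> z /=; rewrite E.
by rewrite addn0.
Qed.

End digits.

Section digit_set.
Context {R : realType}.
Variable free : pred nat.

(** The reals of the unit interval with a binary expansion that vanishes off the free positions,
    presented as an intersection of finite unions of closed intervals to make compactness
    immediate. *)
Definition digit_set : set R := \bigcap_m \bigcup_(z in [set` digits free m])
  `[z%:R / 2 ^+ m, z.+1%:R / 2 ^+ m]%classic.

Lemma digit_set_compact : compact digit_set.
Proof.
apply: (subclosed_compact _ (@segment_compact R 0 1)).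
- apply: closed_bigI => m _; apply: closed_bigcup => [|z _]; last exact: interval_closed.
  exact: finite_seq.
- move=> x /(_ 0%N I)[z /=]; rewrite inE => /eqP ->.
  by rewrite expr0 divr1 divr1.
Qed.

(** Zeros are appended for the levels beyond [m], digits are dropped for the levels before it. *)
Lemma digit_set_mem m z : z \in digits free m -> digit_set (z%:R / 2 ^+ m).
Proof.
move=> zm k _.
have p2 i : 0 < 2 ^+ i :> R by rewrite exprn_gt0.
have [mk|km] := leqP m k.
  rewrite -(subnKC mk); exists (z * 2 ^ (k - m))%N; first exact: digits_mul.
  have E : z%:R / 2 ^+ m = (z * 2 ^ (k - m))%:R / 2 ^+ (m + (k - m)) :> R.
    by rewrite natrM natrX exprD -mulf_div divff ?mulr1// gt_eqF.
  by rewrite /= E in_itv/= lexx/= ler_pM2r ?invr_gt0// ler_nat.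
rewrite -(subnKC (ltnW km)) in zm *.
set e := (m - k)%N in zm *.
exists (z %/ 2 ^ e)%N; first exact: digits_div.
rewrite /= in_itv/= exprD invfM mulrA mulrAC.
rewrite !ler_pM2r ?invr_gt0// ler_pdivlMr// ler_pdivrMr// -!natrX -!natrM !ler_nat.
by rewrite leq_divM/= ltnW// ltn_ceil// expn_gt0.
Qed.

Lemma digit_set01 x : digit_set x -> 0 <= x <= 1.
Proof.
move=> /(_ 0%N I)[z /=]; rewrite inE => /eqP ->.
by rewrite expr0 divr1 divr1 in_itv.
Qed.

End digit_set.

Lemma dyadic_scale {R : realType} (u : R) : 0 < u <= 1 ->
  exists p, 2 ^- p.+1 < u <= 2 ^- p.
Proof.
move=> /andP[u0 u1].
have ex : exists p, 2 ^- p < u.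
  exists (Num.truncn u^-1).+1; rewrite invf_plt ?posrE ?exprn_gt0//.
  apply: lt_trans (truncnS_gt _) _.
  by rewrite -natrX ltr_nat ltn_expl.
case: (ex_minnP ex) => -[|p]; first by rewrite expr0 invr1 ltNge u1.
move=> pu min; exists p; rewrite pu leNgt; apply/negP => /min.
by rewrite ltnn.
Qed.

Section digit_cube.
Context {R : realType} {d : nat}.
Variable free : pred nat.
Implicit Types (a x : 'rV[R]_d) (l : R).

Definition digit_cube a l : set 'rV[R]_d :=
  [set x | forall j, digit_set free ((x ord0 j - a ord0 j) / l)].

Lemma digit_cube_sub a l : 0 < l -> digit_cube a l `<=` chart_cube a l.
Proof.
move=> l0 x ax j; have /digit_set01/andP[] := ax j.
by rewrite pmulr_lge0 ?invr_gt0// ler_pdivrMr// mul1r; lra.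
Qed.

Lemma digit_cube_compact a l : 0 < l -> compact (digit_cube a l).
Proof.
move=> l0; have -> : digit_cube a l = [set x : 'rV[R]_d | forall j,
    ((fun t => a ord0 j + l * t) @` digit_set free) (x ord0 j)].
  apply/seteqP; split => x ax j.
    exists ((x ord0 j - a ord0 j) / l); first exact: ax.
    by rewrite mulrC divfK ?gt_eqF// addrC subrK.
  have [t tK <-] := ax j; rewrite addrAC subrr add0r mulrAC divff ?mul1r//.
  by rewrite gt_eqF.
apply: (@rV_compact R d (fun j => (fun t => a ord0 j + l * t) @` digit_set free)) => j.
apply: continuous_compact; last exact: digit_set_compact.
apply: continuous_subspaceT => t.
by apply: cvgD; [exact: cvg_cst|apply: cvgM; [exact: cvg_cst|exact: cvg_id]].
Qed.

(** The samples fed to [hausdorff_measure_mass]: one admissible digit string of length [m] per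
    coordinate. *)
Definition digit_point a l m (f : {ffun 'I_d -> 'I_(size (digits free m))}) : 'rV[R]_d :=
  \row_j (a ord0 j + l * ((nth 0%N (digits free m) (f j))%:R / 2 ^+ m)).

Lemma digit_point_mem a l m (f : {ffun 'I_d -> 'I_(size (digits free m))}) :
  0 < l -> digit_cube a l (digit_point a l f).
Proof.
move=> l0 j; rewrite mxE addrAC subrr add0r mulrAC divff ?gt_eqF// mul1r.
by apply: digit_set_mem; rewrite mem_nth.
Qed.

(** The leading [p] digits form one of the three integers next to or equal to [w], and
    [count_digits] bounds each case. *)
Lemma card_digit_close p k w :
  (#|[pred i : 'I_(size (digits free (p + k))) |
      (w <= nth 0%N (digits free (p + k)) i %/ 2 ^ k + 1) &&
      (nth 0%N (digits free (p + k)) i %/ 2 ^ k <= w + 1)]%N|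
   <= 3 * 2 ^ (nfree free (p + k) - nfree free p))%N.
Proof.
pose P v := [pred i : 'I_(size (digits free (p + k))) |
  (nth 0%N (digits free (p + k)) i %/ 2 ^ k == v)%N].
have HP v : (#|P v| <= 2 ^ (nfree free (p + k) - nfree free p))%N.
  apply: leq_trans (count_digits free p k v).
  rewrite -sum1_card -sum1_count (big_nth 0%N) big_mkord.
  by apply: eq_leq; apply: eq_bigl.
apply: (@leq_trans (#|[predU P w.-1 & [predU P w & P w.+1]]|)).
  apply: subset_leq_card; apply/fintype.subsetP => i.
  rewrite !inE /=; set q := (_ %/ _)%N; rewrite -!/q; lia.
apply: leq_trans (leq_trans (leq_addr #|[predI P w.-1 & [predU P w & P w.+1]]| _) _).
  exact: leqnn.
rewrite cardUI mulSn leq_add// ?HP//.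
apply: leq_trans (leq_addr #|[predI P w & P w.+1]| _) _.
by rewrite cardUI mul2n -addnn leq_add// ?HP.
Qed.

(* Each coordinate offers at most [3 * 2 ^ (nfree m - nfree p)] digits to a set
   of diameter [l / 2 ^ p]. *)
Lemma hausdorff_digit_cube_gt0 (tau : R) a l : (0 < d)%N -> 0 < tau ->
    (forall p, tau * p%:R <= (nfree free p)%:R) -> 0 < l ->
    chart_cube a l `<=` base_cube ->
  (0 < hausdorff_measure (tau * d%:R) (chart @` digit_cube a l))%E.
Proof.
move=> d0 tau0 Htau l0 aQ; set s := tau * d%:R.
have s0 : 0 < s by rewrite mulr_gt0// ltr0n.
(* The 3 comes from [card_digit_close], once per coordinate; [2 / l] appears because the dyadic
   scale 2^-p chosen for u / l is less than 2 u / l. *)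
pose C : R := 3 ^+ d * (2 / l) `^ s.
have C0 : 0 < C by rewrite mulr_gt0 ?exprn_gt0// powR_gt0// divr_gt0.
apply: (@lt_le_trans _ _ (C^-1)%:E); first by rewrite lte_fin invr_gt0.
have KQ := subset_trans (digit_cube_sub l0) aQ.
pose J m : finType := {ffun 'I_d -> 'I_(size (digits free m))}.
have cardJ m : #|J m| = (2 ^ (nfree free m * d))%N.
  by rewrite card_ffun !card_ord size_digits expnM.
apply: (@hausdorff_measure_mass _ _ _ s C J (fun m f => chart (digit_point a l f))) => //.
- exact: compact_chart_image (digit_cube_compact l0).
- by move=> m f; exists (digit_point a l f) => //; exact: digit_point_mem.
- by move=> m; rewrite cardJ expn_gt0.
move=> u u0.
have l2 : 0 <= 2 / l by rewrite divr_ge0// ltW.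
have uge0 := ltW u0.
have [lu|ul] := leP l u.
  exists 0%N => m _ U UU; apply: (@le_trans _ _ #|J m|%:R).
    by rewrite ler_nat max_card.
  rewrite ler_peMl// /C -mulrA -powRM//.
  rewrite -[leLHS]mulr1 ler_pM// ?exprn_ege1// ?ler1n//.
  rewrite -[leLHS](powRr0 (2 / l * u)); apply: ler_powR; last exact: ltW.
  rewrite mulrAC ler_pdivlMr// mul1r.
  by apply: le_trans lu _; rewrite ler_peMl ?ler1n.
have [p /andP[pu up]] : exists p, 2 ^- p.+1 < u / l <= 2 ^- p.
  by apply: dyadic_scale; rewrite divr_gt0//= ler_pdivrMr// mul1r ltW.
exists p => m pm U UU; rewrite -(subnKC pm); set k := (m - p)%N.
set P := [pred j | _]; have [->|] := eqVneq #|P| 0%N.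
  by rewrite !mulr_ge0 ?powR_ge0// ltW.
rewrite -lt0n => /card_gt0P[f0 Pf0].
pose W j := (nth 0%N (digits free (p + k)) (f0 j) %/ 2 ^ k)%N.
pose F (j : 'I_d) := [pred i : 'I_(size (digits free (p + k))) |
      (W j <= nth 0%N (digits free (p + k)) i %/ 2 ^ k + 1) &&
      (nth 0%N (digits free (p + k)) i %/ 2 ^ k <= W j + 1)]%N.
have p2 i : 0 < 2 ^+ i :> R by rewrite exprn_gt0.
have PF : (#|P| <= #|(family F : simpl_pred {ffun 'I_d -> 'I_(size (digits free (p + k)))})|)%N.
  apply: subset_leq_card; apply/fintype.subsetP => f Pf; apply/familyP => j.
  have {Pf Pf0} : mdist (chart (digit_point a l f)) (chart (digit_point a l f0)) <= u.
    move: Pf Pf0; rewrite !unfold_in => /asboolP Uf /asboolP Uf0; exact: UU.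
  move=> /(le_trans (chart_mdist_ge j (KQ _ (digit_point_mem _ _ l0)) (KQ _ (digit_point_mem _ _ l0)))).
  rewrite !mxE opprD addrACA subrr add0r -mulrBr -mulrBl normrM gtr0_norm//.
  rewrite mulrC -ler_pdivlMr// => /le_trans/(_ up).
  rewrite normrM (gtr0_norm (_ : 0 < 2 ^- (p + k))) ?invr_gt0// ler_pdivrMr//.
  rewrite exprD mulrA mulVf ?mul1r; last by rewrite gt_eqF.
  rewrite inE /W -natrX; set z := nth _ _ _; set z0 := nth _ _ _.
  rewrite ler_norml lerBlDr -natrD lerNl opprB lerBlDr -natrD !ler_nat.
  move=> /andP[h1 h2].
  have K0 : (0 < 2 ^ k)%N by rewrite expn_gt0.
  have {}h1 : (z0 %/ 2 ^ k <= z %/ 2 ^ k + 1)%N.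
    rewrite addnC -(divnMDl 1 z K0) mul1n; exact: leq_div2r.
  have {}h2 : (z %/ 2 ^ k <= z0 %/ 2 ^ k + 1)%N.
    rewrite addnC -(divnMDl 1 z0 K0) mul1n; exact: leq_div2r.
  by rewrite h1.
have FB : (#|(family F : simpl_pred {ffun 'I_d -> 'I_(size (digits free (p + k)))})|
    <= (3 * 2 ^ (nfree free (p + k) - nfree free p)) ^ d)%N.
  rewrite card_family -[X in (_ <= _ ^ X)%N](card_ord d) cardE /image_mem.
  elim: (enum _) => //= j r IH.
  by rewrite expnS leq_mul// card_digit_close.
apply: (@le_trans _ _ ((3 * 2 ^ (nfree free (p + k) - nfree free p)) ^ d)%:R).
  by rewrite ler_nat (leq_trans PF).
rewrite cardJ expnMn natrM natrX /C -!mulrA ler_wpM2l ?exprn_ge0//.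
rewrite mulrA -powRM//.
rewrite -[X in (X * d)%N](@subnK (nfree free p)) ?nfree_le ?leq_addr//.
rewrite mulnDl expnD natrM mulrCA expnM ler_peMr//.
(* It remains to see that (2 u / l)^s times 2 to the power [nfree free p * d] is at least 1. Since s
   = tau d, the density hypothesis at [p] bounds the second factor below by 2^(p s). *)
apply: (@le_trans _ _ ((2 ^- p) `^ s * 2 `^ (p%:R * s))).
  rewrite -powR_invn// -powRrM -powRD ?implybT//; last by rewrite pnatr_eq0 implybT.
  by rewrite mulNr addNr powRr0.
apply: ler_pM; rewrite ?powR_ge0//.
  apply: ge0_ler_powR; rewrite ?nnegrE ?(ltW s0) ?mulr_ge0 ?invr_ge0 ?(ltW l0)//.
  by move: pu; rewrite exprS invfM -[2 / l * u]mulrA [l^-1 * u]mulrC; move: (2 ^- p) => q; lra.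
rewrite natrX -powR_mulrn//; apply: ler_powR; first by rewrite ler1n.
by rewrite /s mulrA natrM ler_wpM2r// mulrC.
Qed.

End digit_cube.

(** * The normalized surface measure *)

Section borel_sphere.
Context {R : realType} {d : nat}.

Lemma measurable_open_sphere (U : set (sphere R d)) : open U -> measurable U.
Proof. by move=> oU; apply: sub_sigma_algebra. Qed.

Lemma continuous_measurable_sphere (f : sphere R d -> R) :
  continuous f -> measurable_fun [set: sphere R d] f.
Proof.
move=> /continuousP cf; apply: (measurability _ (RGenOpens.measurableE R)) => //.
move=> _ [_ [a [b ->] <-]]; rewrite setTI; apply: measurable_open_sphere.
by apply: cf; exact: interval_open.
Qed.

Lemma lipschitz_continuous_sphere (f : sphere R d -> R) (L : R) :
  (forall x y, `|f x - f y| <= L * mdist x y) -> continuous f.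
Proof.
move=> fL x; apply/(@cvgrPdist_lt _ R^o _ _ (nbhs_filter x)) => e e0; pose L1 := `|L| + 1.
have L10 : 0 < L1 by rewrite ltr_wpDl.
near=> y; apply: le_lt_trans (fL x y) _.
have : mdist x y < e / L1.
  suff : ball x (e / L1) y by rewrite ballEmdist.
  by near: y; apply: nbhsx_ballx; rewrite divr_gt0.
rewrite ltr_pdivlMr// mulrC => h; apply: le_lt_trans h.
by rewrite ler_wpM2r ?mdist_ge0// /L1 (le_trans (ler_norm _))// lerDl.
Unshelve. all: by end_near. Qed.

Lemma measurable_ball_sphere (x : sphere R d) e : measurable (ball x e).
Proof.
suff : open (ball x e) by exact: measurable_open_sphere.
rewrite openE => y; rewrite ballEmdist/= => xy.
apply/nbhs_ballP; exists (e - mdist x y) => /=; first by rewrite subr_gt0.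
move=> z; rewrite !ballEmdist/= => yz.
by have := metric_triangle x y z; lra.
Qed.

End borel_sphere.

Section sigma_lemmas.
Context {R : realType} {d : nat}.
Hypothesis d_gt0 : (0 < d)%N.
Local Notation H := (@hausdorff_measure R (sphere R d) d%:R).
Local Notation sigma := (sigma R d).

Lemma nfree_predT p : nfree predT p = p.
Proof. by rewrite /nfree count_predT size_iota. Qed.

(** The case of [hausdorff_digit_cube_gt0] in which every position is free: the density is 1, so the
    dimension is [d]. *)
Lemma hausdorff_chart_cube_gt0 a l : 0 < l -> chart_cube a l `<=` base_cube ->
  (0 < H (chart @` chart_cube a l))%E.
Proof.
move=> l0 aQ; have := @hausdorff_digit_cube_gt0 R d predT 1 a l d_gt0 ltr01.
rewrite mul1r => /(_ _ l0 aQ)/lt_le_trans; apply => [p|].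
  by rewrite nfree_predT mul1r.
by apply: le_hausdorff_measure => _ [x ax <-]; exists x => //; exact: digit_cube_sub ax.
Qed.

Lemma hausdorff_sphere_gt0 : (0 < H [set: sphere R d])%E.
Proof.
apply: (@lt_le_trans _ _ (H (chart @` base_cube))); last exact: le_hausdorff_measure.
exact: (hausdorff_chart_cube_gt0 (@patch_width_gt0 R d)).
Qed.

Definition sphere_mass : R := fine (H [set: sphere R d]).

Lemma sphere_massE : sphere_mass%:E = H [set: sphere R d].
Proof. by rewrite fineK// ge0_fin_numE ?hausdorff_sphere_lty// ltW// hausdorff_sphere_gt0. Qed.

Lemma sphere_mass_gt0 : 0 < sphere_mass.
Proof. by rewrite -lte_fin sphere_massE hausdorff_sphere_gt0. Qed.

Lemma sigmaE A : sigma A = (H A * (sphere_mass^-1)%:E)%E.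
Proof.
have H0 := hausdorff_sphere_gt0; have Hy := @hausdorff_sphere_lty R d.
rewrite /sigma /= /mnormalize /sphere_hausdorff /= ifF//.
by rewrite /sphere_hausdorff (gt_eqF H0) (lt_eqF Hy).
Qed.

Lemma sigma_gt0 A : (0 < H A)%E -> (0 < sigma A)%E.
Proof. by move=> A0; rewrite sigmaE mule_gt0// lte_fin invr_gt0 sphere_mass_gt0. Qed.

Lemma sigma_eq0 A : H A = 0%E -> sigma A = 0%E.
Proof. by move=> A0; rewrite sigmaE A0 mul0e. Qed.

Definition sigma_ball_const : R := @ball_upper_const R d / sphere_mass.

Lemma sigma_ball_const_gt0 : 0 < sigma_ball_const.
Proof. by rewrite divr_gt0 ?ball_upper_const_gt0 ?sphere_mass_gt0. Qed.

Lemma sigma_ball_le y (u : R) : 0 < u ->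
  (sigma (ball y u) <= (sigma_ball_const * u ^+ d)%:E)%E.
Proof.
move=> u0; rewrite sigmaE /sigma_ball_const mulrAC EFinM.
by rewrite lee_wpmul2r ?hausdorff_ball_le// lee_fin invr_ge0 ltW// sphere_mass_gt0.
Qed.

(** The hypothesis on [a] leaves room in [base_cube] for a cube with corner [a]; one of small edge
    is mapped into the ball. *)
Lemma sigma_ball_gt0 a (e : R) : (exists2 l, 0 < l & chart_cube a l `<=` base_cube) ->
  0 < e -> (0 < sigma (ball (chart a) e))%E.
Proof.
move=> [l l0 aQ] e0; apply: sigma_gt0.
have L0 := @patch_lip_gt0 R d.
pose l' := Num.min l (e / patch_lip R d / 2).
have l'0 : 0 < l' by rewrite lt_min l0/= !divr_gt0.
have aQ' : chart_cube a l' `<=` base_cube.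
  apply: subset_trans aQ => x ax j; have /andP[-> h] := ax j.
  by apply: le_trans h _; rewrite lerD2l ge_min lexx.
apply: lt_le_trans (hausdorff_chart_cube_gt0 l'0 aQ') _.
apply: le_hausdorff_measure => _ [x ax <-]; rewrite ballEmdist/=.
have aa : base_cube a.
  by apply: aQ => j; rewrite lexx lerDl ltW.
apply: (@le_lt_trans _ _ (patch_lip R d * l')).
  apply: chart_mdist_le => //; [exact: aQ'|exact: ltW|move=> j].
  by have := ax j; rewrite distrC ler_norml; lra.
apply: (@le_lt_trans _ _ (patch_lip R d * (e / patch_lip R d / 2))).
  by rewrite ler_pM2l// ge_min lexx orbT.
by rewrite mulrA [_ * (e / _)]mulrC divfK ?gt_eqF// ltr_pdivrMr// ltr_pMr// ltr1n.
Qed.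

End sigma_lemmas.

(** * The Poisson kernel and Poisson integrals *)

Lemma exprn_lipschitz {R : realFieldType} (M : R) n : 1 <= M ->
  forall a b : R, `|a| <= M -> `|b| <= M ->
  `|a ^+ n - b ^+ n| <= n%:R * M ^+ n * `|a - b|.
Proof.
move=> M1 a b aM bM; have M0 : 0 <= M by lra.
elim: n => [|n IH]; first by rewrite !expr0 subrr normr0 !mul0r.
have -> : a ^+ n.+1 - b ^+ n.+1 = a * (a ^+ n - b ^+ n) + (a - b) * b ^+ n.
  by rewrite !exprS; ring.
apply: le_trans (ler_normD _ _) _; rewrite !normrM normrX.
have bn : `|b| ^+ n <= M ^+ n by apply: lerXn2r; rewrite ?nnegrE.
have Mn : M ^+ n <= M ^+ n.+1 by rewrite exprS ler_peMl// exprn_ge0.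
have : `|a| * `|a ^+ n - b ^+ n| <= M * (n%:R * M ^+ n * `|a - b|) by exact: ler_pM.
have : `|a - b| * `|b| ^+ n <= `|a - b| * M ^+ n.+1.
  by rewrite ler_wpM2l// (le_trans bn).
rewrite -natr1 !exprS; lra.
Qed.

Section kernel.
Context {R : realType} {d : nat}.
Implicit Types y xi : sphere R d.

Lemma enorm_sphere (r : R) y : 0 <= r -> enorm (r *: sphere_val y) = r.
Proof. by move=> r0; rewrite enormZ (eqP (valP y)) mulr1 ger0_norm. Qed.

Definition pole_dist (r : R) y xi : R := enorm (r *: sphere_val y - sphere_val xi).

Lemma poisson_kernelE r y xi : 0 <= r ->
  poisson_kernel (r *: sphere_val y) xi = (1 - r ^+ 2) / pole_dist r y xi ^+ d.+1.
Proof. by move=> r0; rewrite /poisson_kernel enorm_sphere. Qed.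

Section radius.
Variable r : R.
Hypothesis r01 : 0 <= r < 1.

Let r0 : 0 <= r. Proof. by case/andP: r01. Qed.
Let rho0 : 0 < 1 - r. Proof. by case/andP: r01; lra. Qed.

Let r2 : 0 <= 1 - r ^+ 2. Proof. by case/andP: r01; nra. Qed.

Lemma pole_dist_ge y xi : 1 - r <= pole_dist r y xi.
Proof.
have := ler_enormD (r *: sphere_val y) (sphere_val xi - r *: sphere_val y).
rewrite addrC subrK (eqP (valP xi)) enorm_sphere// -enormN opprB /pole_dist; lra.
Qed.

Let t0 y xi : 0 < pole_dist r y xi.
Proof. exact: lt_le_trans rho0 (pole_dist_ge _ _). Qed.

Let subr_sphere y : enorm (sphere_val y - r *: sphere_val y) = 1 - r.
Proof. by rewrite -{1}[sphere_val y]scale1r -scalerBl enorm_sphere// ltW. Qed.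

Lemma pole_dist_le y xi : pole_dist r y xi <= (1 - r) + mdist y xi.
Proof.
rewrite -(subr_sphere y) -(enormN (sphere_val y - _)) mdist_sphereE.
apply: le_trans (ler_enormD _ _); rewrite opprB addrA subrK.
by rewrite /pole_dist.
Qed.

Lemma mdist_le_pole_dist y xi : mdist y xi <= 2 * pole_dist r y xi.
Proof.
have : mdist y xi <= (1 - r) + pole_dist r y xi.
  rewrite -(subr_sphere y) mdist_sphereE; apply: le_trans (ler_enormD _ _).
  by rewrite addrA subrK.
by have := pole_dist_ge y xi; lra.
Qed.

Lemma poisson_kernel_ge0 y xi : 0 <= poisson_kernel (r *: sphere_val y) xi.
Proof.
by rewrite poisson_kernelE// divr_ge0//; exact/exprn_ge0/ltW/t0.
Qed.

Lemma poisson_kernel_le y xi (t : R) : 0 < t -> t <= pole_dist r y xi ->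
  poisson_kernel (r *: sphere_val y) xi <= 2 * (1 - r) / t ^+ d.+1.
Proof.
move=> tt0 tle; rewrite poisson_kernelE//; apply: ler_pM => //.
- by rewrite invr_ge0 exprn_ge0// ltW.
- by case/andP: r01; nra.
- rewrite lef_pV2 ?posrE ?exprn_gt0//.
  by apply: lerXn2r => //; rewrite nnegrE ltW// t0.
Qed.

Lemma poisson_kernel_ge y xi (k : R) : 0 <= k -> mdist y xi <= k * (1 - r) ->
  ((1 + k) ^+ d.+1 * (1 - r) ^+ d)^-1 <= poisson_kernel (r *: sphere_val y) xi.
Proof.
move=> k0 yxi; rewrite poisson_kernelE//.
have tle : pole_dist r y xi <= (1 + k) * (1 - r).
  by have := pole_dist_le y xi; lra.
rewrite ler_pdivlMr ?exprn_gt0// mulrC ler_pdivrMr; last first.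
  by rewrite mulr_gt0 ?exprn_gt0//; lra.
apply: (@le_trans _ _ (((1 + k) * (1 - r)) ^+ d.+1)).
  by apply: lerXn2r; rewrite ?nnegrE ?(ltW (t0 _ _))// (le_trans _ tle)// ltW.
rewrite exprMn [(1 - r) ^+ d.+1]exprS mulrCA ler_wpM2r//.
  by apply: mulr_ge0; apply: exprn_ge0; [lra|exact: ltW].
by case/andP: r01; nra.
Qed.

Lemma poisson_kernel_bounded y xi :
  `|poisson_kernel (r *: sphere_val y) xi| <= 2 * (1 - r) / (1 - r) ^+ d.+1.
Proof.
rewrite ger0_norm ?poisson_kernel_ge0//.
by apply: poisson_kernel_le => //; exact: pole_dist_ge.
Qed.

(** The source of measurability, for the kernel in [xi] and later for the Poisson integral in [y].
    The kernel is a multiple of a power of 1 / [pole_dist], which stays at most 1 / (1 - r). *)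
Lemma poisson_kernel_lipschitz : exists2 L : R, 0 <= L & forall y y' xi xi',
  `|poisson_kernel (r *: sphere_val y) xi - poisson_kernel (r *: sphere_val y') xi'|
    <= L * (mdist y y' + mdist xi xi').
Proof.
pose M := 1 + (1 - r)^-1.
have M1 : 1 <= M by rewrite /M lerDl invr_ge0 ltW.
have M0 : 0 <= M by exact: le_trans ler01 M1.
have tM y xi : `|(pole_dist r y xi)^-1| <= M.
  rewrite ger0_norm ?invr_ge0 ?(ltW (t0 _ _))// /M.
  apply: (@le_trans _ _ (1 - r)^-1); last by rewrite lerDr.
  by rewrite lef_pV2 ?posrE// pole_dist_ge.
exists ((1 - r ^+ 2) * (d.+1%:R * M ^+ d.+1 * (M * M))).
  by rewrite !mulr_ge0 ?exprn_ge0.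
move=> y y' xi xi'; rewrite !poisson_kernelE// -mulrBr normrM (ger0_norm r2).
rewrite -!mulrA ler_wpM2l//.
rewrite -!exprVn; apply: le_trans (exprn_lipschitz _ M1 (tM _ _) (tM _ _)) _.
rewrite !mulrA -[leRHS]mulrA -[leRHS]mulrA ler_wpM2l ?mulr_ge0 ?exprn_ge0//.
set t := pole_dist r y xi; set t' := pole_dist r y' xi'.
have -> : t^-1 - t'^-1 = t^-1 * t'^-1 * (t' - t).
  have tn0 : t != 0 by rewrite gt_eqF ?t0.
  have tn0' : t' != 0 by rewrite gt_eqF ?t0.
  by rewrite mulrBr -mulrA mulVf// mulr1 mulrAC mulVf// mul1r.
rewrite normrM normrM mulrA; apply: ler_pM; rewrite ?mulr_ge0 ?ler_pM ?tM//.
rewrite distrC.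
have tri (y1 y2 z1 z2 : sphere R d) :
    pole_dist r y1 z1 <= pole_dist r y2 z2 + (mdist y1 y2 + mdist z1 z2).
  rewrite [mdist z1 z2]metric_sym /pole_dist !mdist_sphereE.
  have -> : r *: sphere_val y1 - sphere_val z1 = (r *: sphere_val y2 - sphere_val z2)
      + (r *: (sphere_val y1 - sphere_val y2) + (sphere_val z2 - sphere_val z1)).
    by rewrite scalerBr; apply/rowP => i; rewrite !mxE; ring.
  apply: le_trans (ler_enormD _ _) _; rewrite lerD2l.
  apply: le_trans (ler_enormD _ _) _; rewrite lerD2r enormZ ger0_norm//.
  by rewrite ler_piMl ?enorm_ge0//; case/andP: r01; lra.
have := tri y y' xi xi'; have := tri y' y xi' xi.
rewrite -/t -/t' [mdist y' y]metric_sym [mdist xi' xi]metric_sym ler_norml; lra.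
Qed.

Lemma poisson_kernel_measurable y :
  measurable_fun [set: sphere R d] (poisson_kernel (r *: sphere_val y)).
Proof.
have [L L0 KL] := poisson_kernel_lipschitz.
apply: continuous_measurable_sphere; apply: (@lipschitz_continuous_sphere _ _ _ L) => x x'.
by apply: le_trans (KL _ _ _ _) _; rewrite mdistxx add0r.
Qed.

End radius.

(** The size (1 - r) / t^(d+1) of the Poisson kernel, up to a constant, at distance t = 2^-i when 1
    - r is about 2^-q. *)
Definition scale_weight q i : R := 2 ^+ (i * d) / 2 ^+ (q - i).

(** One term of the sum suffices: that of the scale of [mdist y xi], or the last one below 4 * 2^-q.
    The factor 4 has two uses: a distance of at least 4 * 2^-(i+1) forces [pole_dist] to be at least
    2^-i, and at scale 0 the ball is the whole sphere. *)
Lemma poisson_kernel_majorant r q y xi : 0 <= r ->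
    2 ^- q.+1 < 1 - r <= 2 ^- q ->
  poisson_kernel (r *: sphere_val y) xi <=
  2 ^+ d.+2 * \sum_(i < q.+1) scale_weight q i * \1_(ball y (4 * 2 ^- i)) xi.
Proof.
move=> r0 /andP[rq qr].
have p2 i : 0 < 2 ^+ i :> R by rewrite exprn_gt0.
have r01 : 0 <= r < 1 by rewrite r0 -subr_gt0 (lt_trans _ rq)// invr_gt0.
have w0 i : 0 <= scale_weight q i by rewrite divr_ge0// ltW.
have le1 i : (i <= q)%N -> mdist y xi < 4 * 2 ^- i ->
    scale_weight q i <= \sum_(i < q.+1) scale_weight q i * \1_(ball y (4 * 2 ^- i)) xi.
  move=> iq yxi; rewrite -ltnS in iq; rewrite (bigD1 (Ordinal iq))//=.
  rewrite indicE mem_set; last by rewrite ballEmdist.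
  by rewrite mulr1 lerDl sumr_ge0// => j _; rewrite mulr_ge0.
have [yq|qy] := ltP (mdist y xi) (4 * 2 ^- q).
  apply: le_trans (ler_wpM2l _ (le1 q (leqnn q) yq)); last exact: ltW.
  rewrite /scale_weight subnn expr0 divr1.
  apply: le_trans (poisson_kernel_le r01 _ (pole_dist_ge r01 y xi)) _.
    by case/andP: r01; lra.
  rewrite exprS invfM mulrA mulfK; last by case/andP: r01 => _ ?; rewrite gt_eqF// subr_gt0.
  have rd : 0 < (1 - r) ^+ d by rewrite exprn_gt0//; case/andP: r01; lra.
  rewrite ler_pdivrMr//.
  have : 1 <= 2 ^+ (q.+1 * d) * (1 - r) ^+ d.
    rewrite exprM -exprMn exprn_ege1// mulrC -ler_pdivrMr//.
    by rewrite mul1r ltW.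
  rewrite mulSn exprD 2!exprS; move: (2 ^+ (q * d)) (2 ^+ d) ((1 - r) ^+ d) => A B C; lra.
have ex : exists j, 4 * 2 ^- j <= mdist y xi by exists q.
case: (ex_minnP ex) => -[|i] yi min.
  by have := mdist_sphere_le2 y xi; move: yi; rewrite expr0 invr1; lra.
have iq : (i < q)%N by exact: min.
have yxi : mdist y xi < 4 * 2 ^- i.
  by rewrite ltNge; apply/negP => /min; rewrite ltnn.
apply: le_trans (ler_wpM2l _ (le1 i (ltnW iq) yxi)); last exact: ltW.
have ti : 2 ^- i <= pole_dist r y xi.
  have := mdist_le_pole_dist r01 y xi; move: yi; rewrite exprS invfM.
  by move: (2 ^- i) => v; lra.
apply: le_trans (poisson_kernel_le r01 _ ti) _; first by rewrite invr_gt0.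
have r1 : (1 - r) * 2 ^+ i <= 2 ^- (q - i).
  by rewrite -ler_pdivlMr// -invfM -exprD ?subnK ?subnKC// ltnW.
rewrite exprVn invrK exprS mulrA -(mulrA 2) /scale_weight exprM [in leRHS]mulrCA.
rewrite (mulrC ((2 ^+ i) ^+ d)) ler_wpM2r ?exprn_ge0//.
apply: ler_pM => //; first by rewrite mulr_ge0//; case/andP: r01; lra.
by rewrite exprS ler_peMr// exprn_ege1// ler1n.
Qed.

End kernel.

Arguments scale_weight R d : clear implicits.

Lemma geo_half_sum {R : realType} q : \sum_(i < q.+1) 2 ^- (q - i) <= 2 :> R.
Proof.
suff : \sum_(i < q.+1) 2 ^- (q - i) = 2 - 2 ^- q :> R.
  by move=> ->; rewrite gerBl invr_ge0 exprn_ge0.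
elim: q => [|q IH]; first by rewrite big_ord_recl big_ord0 subnn expr0 invr1; lra.
rewrite big_ord_recr /= subnn expr0 invr1.
rewrite (eq_bigr (fun i : 'I_q.+1 => 2^-1 * 2 ^- (q - i))); last first.
  by move=> i _; rewrite subSn ?leq_ord// exprS invfM.
rewrite -mulr_sumr IH exprS invfM; lra.
Qed.

Section poisson_transform.
Context {R : realType} {d : nat}.
Hypothesis d_gt0 : (0 < d)%N.
Local Notation sigma := (sigma R d).
Implicit Types (y xi : sphere R d) (u v : sphere R d -> R) (r : R).

(** Stated for plain functions, so that bounded approximants and [net_fun] can be inserted; for an
    element of the space it unfolds to [poisson_integral]. *)
Definition poisson r u y : R :=
  \int[sigma]_xi (poisson_kernel (r *: sphere_val y) xi * u xi).

Definition norm1 u : R := \int[sigma]_xi `|u xi|.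

Definition ball_mass u y e : R := \int[sigma]_(xi in ball y e) `|u xi|.

Local Notation L1 u := (sigma.-integrable setT (EFin \o u)).

Lemma norm1_ge0 u : 0 <= norm1 u.
Proof. by apply: Rintegral_ge0. Qed.

Lemma ball_mass_ge0 u y e : 0 <= ball_mass u y e.
Proof. by apply: Rintegral_ge0. Qed.

Lemma ball_mass_indic u y e : L1 u ->
  ball_mass u y e = \int[sigma]_xi (\1_(ball y e) xi * `|u xi|).
Proof.
move=> u1; rewrite /ball_mass Rintegral_mkcond; apply: eq_Rintegral => xi _.
by rewrite patchE indicE; case: ifP => _; rewrite ?mul1r ?mul0r.
Qed.

Lemma integrable_bounded_mul u (k : sphere R d -> R) M : L1 u ->
  measurable_fun setT k -> (forall xi, `|k xi| <= M) -> L1 (fun xi => k xi * u xi).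
Proof.
move=> u1 mk kM.
apply: (@integrableMr _ _ _ sigma setT measurableT k (EFin \o u)) => //.
exists M; split; first exact: num_real.
by move=> x Mx t _; apply: le_trans (kM t) (ltW Mx).
Qed.

Lemma ball_mass_int u y e : L1 u -> L1 (fun xi => \1_(ball y e) xi * `|u xi|).
Proof.
move=> u1; apply: (@integrable_bounded_mul _ _ 1); first exact: (integrable_norm u1).
  by apply: measurable_indic; exact: measurable_ball_sphere.
by move=> xi; rewrite indicE; case: (_ \in _); rewrite ?normr1 ?normr0.
Qed.

Lemma ball_mass_le_norm1 u y e : L1 u -> ball_mass u y e <= norm1 u.
Proof.
move=> u1; rewrite ball_mass_indic//; apply: le_Rintegral => //.
- exact: ball_mass_int.
- exact: integrable_norm.
- by move=> xi _; rewrite indicE; case: (_ \in _); rewrite ?mul1r ?mul0r.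
Qed.

(** Serves concentric balls in [poisson_majorant] and disjoint ones in [heavy_family_card]. *)
Lemma ball_mass_sum I (s : seq I) (c : I -> R) (z : I -> sphere R d) (e : I -> R) u :
  L1 u ->
  L1 (fun xi => \sum_(i <- s) c i * (\1_(ball (z i) (e i)) xi * `|u xi|)) /\
  \sum_(i <- s) c i * ball_mass u (z i) (e i) =
    \int[sigma]_xi (\sum_(i <- s) c i * (\1_(ball (z i) (e i)) xi * `|u xi|)).
Proof.
move=> u1; have bint i : L1 (fun xi => c i * (\1_(ball (z i) (e i)) xi * `|u xi|)).
  apply: (@integrable_bounded_mul _ (fun=> _) `|c i|) => //.
  exact: ball_mass_int.
have sint (t : seq I) : L1 (fun xi => \sum_(i <- t) c i * (\1_(ball (z i) (e i)) xi * `|u xi|)).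
  have := @integrable_sum _ _ _ sigma setT measurableT _ t xpredT
    (fun i => EFin \o (fun xi => c i * (\1_(ball (z i) (e i)) xi * `|u xi|))).
  move=> /(_ (fun i _ => bint i)).
  by apply: eq_integrable => // xi _ /=; rewrite sumEFin.
split => //; elim: s => [|i s IH].
  rewrite big_nil; under eq_Rintegral do rewrite big_nil.
  by rewrite Rintegral_cst// mul0r.
rewrite big_cons IH; under [RHS]eq_Rintegral do rewrite big_cons.
rewrite RintegralD// RintegralZl// ?ball_mass_indic//; exact: ball_mass_int.
Qed.

Lemma poisson_int r u y : 0 <= r < 1 -> L1 u ->
  L1 (fun xi => poisson_kernel (r *: sphere_val y) xi * u xi).
Proof.
move=> r01 u1; apply: integrable_bounded_mul => //.
  exact: poisson_kernel_measurable.
by move=> xi; exact: (poisson_kernel_bounded r01).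
Qed.

Lemma norm_poisson_le r u y : 0 <= r < 1 -> L1 u ->
  `|poisson r u y| <= \int[sigma]_xi (poisson_kernel (r *: sphere_val y) xi * `|u xi|).
Proof.
move=> r01 u1; apply: le_trans (le_normr_Rintegral _ (poisson_int y r01 u1)) _ => //.
rewrite le_eqVlt; apply/orP; left; apply/eqP; apply: eq_Rintegral => xi _.
by rewrite normrM ger0_norm// (poisson_kernel_ge0 r01).
Qed.

(** A crude bound by the supremum of the kernel; it determines [stability_radius]. *)
Lemma poisson_bound r u y : 0 <= r < 1 -> L1 u ->
  `|poisson r u y| <= 2 * (1 - r) / (1 - r) ^+ d.+1 * norm1 u.
Proof.
move=> r01 u1; apply: le_trans (norm_poisson_le y r01 u1) _.
rewrite /norm1 -RintegralZl//; last exact: integrable_norm.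
apply: le_Rintegral => //.
- by apply: poisson_int => //; exact: integrable_norm.
- apply: (@integrable_bounded_mul _ (fun=> _) `|2 * (1 - r) / (1 - r) ^+ d.+1|) => //.
  exact: integrable_norm.
- move=> xi _; rewrite ler_wpM2r//.
  exact: le_trans (ler_norm _) (poisson_kernel_bounded r01 _ _).
Qed.

Lemma poissonB r u v y : 0 <= r < 1 -> L1 u -> L1 v ->
  poisson r (fun xi => u xi - v xi) y = poisson r u y - poisson r v y.
Proof.
move=> r01 u1 v1; rewrite /poisson -RintegralB//; try exact: poisson_int.
by apply: eq_Rintegral => xi _; rewrite mulrBr.
Qed.

Lemma poissonDZ r u v (c : R) y : 0 <= r < 1 -> L1 u -> L1 v ->
  poisson r (fun xi => u xi + c * v xi) y = poisson r u y + c * poisson r v y.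
Proof.
move=> r01 u1 v1.
have cv : L1 (fun xi => c * v xi) by apply: (@integrable_bounded_mul _ (fun=> c) `|c|).
rewrite /poisson -RintegralZl//; last exact: poisson_int.
rewrite -RintegralD//; first by apply: eq_Rintegral => xi _; rewrite mulrDr [c * (_ * _)]mulrCA.
- exact: poisson_int.
- by apply: (@integrable_bounded_mul _ (fun=> c) `|c|) => //; exact: poisson_int.
Qed.

Lemma poisson_majorant r q u y : 0 <= r -> 2 ^- q.+1 < 1 - r <= 2 ^- q -> L1 u ->
  `|poisson r u y| <=
    2 ^+ d.+2 * \sum_(i < q.+1) scale_weight R d q i * ball_mass u y (4 * 2 ^- i).
Proof.
move=> r0 rq u1.
have r01 : 0 <= r < 1.
  rewrite r0 -subr_gt0; case/andP: rq => rq _.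
  by rewrite (lt_trans _ rq)// invr_gt0 exprn_gt0.
apply: le_trans (norm_poisson_le y r01 u1) _.
have [sint ->] := ball_mass_sum (index_enum 'I_q.+1)
  (fun i => scale_weight R d q i) (fun=> y) (fun i => 4 * 2 ^- i) u1.
rewrite -RintegralZl//; apply: le_Rintegral => //.
- by apply: poisson_int => //; exact: integrable_norm.
- by apply: (@integrable_bounded_mul _ (fun=> _) `|2 ^+ d.+2|).
- move=> xi _; have := poisson_kernel_majorant y xi r0 rq.
  move=> /(ler_wpM2r (normr_ge0 (u xi)))/le_trans; apply.
  rewrite -mulrA mulr_suml; under eq_bigr do rewrite -mulrA.
  by [].
Qed.

Definition poisson_bound_const : R :=
  2 ^+ d.+2 * (2 * (@sigma_ball_const R d * 4 ^+ d)).

Lemma ball_mass_bounded u M y e : L1 u -> (forall xi, `|u xi| <= M) -> 0 < e ->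
  ball_mass u y e <= M * (@sigma_ball_const R d * e ^+ d).
Proof.
move=> u1 uM e0; have M0 : 0 <= M := le_trans (normr_ge0 _) (uM point).
apply: (@le_trans _ _ (\int[sigma]_(xi in ball y e) M)).
  apply: le_Rintegral => //; first exact: measurable_ball_sphere.
  - apply: integrableS (integrable_norm u1) => //; exact: measurable_ball_sphere.
  - by apply: finite_measure_integrable_cst; exact: measurable_ball_sphere.
rewrite Rintegral_cst; last exact: measurable_ball_sphere.
rewrite ler_wpM2l// -lee_fin fineK; first exact: sigma_ball_le.
by apply: fin_num_measure; exact: measurable_ball_sphere.
Qed.

(** The integral of the kernel is not computed: the dyadic majorant and the volume of balls bound it
    by a geometric series, uniformly in [r]. *)
Lemma poisson_bounded r u M y : 0 <= r < 1 -> L1 u -> (forall xi, `|u xi| <= M) ->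
  `|poisson r u y| <= poisson_bound_const * M.
Proof.
move=> r01 u1 uM; have M0 : 0 <= M := le_trans (normr_ge0 _) (uM point).
have S0 := @sigma_ball_const_gt0 R d d_gt0; have r0 : 0 <= r by case/andP: r01.
have [q rq] : exists q, 2 ^- q.+1 < 1 - r <= 2 ^- q.
  by apply: dyadic_scale; case/andP: r01; lra.
apply: le_trans (poisson_majorant y r0 rq u1) _.
rewrite /poisson_bound_const -mulrA ler_wpM2l ?exprn_ge0//.
apply: (@le_trans _ _ (\sum_(i < q.+1) 2 ^- (q - i) * (@sigma_ball_const R d * 4 ^+ d * M))).
  apply: ler_sum => i _.
  have p0 : 0 < 4 * 2 ^- i :> R by rewrite mulr_gt0// invr_gt0 exprn_gt0.
  apply: le_trans (ler_wpM2l _ (ball_mass_bounded y u1 uM p0)) _.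
    by rewrite divr_ge0// exprn_ge0.
  rewrite /scale_weight exprMn exprVn -exprM.
  have pn : 2 ^+ (i * d) != 0 :> R by rewrite expf_neq0.
  rewrite [leLHS](_ : _ = 2 ^- (q - i) * (@sigma_ball_const R d * 4 ^+ d * M) * (2 ^+ (i * d) / 2 ^+ (i * d))).
    by rewrite divff// mulr1.
  by ring.
rewrite -mulr_suml -[leRHS]mulrA; apply: ler_wpM2r; last exact: geo_half_sum.
by apply: mulr_ge0 => //; apply: mulr_ge0; [exact: ltW|exact: exprn_ge0].
Qed.

Lemma poisson_lipschitz r u : 0 <= r < 1 -> L1 u -> exists L, forall y y',
  `|poisson r u y - poisson r u y'| <= L * mdist y y'.
Proof.
move=> r01 u1; have [L L0 KL] := @poisson_kernel_lipschitz R d r r01.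
exists (L * norm1 u) => y y'; rewrite /poisson -RintegralB//; try exact: poisson_int.
under eq_Rintegral do rewrite -mulrBl.
pose k xi := poisson_kernel (r *: sphere_val y) xi - poisson_kernel (r *: sphere_val y') xi.
have kint : L1 (fun xi => k xi * u xi).
  apply: (@integrable_bounded_mul _ _ (L * mdist y y')) => //.
    by apply: measurable_funB; exact: poisson_kernel_measurable.
  by move=> xi; apply: le_trans (KL _ _ _ _) _; rewrite mdistxx addr0.
apply: le_trans (le_normr_Rintegral _ kint) _ => //.
rewrite mulrAC /norm1 -RintegralZl//; last exact: integrable_norm.
apply: le_Rintegral => //; first exact: (integrable_norm kint).
  apply: (@integrable_bounded_mul _ (fun=> _) `|L * mdist y y'|) => //.
  exact: integrable_norm.
move=> xi _; rewrite normrM ler_wpM2r//.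
by apply: le_trans (KL _ _ _ _) _; rewrite mdistxx addr0.
Qed.

Lemma poisson_measurable r u : 0 <= r < 1 -> L1 u ->
  measurable_fun [set: sphere R d] (poisson r u).
Proof.
move=> r01 u1; have [L uL] := poisson_lipschitz r01 u1.
by apply: continuous_measurable_sphere; apply: (@lipschitz_continuous_sphere _ _ _ L).
Qed.

End poisson_transform.
Arguments poisson_bound_const R d : clear implicits.

(** * Order of growth and the upper bound for the dimension *)

Section growth_order.
Context {R : realType}.
Implicit Types (p : R -> R) (g b r : R).

Definition growth_order p : \bar R :=
  limf_esup (fun r => (lne `|p r|%:E / (- ln (1 - r))%:E)%E) 1^'-.

Lemma lne_ratio_le (a x g : R) : 0 < x < 1 ->
  (lne `|a|%:E / (- ln x)%:E <= g%:E)%E = (`|a| <= x `^ (- g)).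
Proof.
move=> /andP[x0 x1]; have lnx : 0 < - ln x by rewrite oppr_gt0 ln_lt0// x0.
rewrite inver gt_eqF// lee_pdivrMr// -EFinM.
have -> : (g * - ln x)%:E = lne (x `^ (- g))%:E.
  by rewrite lne_EFin ?powR_gt0// ln_powR mulNr mulrN.
by rewrite lee_lne ?lee_fin// !in_itv/= leey andbT lee_fin ?powR_ge0.
Qed.

Lemma growth_order_gtP p g (r0 : R) : r0 < 1 -> (g%:E < growth_order p)%E ->
  exists2 r, r0 < r < 1 & (1 - r) `^ (- g) < `|p r|.
Proof.
move=> r01 gp; apply: contrapT => /forall2NP H.
suff : (growth_order p <= g%:E)%E by rewrite leNgt gp.
(* For [r > 0] the denominator - ln (1 - r) is positive. *)
pose r1 := Num.max r0 0.
have r11 : r1 < 1 by rewrite gt_max r01 ltr01.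
have V1 : 1^'- (`]r1, 1[%classic).
  apply/nbhs_ballP; exists (1 - r1) => /=; first by rewrite subr_gt0.
  move=> r /=; rewrite /ball/= ltr_norml in_itv/= => /andP[_ h] ->.
  by rewrite andbT; lra.
apply: le_trans (ereal_inf_lbound _) _; first by exists `]r1, 1[%classic.
apply: ge_ereal_sup => _ [r + <-]; rewrite /= in_itv/= gt_max => /andP[/andP[r0r rp] r1r].
rewrite lne_ratio_le; last by apply/andP; split; lra.
by case: (H r) => [/negP|/negP]; rewrite -?leNgt// r0r r1r.
Qed.

Lemma growth_order_ge p b : (forall g r0, g < b -> r0 < 1 ->
    exists2 r, r0 < r < 1 & (1 - r) `^ (- g) <= `|p r|) ->
  (b%:E <= growth_order p)%E.
Proof.
move=> H; apply: le_ereal_inf_tmp => _ [V V1 <-].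
have /nbhs_ballP[e /= e0 Ve] := V1.
apply/lee_subgt0Pr => x x0.
have [] := H (b - x) (Num.max (1 - e) 0); first by lra.
  by rewrite gt_max ltr01 andbT; lra.
move=> r /andP[]; rewrite gt_max => /andP[er r0] r1 pr.
apply: (@le_trans _ _ (lne `|p r|%:E / (- ln (1 - r))%:E)%E); last first.
  apply: ereal_sup_ubound; exists r => //; apply: Ve => //=.
  by rewrite /ball/= ltr_norml; apply/andP; split; lra.
have x01 : 0 < 1 - r < 1 by apply/andP; split; lra.
have /andP[/ln_lt0 lnr _] : (0 < 1 - r < 1) && true by rewrite x01.
rewrite inver oppr_eq0 lt_eqF// lee_pdivlMr ?oppr_gt0// -EFinD -EFinM.
have -> : ((b - x) * - ln (1 - r))%:E = lne ((1 - r) `^ (- (b - x)))%:E.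
  by case/andP: x01 => x01 _; rewrite lne_EFin ?powR_gt0// ln_powR mulrN mulNr.
by rewrite lee_lne ?lee_fin// !in_itv/= leey andbT lee_fin ?powR_ge0.
Qed.

End growth_order.

Lemma ex_pow2_powR_ge {R : realType} (g B : R) : 0 < g ->
  exists n0, forall n, (n0 <= n)%N -> B <= (2 ^+ n) `^ g.
Proof.
move=> g0; pose B1 := Num.max B 1.
have B10 : 0 <= B1 by rewrite le_max ler01 orbT.
exists (Num.truncn (B1 `^ g^-1)).+1 => n nB.
apply: (@le_trans _ _ B1); first by rewrite le_max lexx.
have gn0 : g != 0 by rewrite gt_eqF.
have -> : B1 = (B1 `^ g^-1) `^ g by rewrite -powRrM mulVf// powRr1.
apply: ge0_ler_powR; rewrite ?nnegrE ?(ltW g0) ?powR_ge0 ?exprn_ge0//.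
apply: le_trans (ltW (truncnS_gt _)) _; rewrite -natrX ler_nat.
exact: leq_trans nB (ltnW (ltn_expl _ _)).
Qed.

Lemma pow2_powR {R : realType} i (a : R) : (2 ^+ i) `^ a = 2 `^ a ^+ i.
Proof.
rewrite -[RHS]powR_mulrn ?powR_ge0// -powRrM mulrC powRrM; congr (_ `^ a).
by rewrite powR_mulrn.
Qed.

(** * Covering the points of large growth *)

Section maximal_order.
Context {R : realType} {d : nat}.
Local Notation sigma := (sigma R d).
Local Notation L1 u := (sigma.-integrable setT (EFin \o u)).
Variable u : sphere R d -> R.
Hypothesis u1 : L1 u.
Implicit Types (y : sphere R d) (g c s : R).

(** The mass of the ball is at least a constant times e^(d - g) at scale e = 2^-i. With the constant
    2^-(d+4), scales that are not heavy contribute at most half of (2^q)^g to [poisson_majorant]. *)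
Definition heavy g i : set (sphere R d) :=
  [set y | (2 ^+ (d + 4))^-1 * ((2 ^+ i) `^ g / 2 ^+ (i * d)) <= ball_mass u y (4 * 2 ^- i)].

(** Otherwise every scale from [I] on is light. The scales before [I] contribute a bounded amount,
    controlled by [B], so for [r] near 1 the majorant stays below (2^q)^g, hence below (1 -
    r)^-g. *)
Lemma growth_order_heavy g y I : 0 < g ->
    (g%:E < growth_order (fun r => poisson r u y))%E ->
  exists2 i, (I <= i)%N & heavy g i y.
Proof.
move=> g0 gy; apply: contrapT => /forall2NP H.
have light i : (I <= i)%N ->
    ball_mass u y (4 * 2 ^- i) <= (2 ^+ (d + 4))^-1 * ((2 ^+ i) `^ g / 2 ^+ (i * d)).
  by move=> Ii; case: (H i) => // /negP; rewrite -ltNge => /ltW.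
pose B := 2 ^+ (I * d) * norm1 u.
have B0 : 0 <= B by rewrite mulr_ge0 ?exprn_ge0 ?norm1_ge0.
have [n0 Hn0] := @ex_pow2_powR_ge R g (2 ^+ (d + 4) * B + 1) g0.
pose N := maxn n0 I.
have [r /andP[rN r1] rg] : exists2 r, 1 - 2 ^- N < r < 1 &
    (1 - r) `^ (- g) < `|poisson r u y|.
  by apply: growth_order_gtP gy; rewrite gtrBl invr_gt0 exprn_gt0.
have r0 : 0 <= r.
  apply: le_trans (ltW rN); rewrite subr_ge0 invf_le1 ?exprn_gt0//.
  by rewrite exprn_ege1// ler1n.
have [q rq] : exists q, 2 ^- q.+1 < 1 - r <= 2 ^- q.
  by apply: dyadic_scale; apply/andP; split; lra.
have Nq : (N <= q)%N.
  have : 2 ^- q.+1 < 2 ^- N :> R by case/andP: rq => + _; move: rN; lra.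
  by rewrite ltf_pV2 ?posrE ?exprn_gt0// ltr_eXn2l ?ltr1n.
have qI : (I <= q)%N := leq_trans (leq_maxr _ _) Nq.
have qg := Hn0 _ (leq_trans (leq_maxl _ _) Nq).
have p2 i : 0 < 2 ^+ i :> R by rewrite exprn_gt0.
have := poisson_majorant y r0 rq u1.
have : \sum_(i < q.+1) scale_weight R d q i * ball_mass u y (4 * 2 ^- i) <=
    2 * ((2 ^+ (d + 4))^-1 * (2 ^+ q) `^ g + B).
  apply: (@le_trans _ _
    (\sum_(i < q.+1) 2 ^- (q - i) * ((2 ^+ (d + 4))^-1 * (2 ^+ q) `^ g + B))).
    apply: ler_sum => i _; have iq : (i <= q)%N by rewrite -ltnS.
    rewrite /scale_weight [2 ^+ _ / _]mulrC -mulrA ler_wpM2l ?invr_ge0 ?(ltW (p2 _))//.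
    have [Ii|iI] := leqP I i.
      apply: (@le_trans _ _ ((2 ^+ (d + 4))^-1 * (2 ^+ q) `^ g)); last by rewrite lerDl.
      apply: le_trans (ler_wpM2l (ltW (p2 _)) (light _ Ii)) _.
      rewrite mulrCA ler_wpM2l ?invr_ge0 ?(ltW (p2 _))// mulrCA divff ?mulr1 ?gt_eqF//.
      apply: ge0_ler_powR; rewrite ?(ltW g0) ?nnegrE ?(ltW (p2 _))//.
      by rewrite ler_eXn2l ?ltr1n.
    apply: (@le_trans _ _ B); last by rewrite lerDr mulr_ge0 ?powR_ge0 ?invr_ge0 ?(ltW (p2 _)).
    apply: ler_pM; rewrite ?ball_mass_ge0 ?(ltW (p2 _))//; last exact: ball_mass_le_norm1.
    by rewrite ler_eXn2l ?ltr1n// leq_mul2r ltnW ?orbT.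
  by rewrite -mulr_suml ler_wpM2r ?geo_half_sum// addr_ge0//
    mulr_ge0 ?powR_ge0 ?invr_ge0 ?(ltW (p2 _)).
move=> /(ler_wpM2l (ltW (p2 d.+2))) sumle /le_trans/(_ sumle).
have : (2 ^+ q) `^ g <= (1 - r) `^ (- g).
  have r10 : 0 < 1 - r by lra.
  rewrite powRN -[leLHS]invrK lef_pV2 ?posrE ?invr_gt0 ?powR_gt0// -powR_inv1 ?powR_ge0//.
  rewrite powRAC powR_inv1 ?(ltW (p2 _))//.
  apply: ge0_ler_powR; rewrite ?nnegrE ?(ltW g0) ?invr_ge0 ?(ltW (p2 _)) ?(ltW r10)//.
  by case/andP: rq.
move: rg qg; rewrite addn4 !exprS.
have E (P X C : R) : 0 < P ->
    2 * (2 * P) * (2 * ((2 * (2 * (2 * (2 * P))))^-1 * X + C)) = X / 2 + 8 * (P * C).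
  by move=> P0; field; rewrite gt_eqF.
rewrite E//; lra.
Qed.

(** The separation makes the balls of radius 4 * 2^-i occurring in [heavy] disjoint. *)
Definition heavy_family g i m (f : 'I_m -> sphere R d) :=
  (forall k, heavy g i (f k)) /\
  (forall k l, k != l -> 8 * 2 ^- i <= mdist (f k) (f l)).

Lemma heavy_family_card g i m (f : 'I_m -> sphere R d) : heavy_family g i f ->
  m%:R <= norm1 u * 2 ^+ (d + 4) * (2 ^+ (i * d) / (2 ^+ i) `^ g).
Proof.
move=> [hf sf].
have p2 j : 0 < 2 ^+ j :> R by rewrite exprn_gt0.
have g0 : 0 < (2 ^+ i) `^ g by rewrite powR_gt0.
pose a := (2 ^+ (d + 4))^-1 * ((2 ^+ i) `^ g / 2 ^+ (i * d)).
have a0 : 0 < a by rewrite mulr_gt0 ?divr_gt0 ?invr_gt0.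
rewrite (_ : _ * _ = norm1 u / a); last first.
  by rewrite /a -mulrA; congr (_ * _); rewrite !invfM !invrK; congr (_ * _); rewrite mulrC.
rewrite ler_pdivlMr//.
apply: (@le_trans _ _ (\sum_(k < m) 1 * ball_mass u (f k) (4 * 2 ^- i))).
  rewrite (_ : m%:R * a = \sum_(k < m) a); last by rewrite sumr_const card_ord mulr_natl.
  apply: ler_sum => k _.
  by rewrite mul1r; exact: hf.
have [sint ->] := ball_mass_sum (index_enum 'I_m) (fun=> 1) f (fun=> 4 * 2 ^- i) u1.
apply: le_Rintegral => //; first exact: integrable_norm.
move=> xi _; have [[k kxi]|none] := pselect (exists k, ball (f k) (4 * 2 ^- i) xi).
  rewrite (bigD1 k)//= big1 ?addr0; first by rewrite mul1r indicE mem_set// mul1r.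
  move=> l lk; rewrite indicE memNset ?mul0r ?mulr0// => lxi.
  have := sf _ _ lk; move: kxi lxi; rewrite !ballEmdist/= (metric_sym (f k)) => kxi lxi.
  have := metric_triangle (f l) xi (f k); move: kxi lxi; move: (2 ^- i) => e; lra.
rewrite big1// => k _; rewrite indicE memNset ?mul0r ?mulr0// => kxi.
by apply: none; exists k.
Qed.

(** A family of maximal size exists because [heavy_family_card] bounds the sizes; by maximality the
    balls of twice the radius around its points cover. *)
Lemma heavy_premeasure g s i (delta : R) : 0 <= s -> 16 * 2 ^- i <= delta ->
  (hausdorff_premeasure s delta (heavy g i) <=
   (norm1 u * 2 ^+ (d + 4) * 16 `^ s * (2 ^+ i) `^ (d%:R - g - s))%:E)%E.
Proof.
move=> s0 idelta.
have p2 j : 0 < 2 ^+ j :> R by rewrite exprn_gt0.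
pose P m := `[< exists f : 'I_m -> sphere R d, heavy_family g i f >].
have P0 : exists m, P m.
  by exists 0%N; apply/asboolP; exists (fun=> point); split => -[].
pose X := norm1 u * 2 ^+ (d + 4) * (2 ^+ (i * d) / (2 ^+ i) `^ g).
have Pub m : P m -> (m <= Num.truncn X)%N.
  move=> /asboolP[f /heavy_family_card fX].
  by rewrite truncn_ge_nat// (le_trans _ fX).
case: (ex_maxnP P0 Pub) => m /asboolP[f [hf sf]] max.
have cov : heavy g i `<=` \bigcup_k ball (f k) (8 * 2 ^- i).
  move=> y hy; apply: contrapT => ny.
  suff : P m.+1 by move=> /max; rewrite ltnn.
  apply/asboolP; exists (fun k => if unlift ord0 k is Some l then f l else y); split.
    by move=> k; case: unliftP => [l _|_].
  have yf l : 8 * 2 ^- i <= mdist y (f l).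
    rewrite leNgt; apply/negP => yl; apply: ny; exists l => //.
    by rewrite ballEmdist/= metric_sym.
  move=> k l; case: unliftP => [k' ->|->]; case: unliftP => [l' ->|->] kl //.
  - by apply: sf; apply: contra kl => /eqP ->.
  - by rewrite metric_sym.
have dball k : (diam (ball (f k) (8 * 2 ^- i)) <= (16 * 2 ^- i)%:E)%E.
  apply: diam_le => [|x y]; first by rewrite mulr_ge0 ?invr_ge0 ?(ltW (p2 _)).
  rewrite !ballEmdist/= => kx ky; have := metric_triangle x (f k) y.
  rewrite (metric_sym x (f k)); move: kx ky; move: (2 ^- i) => e; lra.
have delta0 : 0 <= delta.
  by apply: le_trans idelta; rewrite mulr_ge0 ?invr_ge0 ?(ltW (p2 _)).
apply: (le_trans (hausdorff_premeasure_fin_cover s delta0 cov _)) => [k|].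
  by apply: le_trans (dball k) _; rewrite lee_fin.
apply: (@le_trans _ _ (\sum_(k < m) ((16 * 2 ^- i) `^ s)%:E)%E).
  apply: lee_sum => k _; apply: hausdorff_gauge_le => //.
rewrite sumEFin lee_fin sumr_const card_ord -[leLHS]mulr_natl.
apply: le_trans (ler_wpM2r (powR_ge0 _ _) (heavy_family_card (conj hf sf))) _.
have p2n : 2 ^+ i != 0 :> R by rewrite gt_eqF.
rewrite powRM ?invr_ge0 ?(ltW (p2 _))//.
rewrite (powRB (x := 2 ^+ i)); last by rewrite p2n implybT.
rewrite powRB; last by rewrite p2n implybT.
rewrite powR_mulrn ?(ltW (p2 _))// -exprM.
have -> : (2 ^- i) `^ s = ((2 ^+ i) `^ s)^-1.
  by rewrite -powR_inv1 ?(ltW (p2 _))// -powRrM mulN1r powRN.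
by rewrite le_eqVlt; apply/orP; left; apply/eqP; ring.
Qed.

(** The bounds of [heavy_premeasure] for the scales from [I] on form a geometric series of ratio
    2^-(s - (d - g)), whose sum tends to 0 as [I] grows. *)
Lemma hausdorff_growth_order_gt g s : 0 < g -> 0 <= s -> d%:R - g < s ->
  hausdorff_measure s [set y | (g%:E < growth_order (fun r => poisson r u y))%E] = 0%E.
Proof.
move=> g0 s0 gs; apply/eqP; rewrite eq_le hausdorff_measure_ge0 andbT.
apply: ge_ereal_sup => _ [delta /= delta0 <-].
have p2 j : 0 < 2 ^+ j :> R by rewrite exprn_gt0.
pose th := s - (d%:R - g); have th0 : 0 < th by rewrite subr_gt0.
pose D := norm1 u * 2 ^+ (d + 4) * 16 `^ s.
have D0 : 0 <= D by rewrite !mulr_ge0 ?norm1_ge0 ?powR_ge0 ?(ltW (p2 _)).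
pose z : R := 2 `^ (- th).
have z0 : 0 < z by rewrite powR_gt0.
have z1 : z < 1.
  rewrite /z powRN invf_lt1 ?powR_gt0// [ltLHS](_ : 1 = 1 `^ th); last by rewrite powR1.
  by apply: gt0_ltr_powR; rewrite ?nnegrE ?ltr1n.
have zE i : (2 ^+ i) `^ (d%:R - g - s) = z ^+ i.
  by rewrite pow2_powR /z /th; congr (_ `^ _ ^+ _); ring.
apply/lee_addgt0Pr => e e0; rewrite add0e.
have [n0 Hn0] := @ex_pow2_powR_ge R th (D / (1 - z) / e) th0.
have [n1 Hn1] := @ex_pow2_powR_ge R 1 (16 / delta) ltr01.
pose I := maxn n0 n1.
have Ie : D / (1 - z) * z ^+ I <= e.
  have := Hn0 I (leq_maxl _ _); rewrite ler_pdivrMr// => h.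
  have -> : z ^+ I = ((2 ^+ I) `^ th)^-1.
    by rewrite -zE (_ : _ - s = - th) ?powRN// /th; ring.
  by rewrite ler_pdivrMr ?powR_gt0// [leRHS]mulrC.
have Id i : (I <= i)%N -> 16 * 2 ^- i <= delta.
  move=> Ii; have := Hn1 i (leq_trans (leq_maxr _ _) Ii).
  by rewrite powRr1 ?(ltW (p2 _))// !ler_pdivrMr// mulrC.
have cov : [set y | (g%:E < growth_order (fun r => poisson r u y))%E]
    `<=` \bigcup_k heavy g (I + k)%N.
  move=> y /= /(growth_order_heavy I g0)[i Ii hi].
  by exists (i - I)%N => //; rewrite subnKC.
apply: le_trans (le_hausdorff_premeasure s delta cov) _.
apply: le_trans (@hausdorff_premeasure_sigma_subadditive _ _ s delta
  (fun k => heavy g (I + k)%N)) _.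
apply: lime_le.
  by apply: is_cvg_nneseries => *; exact: hausdorff_premeasure_ge0.
apply: nearW => n; apply: (@le_trans _ _ (\sum_(0 <= k < n) (D * z ^+ I * z ^+ k)%:E)%E).
  apply: lee_sum => k _; apply: le_trans (heavy_premeasure g s0 (Id _ (leq_addr _ _))) _.
  by rewrite zE lee_fin -/D exprD mulrA.
rewrite sumEFin lee_fin -mulr_sumr big_mkord.
apply: le_trans Ie; rewrite -[leRHS]mulrA [_^-1 * _]mulrC mulrA.
rewrite ler_wpM2l ?(mulr_ge0 D0) ?exprn_ge0 ?(ltW z0)//.
rewrite -[leRHS]mul1r ler_pdivlMr ?subr_gt0//.
have := subrX1 z n; have := exprn_ge0 n (ltW z0); move: (\sum_(i < n) _) => S; nra.
Qed.

End maximal_order.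

(** * Approximation in the space of integrable functions *)

Section Lspace_lemmas.
Context {R : realType} {d : nat}.
Local Notation sigma := (sigma R d).
Local Notation L1 u := (sigma.-integrable setT (EFin \o u)).
Implicit Types (f g : LspaceType1 sigma).

Lemma Lspace_integrable f : L1 (f : sphere R d -> R).
Proof.
apply/integrableP; split.
  apply/measurable_EFinP.
  have mf := measurable_funPT (repr (f : {mfun_ sigma, sphere R d >-> measurableTypeR R})).
  by move=> mT Y mY; exact: mf.
by have := Lebesgue_finite (s := f); rewrite /finite_norm Lnorm1.
Qed.

Lemma mdist_LspaceE f g : mdist f g = norm1 (fun x => f x - g x).
Proof.
rewrite /mdist /= /norm1 /Rintegral Lnorm1.
by [].
Qed.

(** The coercion from the class of [v] picks a representative that agrees with [v] only almost
    everywhere, hence a statement about the norm. *)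
Lemma ex_Lspace (v : sphere R d -> R) : L1 v ->
  exists f, norm1 (fun x => f x - v x) = 0.
Proof.
move=> v1; have mv : measurable_fun setT (v : sphere R d -> measurableTypeR R).
  by have /measurable_int/measurable_EFinP := v1.
pose V := HB.pack_for {mfun (sphere R d) >-> measurableTypeR R} v
  (isMeasurableFun.Build _ _ _ _ _ mv).
pose q : {mfun_ sigma, sphere R d >-> measurableTypeR R} := (\pi V)%qT.
have qv : (q : sphere R d -> R) = v %[ae sigma].
  have /asboolP : ae_eq_op sigma (repr q) V by rewrite -eqmodE reprK.
  by [].
have mq : measurable_fun setT (q : sphere R d -> R).
  by have mq := measurable_funPT (repr q); move=> mT Y mY; exact: mq.
have fq : finite_norm sigma 1 (q : sphere R d -> R).
  have /integrableP[_] := v1; rewrite /finite_norm Lnorm1.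
  rewrite (@ae_eq_integral _ _ _ sigma setT
    (fun x => `|(v x)%:E|)%E (fun x => `|(EFin \o q) x|)%E) //.
  - by apply: measurableT_comp => //; exact/measurable_EFinP.
  - by apply: measurableT_comp => //; exact/measurable_EFinP.
  - by move: qv; apply: filterS => x qx _; rewrite /= qx.
pose f : LspaceType1 sigma := HB.pack_for (LspaceType1 sigma) q
  (isFinLebesgue.Build _ _ _ _ _ _ q fq).
exists f; rewrite /norm1 /Rintegral.
rewrite (@ae_eq_integral _ _ _ sigma setT (cst 0%E)) ?integral0//.
  by apply/measurable_EFinP; apply: measurableT_comp => //; exact: measurable_funB.
by move: qv; apply: filterS => x qx _; rewrite /= qx// subrr normr0.
Qed.

End Lspace_lemmas.

Section norm1_lemmas.
Context {R : realType} {d : nat}.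
Local Notation sigma := (sigma R d).
Local Notation L1 u := (sigma.-integrable setT (EFin \o u)).
Implicit Types (u v w : sphere R d -> R).

Lemma integrable_sub u v : L1 u -> L1 v -> L1 (fun x => u x - v x).
Proof. by move=> u1 v1; have := integrableB measurableT u1 v1; apply: eq_integrable. Qed.

Lemma integrable_addZ u v (c : R) : L1 u -> L1 v -> L1 (fun x => u x + c * v x).
Proof.
move=> u1 v1; have := integrableD measurableT u1 (integrableZl measurableT c v1).
by apply: eq_integrable.
Qed.

Lemma norm1_triangle u v w : L1 u -> L1 v -> L1 w ->
  norm1 (fun x => u x - w x) <= norm1 (fun x => u x - v x) + norm1 (fun x => v x - w x).
Proof.
move=> u1 v1 w1; rewrite /norm1.
have uv := integrable_norm (integrable_sub u1 v1).
have vw := integrable_norm (integrable_sub v1 w1).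
rewrite -RintegralD//; apply: le_Rintegral => //.
- exact: integrable_norm (integrable_sub u1 w1).
- by have := integrableD measurableT uv vw; apply: eq_integrable.
- by move=> x _; rewrite -[u x - w x](subrKA (v x)) ler_normD.
Qed.

Lemma norm1_addZ u w h (c : R) : 0 <= c -> L1 u -> L1 w -> L1 h ->
  norm1 (fun x => u x - (w x + c * h x)) <= norm1 (fun x => u x - w x) + c * norm1 h.
Proof.
move=> c0 u1 w1 h1; rewrite /norm1.
have uw := integrable_norm (integrable_sub u1 w1).
have hh := integrable_norm h1.
have ch : L1 (fun x => c * `|h x|).
  by have := integrableZl measurableT c hh; apply: eq_integrable.
rewrite -RintegralZl// -RintegralD//; apply: le_Rintegral => //.
- exact: integrable_norm (integrable_sub u1 (integrable_addZ c w1 h1)).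
- by have := integrableD measurableT uw ch; apply: eq_integrable.
- move=> x _; rewrite opprD addrA (le_trans (ler_normD _ _))//.
  by rewrite normrN normrM (ger0_norm c0).
Qed.

Lemma bounded_approx u e : L1 u -> 0 < e ->
  exists M g, [/\ L1 g, forall x, `|g x| <= M & norm1 (fun x => u x - g x) < e].
Proof.
move=> u1 e0.
have [g_ [g1 _ gu]] := approximation_sfun_integrable measurableT u1.
have := gu; move/fine_cvgP => [_ /cvgrPdist_lt/(_ _ e0)[n _ /(_ n (leqnn n))]].
rewrite /= sub0r normrN => gne.
have [M [_ bM]] := simple_bounded (g_ n).
exists (M + 1), (HBSimple.SimpleFun.sort (g_ n)); split; first exact: g1.
  by move=> x; apply: bM => //; rewrite ltrDl.
by apply: le_lt_trans gne; rewrite /norm1 /Rintegral ler_norm.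
Qed.

End norm1_lemmas.

(** * Functions concentrated near a net *)

Section net_functions.
Context {R : realType} {d : nat}.
Hypothesis d_gt0 : (0 < d)%N.
Local Notation sigma := (sigma R d).
Local Notation L1 u := (sigma.-integrable setT (EFin \o u)).
Local Notation side := (@cube_side R d).

Definition net_point n (f : {ffun 'I_d -> 'I_(2 ^ n)}) : 'rV[R]_d :=
  \row_j (side * ((f j)%:R / 2 ^+ n)).

Lemma side_gt0 : 0 < side. Proof. exact: (@patch_width_gt0 R d). Qed.

Lemma net_cube n f : chart_cube (@net_point n f) (side / 2 ^+ n) `<=` base_cube.
Proof.
move=> x fx j; have := fx j; rewrite !mxE add0r => /andP[fxj xfj].
have p2 i : 0 < 2 ^+ i :> R by rewrite exprn_gt0.
have s0 := side_gt0.
apply/andP; split.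
  by apply: le_trans fxj; rewrite mulr_ge0 ?(ltW s0) ?divr_ge0 ?(ltW (p2 _)).
apply: le_trans xfj _; rewrite -mulrDr ler_piMr ?(ltW s0)// -[X in _ + X]mul1r -mulrDl.
by rewrite ler_pdivrMr// mul1r natr1 -natrX ler_nat.
Qed.

(** The radius is at most 2^-q for all q <= n^2, so at these scales the ball acts like a point
    mass. *)
Definition net_ball n f := ball (chart (@net_point n f)) (2 ^- (n * n)).

Lemma sigma_net_ball_gt0 n f : 0 < fine (sigma (@net_ball n f)).
Proof.
have p2 i : 0 < 2 ^- i :> R by rewrite invr_gt0 exprn_gt0.
rewrite -lte_fin fineK; last by apply: fin_num_measure; exact: measurable_ball_sphere.
apply: sigma_ball_gt0 => //.
by exists (side / 2 ^+ n); [rewrite mulr_gt0 ?side_gt0|exact: net_cube].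
Qed.

Definition net_fun n xi : R :=
  \sum_(f : {ffun 'I_d -> 'I_(2 ^ n)})
    (2 ^- (n * d) / fine (sigma (net_ball f))) * \1_(net_ball f) xi.

Let weight_ge0 n (f : {ffun 'I_d -> 'I_(2 ^ n)}) :
  0 <= 2 ^- (n * d) / fine (sigma (net_ball f)).
Proof. by rewrite divr_ge0 ?invr_ge0 ?exprn_ge0// ltW// sigma_net_ball_gt0. Qed.

Let term_int n (f : {ffun 'I_d -> 'I_(2 ^ n)}) (c : R) : L1 (fun xi => c * \1_(net_ball f) xi).
Proof.
have := integrableZl measurableT c
  (@integrable_indic _ _ R sigma (net_ball f) (measurable_ball_sphere _ _)).
by apply: eq_integrable.
Qed.

Lemma net_fun_ge0 n xi : 0 <= net_fun n xi.
Proof. by apply: sumr_ge0 => f _; rewrite mulr_ge0. Qed.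

Lemma net_fun_int n : L1 (net_fun n).
Proof.
have := @integrable_sum _ _ _ sigma setT measurableT _ (index_enum {ffun 'I_d -> 'I_(2 ^ n)}) xpredT
    (fun f => EFin \o (fun xi => (2 ^- (n * d) / fine (sigma (net_ball f))) * \1_(net_ball f) xi)).
move=> /(_ (fun f _ => term_int f _)).
by apply: eq_integrable => // xi _ /=; rewrite sumEFin.
Qed.

Lemma Rintegral_indic_ball (f : set (sphere R d)) : measurable f ->
  \int[sigma]_xi (\1_f xi) = fine (sigma f).
Proof. by move=> mf; rewrite /Rintegral integral_indic// setIT. Qed.

Lemma norm1_net_fun n : norm1 (net_fun n) <= 1.
Proof.
rewrite /norm1; under eq_Rintegral do rewrite ger0_norm ?net_fun_ge0//.
have E (s : seq {ffun 'I_d -> 'I_(2 ^ n)}) :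
    \int[sigma]_xi (\sum_(f <- s) (2 ^- (n * d) / fine (sigma (net_ball f))) * \1_(net_ball f) xi)
    = \sum_(f <- s) 2 ^- (n * d).
  elim: s => [|f s IH].
    rewrite big_nil; under eq_Rintegral do rewrite big_nil.
    by rewrite Rintegral_cst// mul0r.
  rewrite big_cons -IH; under eq_Rintegral do rewrite big_cons.
  rewrite RintegralD//.
    congr (_ + _); rewrite RintegralZl//; last first.
      exact: (integrable_indic _ (measurable_ball_sphere _ _)).
    rewrite Rintegral_indic_ball; last exact: measurable_ball_sphere.
    by rewrite divfK// gt_eqF// sigma_net_ball_gt0.
  have := @integrable_sum _ _ _ sigma setT measurableT _ s xpredT
    (fun f => EFin \o (fun xi => (2 ^- (n * d) / fine (sigma (net_ball f))) * \1_(net_ball f) xi)).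
  move=> /(_ (fun f _ => term_int f _)).
  by apply: eq_integrable => // xi _ /=; rewrite sumEFin.
rewrite E sumr_const card_ffun !card_ord -[leLHS]mulr_natl.
by rewrite natrX natrX -exprM divff// gt_eqF// exprn_gt0.
Qed.

Definition near_net n q : set (sphere R d) :=
  [set y | exists2 x, base_cube x /\ y = chart x &
     exists f : {ffun 'I_d -> 'I_(2 ^ n)},
       forall j, `|x ord0 j - net_point f ord0 j| <= 2 ^- q].

(** The constant of [poisson_kernel_ge] for k = 1 + [patch_lip R d]: a point of [near_net n q] is
    within [patch_lip R d] times 2^-q of a centre, and the net ball adds at most 2^-q. *)
Definition net_const : R := ((2 + patch_lip R d) ^+ d.+1)^-1.

Lemma net_const_gt0 : 0 < net_const.
Proof. by rewrite invr_gt0 exprn_gt0// addr_gt0// patch_lip_gt0. Qed.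

Lemma radius01 q : 0 <= (1 - 2 ^- q : R) < 1.
Proof.
apply/andP; split; last by rewrite ltrBlDr ltrDl invr_gt0 exprn_gt0.
by rewrite subr_ge0 invf_le1 ?exprn_gt0// exprn_ege1// ler1n.
Qed.

(** Kernel and summands are nonnegative, so one net ball within reach of [y] is enough. *)
Lemma net_fun_poisson n q y : (q <= n * n)%N -> near_net n q y ->
  net_const * (2 ^+ (q * d) / 2 ^+ (n * d)) <= poisson (1 - 2 ^- q) (net_fun n) y.
Proof.
move=> qn [x [xQ ->] [f xf]].
have p2 i : 0 < 2 ^+ i :> R by rewrite exprn_gt0.
have L0 := @patch_lip_gt0 R d.
have fQ : base_cube (net_point f).
  by apply: (@net_cube n f) => j; rewrite lexx lerDl divr_ge0// ltW// side_gt0.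
have xfd : mdist (chart x) (chart (net_point f)) <= patch_lip R d * 2 ^- q.
  by apply: chart_mdist_le => //; rewrite invr_ge0 ltW.
pose a := 2 ^- (n * d) / fine (sigma (net_ball f)).
pose m := net_const * 2 ^+ (q * d).
have m0 : 0 <= m by rewrite mulr_ge0 ?(ltW net_const_gt0) ?(ltW (p2 _)).
have -> : net_const * (2 ^+ (q * d) / 2 ^+ (n * d)) = \int[sigma]_xi (m * a * \1_(net_ball f) xi).
  rewrite RintegralZl//; last exact: (integrable_indic _ (measurable_ball_sphere _ _)).
  rewrite Rintegral_indic_ball; last exact: measurable_ball_sphere.
  rewrite -mulrA /a divfK; last by rewrite gt_eqF// sigma_net_ball_gt0.
  by rewrite /m mulrA.
rewrite /poisson; apply: le_Rintegral => //.
  by apply: poisson_int; [exact: radius01|exact: net_fun_int].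
move=> xi _; have K0 := poisson_kernel_ge0 (radius01 q) (chart x) xi.
have [xib|xib] := pselect (net_ball f xi); last first.
  by rewrite indicE memNset// mulr0 mulr_ge0// net_fun_ge0.
rewrite indicE mem_set// mulr1; apply: ler_pM => //; first exact: weight_ge0.
  have xi_le : mdist (chart x) xi <= (1 + patch_lip R d) * (1 - (1 - 2 ^- q)).
    rewrite opprB addrCA subrr addr0 mulrDl mul1r addrC.
    apply: le_trans (metric_triangle _ (chart (net_point f)) _) _.
    apply: lerD => //; move: xib; rewrite /net_ball ballEmdist/= => /ltW/le_trans; apply.
    by rewrite lef_pV2 ?posrE// ler_eXn2l ?ltr1n.
  have k0 : 0 <= 1 + patch_lip R d by rewrite addr_ge0// ltW.
  apply: le_trans (poisson_kernel_ge (radius01 q) k0 xi_le).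
  rewrite /m /net_const addrA opprB addrCA subrr addr0 invfM exprVn -exprM invrK.
  by [].
have f1 : \1_(net_ball f) xi = 1 :> R by rewrite indicE mem_set.
rewrite -[a]mulr1 -f1 /net_fun (bigD1 f) // lerDl.
by apply: sumr_ge0 => g _; apply: mulr_ge0; [exact: weight_ge0|rewrite indicE].
Qed.

End net_functions.
Arguments net_const R d : clear implicits.

Section big_growth.
Context {R : realType} {d : nat}.
Hypothesis d_gt0 : (0 < d)%N.
Local Notation sigma := (sigma R d).
Local Notation L1 u := (sigma.-integrable setT (EFin \o u)).
Local Notation side := (@cube_side R d).

Definition cap : set (sphere R d) := chart @` base_cube.

Lemma cap_measurable : measurable cap.
Proof.
have cc : closed cap.
  apply: compact_closed; first exact: metric_hausdorff.
  apply: continuous_compact; first exact: chart_continuous.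
  have := @rV_compact R d (fun=> `[0, side]%classic) (fun=> @segment_compact R 0 side).
  congr compact; apply/seteqP; split => x /= xQ j; have := xQ j.
    by rewrite in_itv/= mxE add0r.
  by rewrite in_itv/= mxE add0r.
rewrite -(setCK cap); apply: measurableC; apply: measurable_open_sphere.
exact: closed_openC.
Qed.

Lemma cap_near_net n : cap `<=` near_net n n.
Proof.
move=> _ [x xQ <-]; exists x => //.
have s0 := @side_gt0 R d.
have p2 i : 0 < 2 ^+ i :> R by rewrite exprn_gt0.
have H j : exists k : 'I_(2 ^ n), `|x ord0 j - side * (k%:R / 2 ^+ n)| <= 2 ^- n.
  have := xQ j; rewrite mxE add0r => /andP[x0 x1].
  pose t := x ord0 j / side * 2 ^+ n.
  have xt : x ord0 j = side * (t / 2 ^+ n).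
    by rewrite /t mulfK ?gt_eqF// mulrC divfK// gt_eqF.
  have t0 : 0 <= t by rewrite mulr_ge0 ?divr_ge0 ?(ltW s0) ?(ltW (p2 _)).
  suff [k kt] : exists k : 'I_(2 ^ n), `|t - k%:R| <= 1.
    exists k; rewrite xt -mulrBr -mulrBl !normrM (gtr0_norm s0).
    rewrite (gtr0_norm (_ : 0 < 2 ^- n)) ?invr_gt0// mulrA ler_piMl ?invr_ge0 ?(ltW (p2 _))//.
    rewrite -[leRHS]mulr1; apply: ler_pM => //; first exact: ltW.
    by rewrite /cube_side /patch_width invf_le1// ler1n.
  have n2 : ((2 ^ n).-1 < 2 ^ n)%N by rewrite prednK ?expn_gt0.
  have [t2|t2] := ltP t (2 ^+ n).
    have tk : (Num.truncn t < 2 ^ n)%N by rewrite truncn_lt_nat// natrX.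
    exists (Ordinal tk) => /=; have /andP[h1 h2] := truncn_itv t0.
    by rewrite ler_norml; move: h2; rewrite -natr1; lra.
  (* At the far end of the edge [t] is 2^n, which is not an index; the last index is at distance
     1. *)
  exists (Ordinal n2) => /=.
  have tE : t = 2 ^+ n.
    apply/eqP; rewrite eq_le t2 andbT /t ler_piMl ?(ltW (p2 _))//.
    by rewrite ler_pdivrMr// mul1r.
  by rewrite tE -natrX -natrB ?leq_pred// -subn1 subKn ?expn_gt0// normr1.
have [f Hf] := choice H; exists [ffun j => f j] => j.
by rewrite mxE ffunE.
Qed.

Definition low_growth n (c : R) (u : sphere R d -> R) : set (sphere R d) :=
  [set y | cap y /\ `|poisson (1 - 2 ^- n) u y| < c].

(** The first clause serves beta > 0, with [n%:R] bounding the share of the bounded part. The second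
    serves beta = 0: at scale [n] the net function need not dominate the bounded part, and only the
    measure of the points of cancellation is controlled. *)
Definition big_growth n (c : R) (u : sphere R d -> R) :=
  (forall q y, (n <= q <= n * n)%N -> near_net n q y ->
     2 * c * (2 ^+ (q * d) / 2 ^+ (n * d)) - n%:R <= `|poisson (1 - 2 ^- q) u y|) /\
  (sigma (low_growth n c u) <= sigma cap * 2^-1%:E)%E.

Lemma low_growth_measurable n (c : R) u : L1 u -> measurable (low_growth n c u).
Proof.
move=> u1; have mP := poisson_measurable (radius01 n) u1.
have -> : low_growth n c u = cap `&` (Num.norm \o poisson (1 - 2 ^- n) u) @^-1` `]-oo, c[.
  by apply/seteqP; split => y; rewrite /= in_itv.
apply: measurableI; first exact: cap_measurable.
rewrite -[X in measurable X]setTI.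
have : measurable_fun setT (Num.norm \o poisson (1 - 2 ^- n) u) by exact: measurableT_comp.
by apply => //; exact: measurable_itv.
Qed.

(** The coefficient is 1/n or 2/n. At level [n] the two Poisson integrals differ on [cap] by at
    least [net_const R d / n%:R], twice the threshold, so they are never both below it in absolute
    value. The two exceptional sets are disjoint, and one of them has at most half the measure of
    [cap]. *)
Lemma ex_big_growth u e N : L1 u -> 0 < e -> exists n v, [/\ (N <= n)%N, (0 < n)%N, L1 v,
  norm1 (fun x => u x - v x) < e & big_growth n (net_const R d / n%:R / 2) v].
Proof.
move=> u1 e0.
have [M [g [g1 gM ug]]] := bounded_approx u1 e0.
pose gap := e - norm1 (fun x => u x - g x).
have gap0 : 0 < gap by rewrite subr_gt0.
have M0 : 0 <= M := le_trans (normr_ge0 _) (gM point).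
pose n := maxn (maxn N 1)
  (maxn (Num.truncn (2 / gap)).+1 (Num.truncn (poisson_bound_const R d * M)).+1).
have nN : (N <= n)%N by rewrite /n !leq_max leqnn.
have n0 : (0 < n)%N by rewrite /n !leq_max orbT.
have nR : 0 < n%:R :> R by rewrite ltr0n.
have ngap : 2 / n%:R < gap.
  rewrite ltr_pdivrMr// mulrC -ltr_pdivrMr//.
  by apply: lt_le_trans (truncnS_gt _) _; rewrite ler_nat /n !leq_max leqnn !orbT.
have nM : poisson_bound_const R d * M <= n%:R.
  by apply: le_trans (ltW (truncnS_gt _)) _; rewrite ler_nat /n !leq_max leqnn !orbT.
have c0 := @net_const_gt0 R d.
pose v (c : R) x := g x + c * net_fun n x.
have h1 := @net_fun_int R d n.
have v1 c : L1 (v c) by exact: integrable_addZ.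
have vP c q y : poisson (1 - 2 ^- q) (v c) y =
    poisson (1 - 2 ^- q) g y + c * poisson (1 - 2 ^- q) (net_fun n) y.
  by rewrite poissonDZ//; exact: radius01.
have gP q y : `|poisson (1 - 2 ^- q) g y| <= n%:R.
  by apply: le_trans nM; apply: poisson_bounded => //; exact: radius01.
have vnorm c : 0 <= c <= 2 / n%:R -> norm1 (fun x => u x - v c x) < e.
  move=> /andP[c0' c2]; apply: le_lt_trans (norm1_addZ c0' u1 g1 h1) _.
  have : c * norm1 (@net_fun R d n) <= c.
    by rewrite -[leRHS]mulr1 ler_wpM2l//; exact: norm1_net_fun.
  by move: ngap; rewrite /gap; lra.
have vbig c q y : n%:R^-1 <= c -> (n <= q <= n * n)%N -> near_net n q y ->
    2 * (net_const R d / n%:R / 2) * (2 ^+ (q * d) / 2 ^+ (n * d)) - n%:R <=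
      `|poisson (1 - 2 ^- q) (v c) y|.
  move=> cn /andP[_ qn] yq; rewrite vP.
  have := net_fun_poisson d_gt0 qn yq; set h := poisson _ (net_fun n) y => hh.
  have w0 : 0 <= net_const R d * (2 ^+ (q * d) / 2 ^+ (n * d)).
    by rewrite mulr_ge0 ?divr_ge0 ?exprn_ge0 ?(ltW c0).
  have kh : n%:R^-1 * (net_const R d * (2 ^+ (q * d) / 2 ^+ (n * d))) <= c * h.
    by apply: ler_pM => //; rewrite invr_ge0 ltW.
  have := gP q y; rewrite ler_norml => /andP[g1' _].
  apply: le_trans (ler_norm _); rewrite [leRHS]addrC; apply: lerD => //.
  rewrite (_ : 2 * _ = n%:R^-1 * (net_const R d)) -?mulrA//.
  by field; rewrite gt_eqF.
pose S c := low_growth n (net_const R d / n%:R / 2) (v c).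
have mS c : measurable (S c) by exact: low_growth_measurable.
pose c1 : R := n%:R^-1; pose c2 : R := 2 / n%:R.
have S12 : S c1 `&` S c2 = set0.
  apply/seteqP; split => // y [[Ay]] + [_]; rewrite !vP /c1 /c2.
  have := net_fun_poisson d_gt0 (leq_pmulr n n0) (cap_near_net n Ay).
  rewrite divff ?mulr1 ?gt_eqF ?exprn_gt0//.
  move: (poisson _ g y) (poisson _ (net_fun n) y) => p h hh; rewrite !ltr_norml.
  have : n%:R^-1 * net_const R d <= n%:R^-1 * h by rewrite ler_pM2l// invr_gt0.
  by move: (n%:R^-1) => k; lra.
have : (sigma (S c1) + sigma (S c2) <= sigma cap)%E.
  rewrite -measureU//; apply: le_measure; rewrite ?inE//.
  - exact: measurableU.
  - exact: cap_measurable.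
  - by move=> y [[]|[]].
have capfin := fin_num_measure sigma cap cap_measurable.
move=> SS.
have [S1|S2] : (sigma (S c1) <= sigma cap * 2^-1%:E)%E \/
    (sigma (S c2) <= sigma cap * 2^-1%:E)%E.
  have f1 := fin_num_measure sigma _ (mS c1).
  have f2 := fin_num_measure sigma _ (mS c2).
  move: SS; rewrite -(fineK capfin) -(fineK f1) -(fineK f2) -EFinD -EFinM !lee_fin.
  move: (fine _) (fine _) (fine _) => a b c.
  by have [|] := leP c (a * 2^-1); [left|right; lra].
- exists n, (v c1); split => //.
    apply: vnorm; rewrite invr_ge0 ltW//= ler_peMl ?invr_ge0 ?(ltW nR)//.
    by rewrite ler1n.
  by split => // q y nq yq; exact: vbig.
- exists n, (v c2); split => //.
    by apply: vnorm; rewrite divr_ge0 ?(ltW nR)//= lexx.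
  split => // q y nq yq; apply: vbig => //.
  by rewrite ler_peMl ?invr_ge0 ?(ltW nR)// ler1n.
Qed.

End big_growth.

(** * The residual set *)

Section residual_growth.
Context {R : realType} {d : nat}.
Hypothesis d_gt0 : (0 < d)%N.
Local Notation sigma := (sigma R d).
Local Notation L1 u := (sigma.-integrable setT (EFin \o u)).

Definition growth_threshold n : R := net_const R d / n%:R / 2.

(** The part of [big_growth] that survives a perturbation of norm [stability_radius n], which moves
    the Poisson integrals by at most half the threshold, itself at most 1. *)
Definition stable_growth n (u : sphere R d -> R) :=
  (forall q y, (n <= q <= n * n)%N -> near_net n q y ->
     2 * growth_threshold n * (2 ^+ (q * d) / 2 ^+ (n * d)) - n%:R - 1 <=
       `|poisson (1 - 2 ^- q) u y|) /\
  (sigma (low_growth n (growth_threshold n / 2) u) <= sigma cap * 2^-1%:E)%E.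

Lemma growth_threshold_gt0 n : (0 < n)%N -> 0 < growth_threshold n.
Proof. by move=> n0; rewrite !divr_gt0 ?net_const_gt0// ltr0n. Qed.

Lemma growth_threshold_le1 n : (0 < n)%N -> growth_threshold n <= 1.
Proof.
move=> n0; rewrite /growth_threshold -mulrA -invfM.
have L0 := @patch_lip_gt0 R d.
have c1 : net_const R d <= 1.
  by rewrite /net_const invf_le1 ?exprn_gt0 ?exprn_ege1//; lra.
rewrite ler_pdivrMr ?mulr_gt0 ?ltr0n// mul1r (le_trans c1)//.
by rewrite -natrM ler1n; lia.
Qed.

(** At the radii 1 - 2^-q with q <= n^2, [poisson_bound] is at most 2 * 2^(n * n * d) times the
    norm; the product is then half of [growth_threshold n]. *)
Definition stability_radius n : R := growth_threshold n / 4 / 2 ^+ (n * n * d).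

Lemma stability_radius_gt0 n : (0 < n)%N -> 0 < stability_radius n.
Proof.
move=> n0; apply: divr_gt0; last by rewrite exprn_gt0.
by apply: divr_gt0 => //; exact: growth_threshold_gt0.
Qed.

Lemma big_growth_stable n u f : (0 < n)%N -> L1 u -> L1 f ->
    big_growth n (growth_threshold n) u ->
    norm1 (fun x => f x - u x) <= stability_radius n ->
  stable_growth n f.
Proof.
move=> n0 u1 f1 [ug ul] fu; have c0 := growth_threshold_gt0 n0.
have p2 i : 0 < 2 ^+ i :> R by rewrite exprn_gt0.
have fuP q y : (q <= n * n)%N ->
    `|poisson (1 - 2 ^- q) f y - poisson (1 - 2 ^- q) u y| <= growth_threshold n / 2.
  move=> qn; rewrite -poissonB//; last exact: radius01.
  apply: le_trans (poisson_bound y (radius01 q) (integrable_sub f1 u1)) _.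
  rewrite opprB addrCA subrr addr0 exprS invfM.
  rewrite (_ : 2 * 2 ^- q * _ = 2 * 2 ^+ (q * d)); last first.
    rewrite -mulrA; congr (_ * _); rewrite mulrA divff.
      by rewrite mul1r exprVn invrK -exprM.
    by rewrite invr_eq0 gt_eqF.
  apply: (@le_trans _ _ (2 * 2 ^+ (n * n * d) * stability_radius n)).
    apply: ler_pM; rewrite ?mulr_ge0 ?norm1_ge0 ?(ltW (p2 _))// ler_wpM2l//.
    by rewrite ler_eXn2l ?ltr1n// leq_mul2r qn orbT.
  have E (P c : R) : 0 < P -> 2 * P * (c / 4 / P) = c / 2 by move=> P0; field; rewrite gt_eqF.
  by rewrite /stability_radius E.
split => [q y nq yq|].
  have /andP[_ qn] := nq.
  have := ug q y nq yq; have := fuP q y qn; have := growth_threshold_le1 n0.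
  have := ler_normB (poisson (1 - 2 ^- q) f y)
    (poisson (1 - 2 ^- q) f y - poisson (1 - 2 ^- q) u y).
  rewrite opprB addrCA subrr addr0; lra.
apply: le_trans ul; apply: le_measure; rewrite ?inE.
- exact: low_growth_measurable.
- exact: low_growth_measurable.
move=> y [Ay fy]; split => //.
have := fuP n y (leq_pmulr n n0).
have := ler_normB (poisson (1 - 2 ^- n) f y)
  (poisson (1 - 2 ^- n) f y - poisson (1 - 2 ^- n) u y).
rewrite opprB addrCA subrr addr0; lra.
Qed.

(** Density of the open sets is [ex_big_growth], and membership in all of them gives stable growth
    at arbitrarily large [n] by [big_growth_stable]. *)
Lemma residual_stable_growth : residual [set f : LspaceType1 sigma |
  forall N, exists n, [/\ (N <= n)%N, (0 < n)%N & stable_growth n f]].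
Proof.
pose F N : set (LspaceType1 sigma) := \bigcup_(p in [set p : nat * LspaceType1 sigma |
  [/\ (N <= p.1)%N, (0 < p.1)%N & big_growth p.1 (growth_threshold p.1) p.2]])
  (ball p.2 (stability_radius p.1))°.
exists F; split => [N|f fF N].
  split; first by apply: bigcup_open => p _; exact: open_interior.
  move=> O [f Of] oO.
  have /nbhs_ballP[e /= e0 fO] : nbhs f O by exact: open_nbhs_nbhs.
  have [n [v [Nn n0 v1 fv vg]]] := ex_big_growth d_gt0 N (Lspace_integrable f) e0.
  have [u uv] := ex_Lspace v1.
  have u1 := Lspace_integrable u.
  exists u; split.
    apply: fO; rewrite ballEmdist/= mdist_LspaceE.
    apply: le_lt_trans (norm1_triangle (Lspace_integrable f) v1 u1) _.
    rewrite (_ : norm1 (fun x => v x - u x) = 0) ?addr0//.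
    by rewrite -uv /norm1; apply: eq_Rintegral => x _; rewrite distrC.
  have uP r y : 0 <= r < 1 -> poisson r u y = poisson r v y.
    move=> r01; apply/eqP; rewrite -subr_eq0 -normr_le0 -poissonB//.
    by apply: le_trans (poisson_bound y r01 (integrable_sub u1 v1)) _; rewrite uv mulr0.
  exists (n, u); last exact/nbhsx_ballx/stability_radius_gt0.
  split => //=; case: vg => vg vl; split.
    by move=> q y nq yq; rewrite uP ?radius01//; exact: vg.
  rewrite (_ : low_growth _ _ _ = low_growth n (growth_threshold n) v)//.
  by apply/seteqP; split => y [Ay]; rewrite /low_growth/= uP ?radius01.
have [[n u] /= [Nn n0 ug] /interior_subset] := fF N I.
rewrite ballEmdist/= mdist_LspaceE => uf.
exists n; split => //; apply: (big_growth_stable n0 (Lspace_integrable u)) => //.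
  exact: Lspace_integrable.
rewrite (le_trans _ (ltW uf))// /norm1 le_eqVlt; apply/orP; left; apply/eqP.
by apply: eq_Rintegral => x _; rewrite distrC.
Qed.

End residual_growth.
Arguments growth_threshold R d : clear implicits.

(** * The lower bound for the dimension *)

(** Bernoulli's inequality for b = 2^(e/3), cubed: with h = b - 1 it gives (2^n)^e >= n^3 h^3, and
    one factor n beats C / h^3. *)
Lemma ex_pow2_powR_ge_sqr {R : realType} (e C : R) : 0 < e ->
  exists n0, forall n, (n0 <= n)%N -> C * n%:R ^+ 2 <= (2 ^+ n) `^ e.
Proof.
move=> e0; pose b : R := 2 `^ (e / 3); pose h := b - 1.
have b1 : 1 < b.
  rewrite /b [ltLHS](_ : 1 = 1 `^ (e / 3)); last by rewrite powR1.
  by apply: gt0_ltr_powR; rewrite ?divr_gt0 ?nnegrE ?ltr1n.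
have h0 : 0 < h by rewrite subr_gt0.
have bern n : 1 + n%:R * h <= b ^+ n.
  elim: n => [|n IH]; first by rewrite mul0r addr0 expr0.
  rewrite exprS (_ : b = 1 + h); last by rewrite /h; lra.
  have n0 : 0 <= n%:R :> R by [].
  have b0 : 0 <= (1 + h) by lra.
  apply: le_trans (ler_wpM2l b0 _); last first.
    by rewrite (_ : 1 + h = b); [exact: IH|rewrite /h; lra].
  rewrite -natr1; nra.
exists (Num.truncn (C / h ^+ 3)).+1 => n nC.
have Cn : C <= n%:R * h ^+ 3.
  rewrite -ler_pdivrMr ?exprn_gt0//.
  by apply: le_trans (ltW (truncnS_gt _)) _; rewrite ler_nat.
have -> : (2 ^+ n) `^ e = (b ^+ n) ^+ 3.
  rewrite pow2_powR -exprM mulnC exprM; congr (_ ^+ n).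
  by rewrite -powR_mulrn ?powR_ge0// -powRrM divfK.
have nh : 0 <= n%:R * h by rewrite mulr_ge0// ltW.
apply: (@le_trans _ _ ((n%:R * h) ^+ 3)).
  rewrite exprMn; apply: le_trans (ler_wpM2r (sqr_ge0 _) Cn) _.
  by rewrite mulrAC -exprS.
by apply: lerXn2r; rewrite ?nnegrE ?(le_trans nh)//; have := bern n; lra.
Qed.

Section digit_cube_net.
Context {R : realType} {d : nat}.
Local Notation side := (@cube_side R d).

(** Along the forced positions an admissible string of length [q] is one of length [n] followed by
    zeros, so the left endpoints of level [q] are those of net points of level [n]. *)
Lemma digit_cube_near_net free (n q : nat) (x : 'rV[R]_d) : (n <= q)%N ->
    (forall i, (n <= i < q)%N -> ~~ free i) ->
  digit_cube free 0 side x -> near_net n q (chart x).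
Proof.
move=> nq forced xK; exists x.
  by split => //; exact: (digit_cube_sub (@side_gt0 R d) xK).
have s0 := @side_gt0 R d.
have p2 i : 0 < 2 ^+ i :> R by rewrite exprn_gt0.
have H j : exists w : 'I_(2 ^ n), `|x ord0 j - side * (w%:R / 2 ^+ n)| <= 2 ^- q.
  have [z zq] := xK j q I; rewrite mxE subr0 in zq *.
  rewrite /= in_itv/= => /andP[zx xz].
  have forced' i : (n <= i < n + (q - n))%N -> ~~ free i by rewrite subnKC//; exact: forced.
  have zq' : z \in digits free (n + (q - n)) by rewrite subnKC.
  have /dvdnP[w zw] := digits_forced forced' zq'.
  have wn : (w < 2 ^ n)%N.
    have := digits_lt zq; rewrite zw -[X in (_ < 2 ^ X)%N](subnKC nq) expnD.
    by rewrite ltn_pmul2r// expn_gt0.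
  exists (Ordinal wn) => /=.
  have wz : z%:R / 2 ^+ q = w%:R / 2 ^+ n :> R.
    have -> : 2 ^+ q = 2 ^+ n * 2 ^+ (q - n) :> R by rewrite -exprD subnKC.
    by rewrite zw natrM natrX -mulf_div divff ?mulr1// gt_eqF.
  rewrite wz in zx.
  have xs : x ord0 j = side * (x ord0 j / side) by rewrite mulrC divfK// gt_eqF.
  rewrite {1}xs -mulrBr normrM (gtr0_norm s0) -[leRHS]mul1r; apply: ler_pM => //.
  - exact: ltW.
  - by rewrite /cube_side /patch_width invf_le1// ler1n.
  - rewrite ger0_norm ?subr_ge0// lerBlDr -wz; apply: le_trans xz _.
    by rewrite -natr1 mulrDl mul1r addrC.
have [f Hf] := choice H; exists [ffun j => f j] => j.
by rewrite mxE ffunE.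
Qed.

End digit_cube_net.

Section sparse.
Variables (N Q : nat -> nat).
Hypothesis Q0 : Q 0%N = 0%N.
Hypothesis QN : forall k, (Q k < N k)%N.
Hypothesis NQ : forall k, (N k <= Q k.+1)%N.

Definition sparse_free : pred nat := fun i => `[< ~ exists k, (N k <= i < Q k.+1)%N >].

Lemma sparse_Q_homo : {homo Q : i j / (i <= j)%N}.
Proof.
apply: homo_leq => //; first exact: leq_trans.
by move=> k; apply: leq_trans (NQ k); exact: ltnW.
Qed.

Lemma sparse_Q_ge k : (k <= Q k)%N.
Proof.
elim: k => // k IH; apply: leq_trans (NQ k); exact: leq_ltn_trans IH (QN k).
Qed.

Lemma sparse_free_false k i : (N k <= i < Q k.+1)%N -> ~~ sparse_free i.
Proof. by move=> ki; apply/negP => /asboolP; apply; exists k. Qed.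

Lemma sparse_free_true k i : (Q k <= i < N k)%N -> sparse_free i.
Proof.
move=> /andP[Qi iN]; apply/asboolP => -[j /andP[Nj jQ]].
have [jk|kj] := ltnP j k.
  by have := leq_trans jQ (leq_trans (sparse_Q_homo jk) Qi); rewrite ltnn.
have : (N k <= N j)%N.
  move: kj; rewrite leq_eqVlt => /predU1P[->//|kj].
  exact: leq_trans (NQ k) (leq_trans (sparse_Q_homo kj) (ltnW (QN j))).
by move=> /(leq_trans iN)/leq_trans/(_ Nj); rewrite ltnn.
Qed.

Lemma nfree_sparse k m : (Q k + m <= N k)%N ->
  nfree sparse_free (Q k + m) = (nfree sparse_free (Q k) + m)%N.
Proof.
elim: m => [|m IH]; first by rewrite !addn0.
rewrite addnS => km; rewrite nfreeS IH; last exact: ltnW.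
by rewrite (@sparse_free_true k) ?leq_addr// addn1 addnS.
Qed.

(** On a free stretch the count grows with slope 1, at least [tau]. On a forced block the bound is
    needed only at the end, where by hypothesis the preceding free stretch alone provides it. *)
Lemma nfree_sparse_ge {R : realType} (tau : R) : 0 <= tau <= 1 ->
    (forall k, tau * (Q k.+1)%:R <= (N k - Q k)%:R) ->
  forall p, tau * p%:R <= (nfree sparse_free p)%:R.
Proof.
move=> /andP[t0 t1] tQ p.
suff H k : forall p, (p <= Q k)%N -> tau * p%:R <= (nfree sparse_free p)%:R.
  exact: H (sparse_Q_ge p).
elim: k => [|k IH] {}p; first by rewrite Q0 leqn0 => /eqP ->; rewrite mulr0.
move=> pQ; have [/IH//|Qp] := leqP p (Q k).
have [pN|Np] := leqP p (N k).
  have [m pm] : exists m, p = (Q k + m)%N by exists (p - Q k)%N; rewrite subnKC// ltnW.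
  rewrite pm in pN *; rewrite nfree_sparse//.
  have := IH _ (leqnn (Q k)); rewrite !natrD mulrDr => h; apply: lerD => //.
  by rewrite ler_piMl.
apply: le_trans (ler_wpM2l t0 (_ : p%:R <= (Q k.+1)%:R)) _; first by rewrite ler_nat.
apply: le_trans (tQ k) _; rewrite ler_nat.
apply: leq_trans (nfree_le sparse_free (ltnW Np)).
rewrite -[X in nfree _ X](subnKC (ltnW (QN k))) nfree_sparse ?leq_addl//.
by rewrite subnKC// ltnW.
Qed.

End sparse.

Section spectrum.
Context {R : realType} {d : nat}.
Hypothesis d_gt0 : (0 < d)%N.
Local Notation sigma := (sigma R d).
Local Notation L1 u := (sigma.-integrable setT (EFin \o u)).
Variable u : sphere R d -> R.
Hypothesis u1 : L1 u.

Definition order_at (y : sphere R d) : \bar R := growth_order (fun r => poisson r u y).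

Definition level (b : R) : set (sphere R d) := [set y | order_at y = b%:E].

Lemma hausdorff_level_eq0 (b s : R) : 0 <= b -> 0 <= s -> d%:R - b < s ->
  hausdorff_measure s (level b) = 0%E.
Proof.
move=> b0 s0 bs.
move: bs; have [->|bn0] := eqVneq b 0 => bs.
  (* Order 0 is out of reach of [hausdorff_growth_order_gt], which needs [g > 0]; here [s] exceeds
     the dimension of the whole sphere. *)
  apply/eqP; rewrite eq_le hausdorff_measure_ge0 andbT.
  rewrite -(@hausdorff_measure_gt_dim _ (sphere R d) d%:R s setT).
  - exact: le_hausdorff_measure.
  - by rewrite ler0n/=; move: bs; rewrite subr0.
  - exact: hausdorff_sphere_lty.
have {}b0 : 0 < b by rewrite lt_neqAle eq_sym bn0.
(* Positive, below [b], and above [d%:R - s] as the midpoint of the latter and [b] is. *)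
pose g := Num.max (b / 2) ((b + (d%:R - s)) / 2).
have g0 : 0 < g by rewrite lt_max divr_gt0.
have gb : g < b by rewrite gt_max; apply/andP; split; lra.
have gs : d%:R - g < s.
  have : (b + (d%:R - s)) / 2 <= g by rewrite le_max lexx orbT.
  by lra.
apply/eqP; rewrite eq_le hausdorff_measure_ge0 andbT.
rewrite -(hausdorff_growth_order_gt u1 g0 s0 gs).
by apply: le_hausdorff_measure => y /= yb; rewrite -/(order_at y) yb lte_fin.
Qed.

Lemma hausdorff_dim_level_le (b : R) : 0 <= b <= d%:R ->
  (hausdorff_dim (level b) <= (d%:R - b)%:E)%E.
Proof.
move=> /andP[b0 bd]; apply/lee_addgt0Pr => e e0.
apply: ereal_inf_lbound; exists (d%:R - b + e) => //; split; first by lra.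
by apply: hausdorff_level_eq0 => //; lra.
Qed.

(* The points of order greater than [b] form a countable union of sets of
   dimension less than [d - b]. *)
Lemma hausdorff_level_gt0 (b : R) : 0 <= b <= d%:R ->
    (0 < hausdorff_measure (d%:R - b) [set y | (b%:E <= order_at y)%E])%E ->
  (0 < hausdorff_measure (d%:R - b) (level b))%E.
Proof.
move=> /andP[b0 bd] H0; rewrite lt_neqAle hausdorff_measure_ge0 andbT.
apply/eqP => /esym Hb; move: H0; rewrite ltNge => /negP; apply.
pose F k := [set y | ((b + k.+1%:R^-1)%:E < order_at y)%E].
have F0 k : hausdorff_measure (d%:R - b) (F k) = 0%E.
  have k0 : 0 < k.+1%:R^-1 :> R by rewrite invr_gt0.
  apply: (hausdorff_growth_order_gt (g := b + k.+1%:R^-1) u1);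
    by move: k0; move: (k.+1%:R^-1) => x; lra.
have cov : [set y | (b%:E <= order_at y)%E] `<=` level b `|` \bigcup_k F k.
  move=> y /=; rewrite le_eqVlt => /predU1P[yb|yb]; first by left.
  right; have [k bk] : exists k, ((b + k.+1%:R^-1)%:E < order_at y)%E.
    case: (order_at y) yb => [x||] //; last by move=> _; exists 0%N; rewrite ltry.
    rewrite lte_fin => bx; exists (Num.truncn (x - b)^-1).
    rewrite lte_fin -ltrBrDl invf_plt ?posrE ?subr_gt0//.
    exact: truncnS_gt.
  by exists k.
apply: le_trans (le_hausdorff_measure _ cov) _.
apply: le_trans (outer_measureU2 (hausdorff_measure (d%:R - b)) _ _) _.
rewrite [X in (X + _)%E]Hb add0e.
apply: le_trans (@hausdorff_measure_sigma_subadditive _ _ (d%:R - b) F) _.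
by rewrite eseries0// => i _ _; exact: F0.
Qed.

(** Positive measure in dimension d - b excludes measure zero in every smaller one. At b = d there
    is no smaller nonnegative dimension. *)
Lemma hausdorff_dim_level (b : R) : 0 <= b <= d%:R ->
    (b < d%:R -> (0 < hausdorff_measure (d%:R - b) [set y | (b%:E <= order_at y)%E])%E) ->
  hausdorff_dim (level b) = (d%:R - b)%:E.
Proof.
move=> bd H; apply/eqP; rewrite eq_le hausdorff_dim_level_le//=.
apply: le_ereal_inf_tmp => _ [s [s0 Hs] <-]; rewrite lee_fin leNgt; apply/negP => sd.
have := hausdorff_level_gt0 bd (H _).
rewrite (@hausdorff_measure_gt_dim _ _ s) ?Hs ?ltry ?ltxx//; last by rewrite s0.
have bd1 : b < d%:R by lra.
by move=> /(_ bd1).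
Qed.

Lemma order_at_ge (b : R) y :
    (forall g n0, g < b -> exists2 n, (n0 <= n)%N &
      (2 ^+ n) `^ g <= `|poisson (1 - 2 ^- n) u y|) ->
  (b%:E <= order_at y)%E.
Proof.
move=> H; apply: growth_order_ge => g r0 gb r01.
have [n0 Hn0] := @ex_pow2_powR_ge R 1 ((1 - r0)^-1 + 1) ltr01.
have [n nn0 Hn] := H g n0 gb.
have p2 : 0 < 2 ^+ n :> R by rewrite exprn_gt0.
exists (1 - 2 ^- n).
  apply/andP; split; last by rewrite ltrBlDr ltrDl invr_gt0.
  rewrite ltrBrDr addrC -ltrBrDr invf_plt ?posrE ?subr_gt0//.
  by have := Hn0 n nn0; rewrite powRr1 ?(ltW p2)//; lra.
rewrite opprB addrCA subrr addr0.
suff -> : (2 ^- n) `^ (- g) = (2 ^+ n) `^ g by [].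
by rewrite -(powR_inv1 (ltW p2)) -powRrM mulN1r opprK.
Qed.

Hypothesis u_growth : forall N, exists n, [/\ (N <= n)%N, (0 < n)%N & stable_growth n u].

(** Off [low_growth] the Poisson integral is at least a constant over n, hence at least 2^(n g) for
    each g < 0 and n large. The points where this recurs infinitely often contain the upper limit of
    sets of at least half the measure of [cap]. *)
Lemma hausdorff_order_ge0 :
  (0 < hausdorff_measure d%:R [set y | (0%:E <= order_at y)%E])%E.
Proof.
have [n_ Hn] := choice u_growth.
pose B k := cap `\` low_growth (n_ k) (growth_threshold R d (n_ k) / 2) u.
have mL k : measurable (low_growth (n_ k) (growth_threshold R d (n_ k) / 2) u).
  exact: low_growth_measurable.
have mB k : measurable (B k) by apply: measurableD => //; exact: cap_measurable.
have capfin := fin_num_measure sigma cap (@cap_measurable R d).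
have cap0 : (0 < sigma cap)%E.
  by apply: sigma_gt0 => //; exact: (hausdorff_chart_cube_gt0 d_gt0 (@side_gt0 R d)).
have Bge k : (sigma cap * 2^-1%:E <= sigma (B k))%E.
  have [_ _ [_ low]] := Hn k.
  have Lfin := fin_num_measure sigma _ (mL k).
  rewrite measureD//; [|exact: cap_measurable|by rewrite -ge0_fin_numE].
  rewrite setIidr; last by move=> y [].
  rewrite leeBrDr//; apply: le_trans (leeD2l _ low) _.
  rewrite -[leRHS](fineK capfin) -[X in (X * _ + _)%E](fineK capfin).
  by rewrite -[X in (_ + X * _)%E](fineK capfin) -EFinM -EFinD lee_fin; lra.
have Bsup : (0 < sigma (lim_sup_set B))%E.
  apply: (@lt_le_trans _ _ (sigma cap * 2^-1%:E)%E); first by rewrite mule_gt0// lte_fin.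
  have cvgB := lim_sup_set_cvg sigma B mB.
  have fB : (sigma (\bigcup_(k in [set k | (0 <= k)%N]) B k) < +oo)%E.
    rewrite -ge0_fin_numE//; apply: fin_num_measure.
    by apply: bigcup_measurable => k _; exact: mB.
  have {}cvgB := cvgB fB.
  rewrite -(cvg_lim _ cvgB)//; apply: lime_ge; first by apply/cvg_ex; eexists; exact: cvgB.
  apply: nearW => n; apply: le_trans (Bge n) _.
  apply: le_measure; rewrite ?inE//.
    by apply: bigcup_measurable => k _; exact: mB.
  by move=> y By; exists n => //=.
have sub : lim_sup_set B `<=` [set y | (0%:E <= order_at y)%E].
  move=> y By /=; apply: order_at_ge => g n0 g0.
  pose c : R := net_const R d / 4.
  have c0 : 0 < c by rewrite divr_gt0 ?net_const_gt0.
  have ng0 : 0 < - g by rewrite oppr_gt0.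
  have [n1 Hn1] := @ex_pow2_powR_ge_sqr R (- g) c^-1 ng0.
  have [k /= kn [Ay ylow]] := By (maxn n0 n1) I.
  have [nk nk0 _] := Hn k.
  have nkR : 0 < (n_ k)%:R :> R by rewrite ltr0n.
  exists (n_ k); first exact: leq_trans (leq_maxl _ _) (leq_trans kn nk).
  have P_ge : c / (n_ k)%:R <= `|poisson (1 - 2 ^- n_ k) u y|.
    rewrite leNgt; apply/negP => lt; apply: ylow; split => //.
    by apply: lt_le_trans lt _; rewrite /growth_threshold /c; lra.
  apply: le_trans P_ge.
  have := Hn1 (n_ k) (leq_trans (leq_maxr _ _) (leq_trans kn nk)).
  rewrite powRN => h.
  have h2 : c^-1 * (n_ k)%:R <= ((2 ^+ n_ k) `^ g)^-1.
    apply: le_trans h; rewrite ler_wpM2l ?invr_ge0 ?(ltW c0)//.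
    by rewrite expr2 ler_peMl ?(ltW nkR)// ler1n.
  rewrite -[leLHS]invrK -[leRHS]invrK lef_pV2 ?posrE ?invr_gt0 ?powR_gt0 ?exprn_gt0 ?(divr_gt0 c0)//.
  by rewrite invfM invrK.
apply: lt_le_trans (le_hausdorff_measure _ sub).
rewrite lt_neqAle hausdorff_measure_ge0 andbT; apply/eqP => /esym H0.
by move: Bsup; rewrite (sigma_eq0 d_gt0 H0) ltxx.
Qed.

End spectrum.

(** * Orders strictly between 0 and d *)

Section intermediate.
Context {R : realType} {d : nat}.
Hypothesis d_gt0 : (0 < d)%N.
Variable u : sphere R d -> R.
Hypothesis u_growth : forall N, exists n, [/\ (N <= n)%N, (0 < n)%N & stable_growth n u].
Variable b : R.
Hypothesis bd : 0 < b < d%:R.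

Let b0 : 0 < b. Proof. by case/andP: bd. Qed.
Let dR : 0 < d%:R :> R. Proof. by rewrite ltr0n. Qed.

(** The share of free digits for which the Cantor set has dimension tau d = d - b. *)
Definition free_density : R := (d%:R - b) / d%:R.
Local Notation tau := free_density.

Lemma free_density_gt0 : 0 < tau.
Proof. by rewrite divr_gt0//; case/andP: bd; lra. Qed.

Lemma free_density_lt1 : tau < 1.
Proof. by rewrite ltr_pdivrMr// mul1r; case/andP: bd; lra. Qed.

Lemma free_densityE : tau * d%:R = d%:R - b.
Proof. by rewrite divfK// gt_eqF. Qed.

(** One stage of the Cantor construction: positions from [q] to [p.1] are free, those from [p.1] to
    [p.2] forced. Taking [p.2] as large as the density [tau] permits yields growth 2^(b p.2) up to a
    factor depending on [q]; as [q] is fixed before [p.1], the small loss in the exponent absorbs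
    it. *)
Lemma sparse_step q k : exists p : nat * nat, [/\ (q < p.1)%N, (p.1 <= p.2)%N,
  tau * p.2%:R <= (p.1 - q)%:R &
  forall y, near_net p.1 p.2 y ->
    (2 ^+ p.2) `^ (b - b / k.+1%:R) <= `|poisson (1 - 2 ^- p.2) u y|].
Proof.
have t0 := free_density_gt0; have t1 := free_density_lt1.
have e0 : 0 < b / k.+1%:R by rewrite divr_gt0.
have eb : b / k.+1%:R <= b by rewrite ler_pdivrMr// ler_peMr ?(ltW b0)// ler1n.
set e := b / k.+1%:R in e0 eb *.
have kap0 := @net_const_gt0 R d.
have p2 i : 0 < 2 ^+ i :> R by rewrite exprn_gt0.
have [n1 Hn1] := @ex_pow2_powR_ge_sqr R e (4 * 2 ^+ (q.+1 * d) / net_const R d) e0.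
(* Apart from the growth estimate, [n] must exceed q / (1 - tau), which gives n <= q', and 1 / tau,
   which gives q' <= n^2. *)
have [n [Nn n0 [ng _]]] := u_growth (maxn (maxn n1 q.+1)
  (maxn (Num.truncn (q%:R / (1 - tau))).+1 (Num.truncn tau^-1).+1)).
have n1n : (n1 <= n)%N by apply: leq_trans Nn; rewrite !leq_max leqnn.
have qn : (q < n)%N by apply: leq_trans Nn; rewrite !leq_max leqnn orbT.
have tn : tau * n%:R <= n%:R - q%:R.
  have h : q%:R / (1 - tau) <= n%:R.
    apply: le_trans (ltW (truncnS_gt _)) _; rewrite ler_nat.
    by apply: leq_trans Nn; rewrite !leq_max leqnn !orbT.
  by move: h; rewrite ler_pdivrMr ?subr_gt0// mulrBr mulr1 [n%:R * _]mulrC; lra.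
have tn2 : tau^-1 <= n%:R.
  apply: le_trans (ltW (truncnS_gt _)) _; rewrite ler_nat.
  by apply: leq_trans Nn; rewrite !leq_max leqnn !orbT.
pose x := (n%:R - q%:R) / tau; pose q' := Num.truncn x.
have x0 : 0 <= x by rewrite divr_ge0 ?(ltW t0)// subr_ge0 ler_nat ltnW.
have /andP[q'x xq'] := truncn_itv x0.
have nq' : (n <= q')%N by rewrite truncn_ge_nat// ler_pdivlMr// mulrC.
have nR : 1 <= n%:R :> R by rewrite ler1n.
have q'n : (q' <= n * n)%N.
  rewrite -(ler_nat R) (le_trans q'x)// natrM /x; apply: ler_pM => //.
  - by rewrite subr_ge0 ler_nat ltnW.
  - by rewrite invr_ge0 ltW.
  - by rewrite lerBlDr lerDl.
exists (n, q'); split => //=.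
  rewrite natrB ?(ltnW qn)// mulrC -ler_pdivlMr//.
move=> y yq; have nqn : (n <= q' <= n * n)%N by rewrite nq'.
apply: le_trans (ng q' y nqn yq).
set V := (2 ^+ q') `^ (b - e).
have V1 : 1 <= V.
  rewrite -[leLHS](powRr0 (2 ^+ q')); apply: ler_powR; last by rewrite subr_ge0.
  by rewrite exprn_ege1// ler1n.
have WVE : (2 ^+ q') `^ b = V * (2 ^+ q') `^ e.
  by rewrite -powRD ?subrK// gt_eqF ?implybT.
(* Truncation gives n <= q + tau (q' + 1); multiplied by d, this costs at most (q + 1) d in the
   exponent. *)
have ratio : (2 ^+ q') `^ b / 2 ^+ (q.+1 * d) <= 2 ^+ (q' * d) / 2 ^+ (n * d).
  rewrite ler_pdivrMr// mulrAC ler_pdivlMr// -exprD.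
  rewrite -(@powR_mulrn _ 2 (n * d))// -(@powR_mulrn _ 2 (q' * d + _))//.
  rewrite pow2_powR -powR_mulrn ?powR_ge0// -powRrM -powRD; last by rewrite pnatr_eq0 implybT.
  apply: ler_powR; first by rewrite ler1n.
  have nx : n%:R <= q%:R + tau * (q'%:R + 1).
    move: xq'; rewrite /x ltr_pdivrMr// -/q' -natr1 mulrC => /ltW; lra.
  have -> : (q' * d + q.+1 * d)%:R = q'%:R * d%:R + (q%:R + 1) * d%:R :> R.
    by rewrite natr1 -!natrM -natrD.
  rewrite natrM.
  have : n%:R * d%:R <= (q%:R + tau * (q'%:R + 1)) * d%:R by rewrite ler_pM2r.
  rewrite mulrDl -[tau * _ * _]mulrAC free_densityE.
  have : (d%:R - b) * (q'%:R + 1) = d%:R * q'%:R - b * q'%:R + d%:R - b by ring.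
  move=> -> h; have := b0; lra.
have gt2 : 2 * growth_threshold R d n = net_const R d / n%:R.
  by rewrite /growth_threshold mulrC divfK.
rewrite gt2.
have q'1 : 1 <= q'%:R :> R by rewrite ler1n (leq_trans n0).
have nq'R : n%:R <= q'%:R :> R by rewrite ler_nat.
(* The factor 4 q' leaves room for the subtracted [n%:R] and 1, each at most q' V. *)
have main : 4 * q'%:R * V <= net_const R d / n%:R * (2 ^+ (q' * d) / 2 ^+ (n * d)).
  apply: le_trans (ler_wpM2l _ ratio); last by rewrite divr_ge0 ?(ltW kap0).
  have := Hn1 q' (leq_trans n1n nq'); rewrite WVE.
  set E := (2 ^+ q') `^ e; set P := 2 ^+ (q.+1 * d); set kap := net_const R d => hE.
  have P0 : 0 < P by exact: p2.
  have -> : kap / n%:R * (V * E / P) = V * ((kap / P * E) / n%:R) by ring.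
  rewrite mulrC ler_wpM2l ?(le_trans ler01)// ler_pdivlMr ?(lt_le_trans ltr01)//.
  apply: (@le_trans _ _ (kap / P * (4 * P / kap * q'%:R ^+ 2))); last first.
    by rewrite ler_wpM2l// divr_ge0// ltW.
  rewrite (_ : kap / P * (4 * P / kap * q'%:R ^+ 2) = 4 * q'%:R * q'%:R).
    by rewrite ler_wpM2l// mulr_ge0// (le_trans ler01).
  by field; rewrite !gt_eqF.
have : q'%:R <= q'%:R * V by rewrite ler_peMr ?(le_trans ler01).
have : V <= q'%:R * V by rewrite ler_peMl ?(le_trans ler01).
by move: main; rewrite -mulrA; lra.
Qed.

Lemma hausdorff_order_ge_gt0 :
  (0 < hausdorff_measure (d%:R - b) [set y | (b%:E <= order_at u y)%E])%E.
Proof.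
have [f Hf] := choice (fun p : nat * nat => sparse_step p.1 p.2).
(* Stage [k] starts where the previous one ended and aims at the exponent b - b / (k + 1), which
   tends to [b]. *)
pose Q := fix Q k := if k is k'.+1 then (f (Q k', k')).2 else 0%N.
pose N k := (f (Q k, k)).1.
have QN k : (Q k < N k)%N by have [] := Hf (Q k, k).
have NQ k : (N k <= Q k.+1)%N by have [] := Hf (Q k, k).
have tQ k : tau * (Q k.+1)%:R <= (N k - Q k)%:R by have [] := Hf (Q k, k).
have t0 := free_density_gt0; have t1 := free_density_lt1.
have dens := @nfree_sparse_ge N Q erefl QN NQ R tau _ tQ.
have cubeQ : chart_cube (0 : 'rV[R]_d) (@cube_side R d) `<=` base_cube by move=> x.
have := hausdorff_digit_cube_gt0 d_gt0 t0 (dens _) (@side_gt0 R d) cubeQ.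
rewrite free_densityE => /(_ _)/lt_le_trans; apply; first by rewrite !ltW.
apply: le_hausdorff_measure => _ [x xK <-] /=.
apply: order_at_ge => g n0 gb.
pose k := maxn n0 (Num.truncn (b / (b - g))).
have gk : g <= b - b / k.+1%:R.
  have bg : 0 < b - g by rewrite subr_gt0.
  have : b / (b - g) < k.+1%:R.
    by apply: lt_le_trans (truncnS_gt _) _; rewrite ler_nat ltnS leq_maxr.
  by rewrite ltr_pdivrMr// mulrC -ltr_pdivrMr//; move: (b / k.+1%:R) => x'; lra.
exists (Q k.+1).
  by apply: leq_trans (sparse_Q_ge QN NQ k.+1); rewrite ltnW// ltnS leq_maxl.
have [_ _ _ /(_ (chart x))] := Hf (Q k, k).
move=> /(_ (digit_cube_near_net _ _ xK)); rewrite -/(N k) -/(Q k.+1) => H.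
apply: le_trans (H _ _) => //; last by move=> i; exact: sparse_free_false.
by apply: ler_powR => //; rewrite exprn_ege1// ler1n.
Qed.

End intermediate.

Theorem theorem2 (R : realType) (d : nat) (d_ge1 : (1 <= d)%N) :
  residual [set f : LspaceType1 (sigma R d) |
    forall beta : R, 0 <= beta <= d%:R ->
      hausdorff_dim (divergence_set beta f) = (d%:R - beta)%:E].
Proof.
have [F [Fod FG]] := @residual_stable_growth R d d_ge1.
exists F; split => // f /FG fgrowth beta bd.
have f1 := Lspace_integrable f.
(* [divergence_set] is by conversion [level] for the representative of [f]. *)
apply: (hausdorff_dim_level f1 bd) => bltd.
have [->|bn0] := eqVneq beta 0.
  by rewrite subr0; exact: (hausdorff_order_ge0 d_ge1 f1 fgrowth).
apply: (hausdorff_order_ge_gt0 d_ge1 fgrowth).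
by rewrite bltd andbT lt_neqAle eq_sym bn0; case/andP: bd.
Qed.
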